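(* For a finite subgroup $\widetilde W$ of $GL_2(\mathbf{C})$ containing $-1$, let $\varphi(\widetilde W)\simeq\widetilde W/\{1,-1\}$ be its image in $GL(V)$, where $V$ is the 3-dimensional tangent space at $0$ to $\mathbf{C}^2/\{1,-1\}$. The correspondence $\widetilde W\mapsto\varphi(\widetilde W)$ induces a bijection between - the set of conjugacy classes of finite subgroups of $GL_2(\mathbf{C})$ generated by reflections of order $2$ and containing $-1$, and - the set of conjugacy classes of non-trivial finite subgroups of $GL_3(\mathbf{R})$ generated by reflections, that is, the set of isomorphism classes of finite Coxeter groups of rank between $1$ and $3$. (Here the finite subgroup $\varphi(\widetilde W)$ preserves a non-degenerate quadratic form $R$ on $V$ and stabilizes a real structure on $V$, by which it is viewed as a subgroup of $GL_3(\mathbf{R})$.)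
   Context: Let $(X,Y)$ be the standard coordinates on $\mathbf{C}^2$ and $G=\{1,-1\}\subset GL_2(\mathbf{C})$. The algebra $\mathbf{C}[X,Y]^G$ is generated by $p_1=XY$, $p_2=X^2$, $p_3=Y^2$. The tangent space $V$ to $\mathbf{C}^2/G=\operatorname{Spec}\mathbf{C}[X,Y]^G$ at $0$ is the 3-dimensional space dual to the span of $p_1,p_2,p_3$; $\varphi:GL_2(\mathbf{C})\to GL(V)$ is the natural homomorphism, with kernel $\{1,-1\}$. Let $X_1,X_2,X_3$ be the coordinates on $V$ corresponding to $p_1,p_2,p_3$, and let $R=X_1^2-X_2X_3$, the quadratic form on $V$ generating the ideal of relations. A reflection is an automorphism of finite order whose fixed space is a hyperplane. ''Isomorphism classes of Coxeter groups'' means classes of Coxeter groups as Coxeter systems. *)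

(* Defs.v *)
From HB Require Import structures.
From mathcomp Require Import all_boot all_order all_algebra all_fingroup.
From mathcomp Require Import complex mpoly ring.
From mathcomp Require Import boolp classical_sets functions cardinality reals.

Set Implicit Arguments.
Unset Strict Implicit.
Unset Printing Implicit Defensive.

Import Order.TTheory GRing.Theory Num.Theory.
Local Open Scope classical_set_scope.
Local Open Scope ring_scope.

(* Matrices act on column vectors, v |-> g *m v.  Subsets of a matrix ring are
   classical sets; [f @` A] is the direct image. *)

Section LinearGroups.
Variables (F : fieldType) (n : nat).
Implicit Types (g s : 'M[F]_n.+1) (G H : set 'M[F]_n.+1).

Definition linear_group G : Prop :=
  [/\ G `<=` [set g | g \is a GRing.unit],
      G 1,
      forall g h, G g -> G h -> G (g * h)
    & forall g, G g -> G g^-1].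

(* The column space of [cokermx (g - 1)] is [{v | g *m v = v}], so the rank
   condition says that the fixed space is a hyperplane. *)
Definition reflection g : Prop :=
  (exists2 k, (0 < k)%N & g ^+ k = 1) /\ \rank (cokermx (g - 1)) = n.

Definition order2_reflection g : Prop :=
  [/\ reflection g, g <> 1 & g ^+ 2 = 1].

Definition generated_by (P : 'M[F]_n.+1 -> Prop) G : Prop :=
  exists2 E : set 'M[F]_n.+1, E `<=` P & G = smallest linear_group E.

Definition conjugate_groups G H : Prop :=
  exists2 x : 'M[F]_n.+1, x \is a GRing.unit
                        & H = (fun g => x * g * x^-1) @` G.

Definition conj_class G : set (set 'M[F]_n.+1) := [set H | conjugate_groups G H].

End LinearGroups.

Section TangentRepresentation.
Variable F : fieldType.

(* Exponents of [p_1 = XY], [p_2 = X^2], [p_3 = Y^2], indexed from 0. *)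
Definition quad_mon (k : 'I_3) : 'X_{1..2} :=
  (tnth [tuple U_(0%R) + U_(1%R); U_(0%R) *+ 2; U_(1%R) *+ 2] k)%MM.

Definition quad_inv (k : 'I_3) : {mpoly F[2]} := 'X_[quad_mon k].

(* [p] composed with the linear map [g] *)
Definition pullback (g : 'M[F]_2) (p : {mpoly F[2]}) : {mpoly F[2]} :=
  p \mPo [tuple \sum_(l < 2) g i l *: 'X_l | i < 2].

(* A tangent vector [xi] is a linear form on the span of the [p_k], with
   coordinates [xi p_k]; [g] sends it to [fun p => xi (pullback g p)]. *)
Definition phi (g : 'M[F]_2) : 'M[F]_3 :=
  \matrix_(j, k) (pullback g (quad_inv j))@_(quad_mon k).

Definition quadR (v : 'cV[F]_3) : F :=
  v (inord 0) 0 ^+ 2 - v (inord 1) 0 * v (inord 2) 0.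

Definition nondegenerate_form (q : 'cV[F]_3 -> F) : Prop :=
  forall u, (forall v, q (u + v) - q u - q v = 0) -> u = 0.

Definition preserves_form (q : 'cV[F]_3 -> F) (G : set 'M[F]_3) : Prop :=
  forall g v, G g -> q (g *m v) = q v.

Lemma quad_mon_inj : injective quad_mon.
Proof.
move=> j k /mnmP E; have := E 0; have := E 1; clear E.
case: j k => [[|[|[|//]]] jlt] [[|[|[|//]]] klt];
  rewrite /quad_mon !(tnth_nth 0%MM) /= ?(mnmDE, mulmnE, mnm1E) //=;
  by move=> *; apply/val_inj.
Qed.

Lemma pullback_quad (g : 'M[F]_2) (j : 'I_3) :
  pullback g (quad_inv j) = \sum_k phi g j k *: quad_inv k.
Proof.
suff [c cE] : exists c : 'I_3 -> F,
    pullback g (quad_inv j) = \sum_k c k *: quad_inv k.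
  rewrite [LHS]cE; apply: eq_bigr => k _; congr (_ *: _).
  rewrite /phi mxE cE raddf_sum /= (bigD1 k) //= big1 => [|l lk].
    by rewrite mcoeffZ mcoeffX eqxx mulr1 addr0.
  by rewrite mcoeffZ mcoeffX (inj_eq quad_mon_inj) (negPf lk) mulr0.
have quadE a b c d : exists e : 'I_3 -> F,
    (a *: 'X_0 + b *: 'X_1) * (c *: 'X_0 + d *: 'X_1)
      = \sum_k e k *: quad_inv k.
  exists (fun k => tnth [tuple a * d + b * c; a * c; b * d] k).
  rewrite !big_ord_recl big_ord0 addr0 /quad_inv /quad_mon.
  rewrite !(tnth_nth 0) !(tnth_nth 0%MM) /= !mpolyXD -!mul_mpolyC.
  by rewrite !mpolyCD !mpolyCM; ring.
pose lin i := \sum_(l < 2) g i l *: 'X_l : {mpoly F[2]}.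
have linE i : lin i = g i 0 *: 'X_0 + g i 1 *: 'X_1.
  rewrite /lin !big_ord_recl big_ord0 addr0.
  by congr (_ + g _ _ *: 'X_ _); apply/val_inj.
have compE i : 'X_i \mPo [tuple lin i | i < 2] = lin i.
  by rewrite comp_mpolyXU -tnth_nth; apply: (tnth_mktuple lin).
rewrite /pullback {1}/quad_inv {1}/quad_mon.
by case: j => [[|[|[|//]]] jlt]; rewrite (tnth_nth 0%MM) /= mpolyXD rmorphM /=
  !compE !linE; apply: quadE.
Qed.

(* [quad_map] is the quotient map from the plane, in the coordinates [p_k]. *)
Definition quad_map (v : 'cV[F]_2) : 'cV[F]_3 :=
  \col_k (quad_inv k).@[fun i => v i 0].

Lemma phi_quad_map (g : 'M[F]_2) (v : 'cV[F]_2) :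
  phi g *m quad_map v = quad_map (g *m v).
Proof.
apply/colP => j; rewrite !mxE.
have -> : (quad_inv j).@[fun i => (g *m v) i 0]
          = (pullback g (quad_inv j)).@[fun i => v i 0].
  rewrite comp_mpoly_meval; apply: meval_eq => i.
  rewrite tnth_mktuple raddf_sum mxE; apply: eq_bigr => l _.
  by rewrite /= mevalZ mevalXU.
rewrite pullback_quad raddf_sum; apply: eq_bigr => k _.
by rewrite /= mevalZ [quad_map v k 0]mxE.
Qed.

End TangentRepresentation.

Section RealStructures.
Variable R : realType.

Definition complexify m n (x : 'M[R]_(m, n)) : 'M[R[i]]_(m, n) :=
  map_mx (real_complex R) x.

(* The real span of the columns of [P] *)
Definition real_span (P : 'M[R[i]]_3) : set 'cV[R[i]]_3 :=
  range (fun x : 'cV[R]_3 => P *m complexify x).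

Definition real_structure (U : set 'cV[R[i]]_3) : Prop :=
  exists2 P, P \is a GRing.unit & U = real_span P.

Definition stabilizes (G : set 'M[R[i]]_3) (U : set 'cV[R[i]]_3) : Prop :=
  forall g u, G g -> U u -> U (g *m u).

(* [H] is the set of matrices of the elements of [G], restricted to some
   [G]-stable real structure, in some basis of that real structure. *)
Definition real_model (G : set 'M[R[i]]_3) (H : set 'M[R]_3) : Prop :=
  exists P : 'M[R[i]]_3,
    [/\ P \is a GRing.unit,
        stabilizes G (real_span P)
      & H = [set h | exists2 g, G g & g *m P = P *m complexify h]].

Definition order2_reflection_groups : set (set 'M[R[i]]_2) :=
  [set W | [/\ linear_group W, finite_set W,
               generated_by (@order2_reflection _ _) W & W (- 1)]].

Definition real_reflection_groups : set (set 'M[R]_3) :=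
  [set H | [/\ linear_group H, finite_set H,
               generated_by (@reflection _ _) H & H <> [set 1]]].

End RealStructures.

(* The last clause says that the generators [S] and the relations
   [(s t)^m(s,t) = 1], with [m(s,t)] the order of [s t], present the group. *)
Definition coxeter_system (gT : finGroupType) (S : {set gT}) : Prop :=
  [/\ <<S>>%g = [set: gT]%SET,
      forall s, s \in S -> #[s]%g = 2%N
    & forall (K : groupType) (f : gT -> K),
        (forall s t, s \in S -> t \in S ->
           ((f s * f t) ^+ #[(s * t)%g])%g = 1%g) ->
        exists F : gT -> K,
          {morph F : x y / (x * y)%g} /\ {in S, F =1 f}].

Record finCoxeter : Type := FinCoxeter {
  cox_group : finGroupType;
  cox_gens : {set cox_group};
  cox_axiom : coxeter_system cox_gens
}.

Definition cox_rank (c : finCoxeter) : nat := #|cox_gens c|.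

Definition cox_iso (c d : finCoxeter) : Prop :=
  exists f : {morphism [set: cox_group c]%SET >-> cox_group d},
    isom [set: cox_group c]%SET [set: cox_group d]%SET f /\
    (f @: cox_gens c = cox_gens d)%SET.

(* [finCoxeter] is too large for the universe of [set], so predicates on it are
   plain functions to [Prop] and [set_bij] has to be restated. *)
Definition cox_class (c : finCoxeter) : finCoxeter -> Prop :=
  fun d => cox_iso c d.

Definition small_rank_cox_classes (K : finCoxeter -> Prop) : Prop :=
  exists2 c, (1 <= cox_rank c <= 3)%N & K = cox_class c.

Definition bij_between (X Y : Type) (A : X -> Prop) (B : Y -> Prop)
    (f : X -> Y) : Prop :=
  [/\ forall x, A x -> B (f x),
      forall x y, A x -> A y -> f x = f y -> x = y
    & forall y, B y -> exists2 x, A x & f x = y].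

Section SimpleReflections.
Variables (R : realType) (n : nat).
Implicit Types (H S : set 'M[R]_n.+1).

Definition root_vector H (v : 'cV[R]_n.+1) : Prop :=
  v <> 0 /\ exists s, [/\ H s, reflection s & s *m v = - v].

(* [S] is the set of reflections of [H] attached to a simple system: the columns
   of [A] are linearly independent roots, and the coordinates of every root in
   terms of them are all nonnegative or all nonpositive. *)
Definition simple_reflections H S : Prop :=
  exists r (A : 'M[R]_(n.+1, r)),
    [/\ \rank A = r,
        forall i, root_vector H (col i A),
        forall v, root_vector H v -> exists2 c : 'cV[R]_r, v = A *m c &
          (forall i, 0 <= c i 0) \/ (forall i, c i 0 <= 0)
      & S = [set s | [/\ H s, reflection s
                       & exists i, s *m col i A = - col i A]]].

(* [H], with a set of simple reflections, is isomorphic to [c]. *)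
Definition coxeter_model H (c : finCoxeter) : Prop :=
  exists rho : cox_group c -> 'M[R]_n.+1,
    [/\ forall x y, rho (x * y)%g = rho x * rho y,
        injective rho,
        range rho = H
      & simple_reflections H (rho @` [set` cox_gens c])].

End SimpleReflections.

(* Main.v *)
(** The quadratic form [R] identifies [{g | det g = 1 or det g = -1}] modulo
    [{1, -1}] with the complex orthogonal group of [R]: an isometry moves the
    rulings of the cone [R = 0], and these are the images of the lines of the
    plane.  A reflection lifts to two reflections [s] and [- s] of order 2, so a
    group [W] as in the statement is the full preimage of [phi W].  Unitarizing
    [W] exhibits a stable real structure, and two subgroups of the orthogonal
    group that are conjugate by [x] in [GL_3] are conjugate by an isometry: with
    [A] the matrix of the form [x^* R] relative to [R], take [x B^-1] where [B]
    is a square root of [A] that is a polynomial in [A].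

    For the Coxeter side, Tits' positivity argument is run on words in the
    generators modulo a congruence compatible with the representation.  Applied
    to equality in an abstract Coxeter group it shows that the geometric
    representation is faithful; applied to equality in an arbitrary group that
    satisfies the Coxeter relations it gives the presentation of a real
    reflection group.  The angle of two simple roots is [pi - pi / m], as
    otherwise some root in their plane would have coordinates of both signs, so
    the Coxeter system determines the Gram matrix of the simple roots. *)

Require Import Defs.
From HB Require Import structures.
From mathcomp Require Import all_boot all_order all_algebra all_fingroup.
From mathcomp Require mpoly.
From mathcomp Require Import cyclic complex ring lra zify.
From mathcomp Require Import boolp classical_sets functions cardinality reals trigo.

Set Implicit Arguments.
Unset Strict Implicit.
Unset Printing Implicit Defensive.

Import Order.TTheory GRing.Theory Num.Theory.
Local Open Scope classical_set_scope.
Local Open Scope ring_scope.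

(** * Linear groups and reflections *)

(** An abstract finite Coxeter system comes without a positive definite form, so its representation
    cannot start from a Euclidean space. The simple roots are taken to be coordinate vectors of
    [R^3], which is possible because the rank is at most 3, and the remaining coordinates are fixed.
    The matrix group is finite because the abstract group is, and an invariant scalar product is
    obtained afterwards by averaging. For this reason the positivity argument treats the roots and
    the linear forms of the reflections as separate data.

    On the complex side a group may stabilize several real structures, so the class of its real
    model has to be shown independent of the choice. Two models are conjugate over the complex
    numbers by the change of frame, and a determinant that is a nonzero polynomial in one parameter
    brings the conjugation down to the reals. The frame [real_frame], in which [R] is a sum of three
    squares, turns real orthogonal matrices into isometries of [R]. *)

Section LinearGroupTheory.
Variables (F : fieldType) (n : nat).
Implicit Types (g h s x : 'M[F]_n.+1) (G H E L : set 'M[F]_n.+1).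

Lemma smallest_linear_group E :
  E `<=` [set g | g \is a GRing.unit] ->
  linear_group (smallest (@linear_group F n) E).
Proof.
move=> uE; split.
- apply: smallest_sub => //.
  by split=> //= [|g h|g]; rewrite ?unitr1 ?unitrV // => gU hU; rewrite unitrMr.
- by move=> L [[_ L1 _ _] _].
- by move=> g h Eg Eh L [lL EL]; case: (lL) => _ _ + _; apply; [apply: Eg | apply: Eh].
- by move=> g Eg L [lL EL]; case: (lL) => _ _ _; apply; apply: Eg.
Qed.

(** Serves as an induction principle: [L] is a property stable under the group operations, to be
    checked only on the elements of [G] that satisfy [P]. *)
Lemma generated_by_sub (P : 'M[F]_n.+1 -> Prop) G L :
  generated_by P G -> linear_group L -> G `&` [set g | P g] `<=` L -> G `<=` L.
Proof.
move=> [E EP ->] lL EL; apply: smallest_sub => // g Eg; apply: EL; split; last exact: EP.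
exact: sub_gen_smallest.
Qed.

Lemma generated_by_nontrivial (P : 'M[F]_n.+1 -> Prop) G : linear_group G ->
  generated_by P G -> G <> [set 1] -> exists2 s, G s & P s.
Proof.
move=> [_ G1 _ _] gG nt; apply: contrapT => nex; apply: nt.
rewrite eqEsubset; split; last by move=> _ ->.
apply: (generated_by_sub gG) => [|s [Gs Ps]]; last by case: nex; exists s.
by split=> [_ -> /=|//|_ _ -> -> /=|_ -> /=]; rewrite ?unitr1 ?mulr1 ?invr1.
Qed.

Lemma generated_byI (P : 'M[F]_n.+1 -> Prop) G :
  linear_group G ->
  (forall L, linear_group L -> G `&` [set g | P g] `<=` L -> G `<=` L) ->
  generated_by P G.
Proof.
move=> lG sG; exists (G `&` [set g | P g]); first by move=> g [].
rewrite eqEsubset; split.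
  apply: sG; last exact: sub_gen_smallest.
  by apply: smallest_linear_group => g [Gg _]; case: lG => + _ _ _; apply.
by apply: smallest_sub => // g [].
Qed.

Lemma finite_order G g :
  linear_group G -> finite_set G -> G g -> exists2 k, (0 < k)%N & g ^+ k = 1.
Proof.
move=> [uG G1 GM _] /finite_seqP[s sG] Gg.
have Gk k : G (g ^+ k) by elim: k => [|k IH]; rewrite ?expr0 // exprS; apply: GM.
have /negP : ~ uniq [seq g ^+ k | k <- iota 0 (size s).+1].
  move=> U; have := uniq_leq_size U (s2 := s); rewrite size_map size_iota ltnn => H.
  have : false by apply: H => _ /mapP[k _ ->]; have := Gk k; rewrite sG.
  by [].
move=> /(uniqPn 0)[i [j [ij]]]; rewrite size_map size_iota => jlt.
rewrite !(nth_map 0%N) ?size_iota ?(ltn_trans ij) // !nth_iota ?(ltn_trans ij) // !add0n.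
move=> eqij; exists (j - i)%N; first by rewrite subn_gt0.
have uX : g ^+ i \is a GRing.unit by rewrite unitrX //; apply: uG.
by apply: (mulrI uX); rewrite -exprD subnKC ?mulr1 // ltnW.
Qed.

(** The last clause reindexes a sum over the group by a right translation, as needed for the
    averaged form. *)
Lemma finite_group_enum G : linear_group G -> finite_set G ->
  exists s : seq 'M[F]_n.+1, [/\ uniq s, forall g, G g <-> g \in s
    & forall h, G h -> perm_eq [seq g * h | g <- s] s].
Proof.
move=> [uG G1 GM GV] /finite_seqP[s sG]; exists (undup s).
have Gs g : G g <-> g \in undup s by rewrite mem_undup sG.
split=> [||h Gh]; [exact: undup_uniq|exact: Gs|].
have uh : h \is a GRing.unit := uG _ Gh.
apply: uniq_perm; rewrite ?map_inj_uniq ?undup_uniq //; first exact: mulIr.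
move=> g; apply/mapP/idP => [[k /Gs Gk ->]|/Gs Gg]; first by apply/Gs/GM.
by exists (g * h^-1); [apply/Gs/GM => //; apply: GV | rewrite mulrVK].
Qed.

Lemma rank1P m p (A : 'M[F]_(m, p)) :
  \rank A = 1%N -> exists (a : 'cV_m) (f : 'rV_p), A = a *m f.
Proof.
move=> rA; rewrite -(mulmx_base A); move: (col_base A) (row_base A).
by rewrite rA => a f; exists a, f.
Qed.

Lemma rank_col_row m p (a : 'cV[F]_m) (f : 'rV_p) : a *m f != 0 -> \rank (a *m f) = 1%N.
Proof.
rewrite -mxrank_eq0 -lt0n => r; apply/eqP; rewrite eqn_leq r andbT.
exact: leq_trans (mxrankM_maxr _ _) (rank_leq_row _).
Qed.

Lemma reflectionE g : reflection g <->
  (exists2 k, (0 < k)%N & g ^+ k = 1) /\ \rank (g - 1) = 1%N.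
Proof.
rewrite /reflection mxrank_coker; have := rank_leq_row (g - 1).
move: (\rank _) => r le; split=> -[fin E]; split=> //; last by rewrite E subn1.
by move: le E; lia.
Qed.

Lemma reflectionP g : reflection g ->
  exists (a : 'cV_n.+1) (f : 'rV_n.+1), g = 1 + a *m f /\ a *m f != 0.
Proof.
move=> /reflectionE[_ r]; have [a [f E]] := rank1P r.
exists a, f; rewrite -E addrC subrK; split=> //.
by rewrite -mxrank_eq0 r.
Qed.

Lemma reflection_neq1 g : reflection g -> g <> 1.
Proof. by move=> /reflectionP[a [f [-> af]]] E; case/eqP: af; apply: (addrI 1);
  rewrite E addr0. Qed.

(* The image of [s - 1] is a line and contains [(c - 1) v]. *)
Lemma reflection_vec s (v : 'cV_n.+1) (c : F) : reflection s -> c != 1 -> v <> 0 ->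
  s *m v = c *: v -> exists f : 'rV_n.+1, s = 1 + v *m f.
Proof.
move=> /reflectionP[a [f [-> af]]] c1 v0; rewrite mulmxDl mul1mx -mulmxA.
rewrite [f *m v]mx11_scalar mul_mx_scalar => E.
have {}E : ((f *m v) 0 0) *: a = (c - 1) *: v by rewrite scalerBl -E scale1r addrC addKr.
have c10 : c - 1 != 0 by rewrite subr_eq0.
exists (((c - 1) / (f *m v) 0 0) *: f); congr (1 + _).
have fv : (f *m v) 0 0 != 0.
  apply/eqP => fv; move/eqP: E; rewrite fv scale0r eq_sym scaler_eq0 (negPf c10) /=.
  by move/eqP.
by rewrite -scalemxAr scalemxAl mulrC -scalerA -E scalerA mulVf // scale1r.
Qed.

Lemma mulmx_col_row m p (a : 'cV[F]_m) (f : 'rV_p) (b : 'cV_p) k (f' : 'rV_k) :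
  (a *m f) *m (b *m f') = ((f *m b) 0 0) *: (a *m f').
Proof.
rewrite -mulmxA [f *m (b *m f')]mulmxA; have := mx11_scalar (f *m b).
by set c := (f *m b) 0 0 => ->; rewrite mul_scalar_mx -scalemxAr.
Qed.

Lemma sqr_transvection (a : 'cV[F]_n.+1) (f : 'rV_n.+1) :
  (1 + a *m f) * (1 + a *m f) = 1 + (2 + (f *m a) 0 0) *: (a *m f).
Proof.
rewrite mulrDl mul1r mulrDr mulr1 -[X in _ + (_ + X)]/((a *m f) *m (a *m f)) mulmx_col_row.
by rewrite -addrA; congr (1 + _); rewrite addrA -mulr2n -scaler_nat -scalerDl.
Qed.

Lemma mxtrace_transvection (a : 'cV[F]_n.+1) (f : 'rV_n.+1) :
  \tr (1 + a *m f) = n.+1%:R + (f *m a) 0 0.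
Proof. by rewrite raddfD /= mxtrace1 mxtrace_mulC trace_mx11. Qed.

Lemma involution_transvection (a : 'cV[F]_n.+1) (f : 'rV_n.+1) : a *m f != 0 ->
  (1 + a *m f) ^+ 2 = 1 <-> (f *m a) 0 0 = - 2.
Proof.
move=> af; rewrite expr2 sqr_transvection; split=> [/eqP|->]; last by rewrite subrr scale0r addr0.
rewrite -{2}[1]addr0 (inj_eq (addrI _)) scaler_eq0 (negPf af) orbF addrC addr_eq0.
by move/eqP.
Qed.

Lemma reflection_involutionI (a : 'cV[F]_n.+1) (f : 'rV_n.+1) : (2 : F) != 0 ->
  (f *m a) 0 0 = - 2 -> reflection (1 + a *m f).
Proof.
move=> two fa; have af : a *m f != 0.
  apply/eqP => af; have a0 : a != 0.
    by apply/eqP => a0; move/eqP: fa; rewrite a0 mulmx0 mxE eq_sym oppr_eq0 (negPf two).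
  have: a *m (f *m a) = 0 by rewrite mulmxA af mul0mx.
  rewrite [f *m a]mx11_scalar fa mul_mx_scalar => /eqP.
  by rewrite scaler_eq0 oppr_eq0 (negPf two) (negPf a0).
apply/reflectionE; split; first by exists 2%N => //; apply/(involution_transvection af).
by rewrite addrC addKr rank_col_row.
Qed.

Lemma mxtrace_reflection s : reflection s -> s ^+ 2 = 1 -> \tr s = n.+1%:R - 2.
Proof.
move=> /reflectionP[a [f [-> af]]] /(involution_transvection af) fa.
by rewrite mxtrace_transvection fa.
Qed.

End LinearGroupTheory.

Lemma inv_uniq (T : unitRingType) (x y : T) : x * y = 1 -> y * x = 1 -> y = x^-1.
Proof.
move=> xy yx; have xU : x \is a GRing.unit by apply/unitrP; exists y.
by apply: (mulrI xU); rewrite mulrV.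
Qed.

Lemma conjr_invM (T : unitRingType) (x y g : T) : x \is a GRing.unit -> y \is a GRing.unit ->
  (x^-1 * y)^-1 * g * (x^-1 * y) = y^-1 * (x * g * x^-1) * y.
Proof. by move=> ux uy; rewrite invrM ?unitrV // invrK !mulrA. Qed.

Lemma conjr_mul (T : unitRingType) (x g h : T) : x \is a GRing.unit ->
  x^-1 * (g * h) * x = (x^-1 * g * x) * (x^-1 * h * x).
Proof. by move=> ux; rewrite !mulrA mulrK. Qed.

Lemma conjrK (T : unitRingType) (x g : T) : x \is a GRing.unit ->
  x * (x^-1 * g * x) * x^-1 = g.
Proof. by move=> ux; rewrite !mulrA mulrV // mul1r mulrK. Qed.

Lemma conjrVK (T : unitRingType) (x g : T) : x \is a GRing.unit ->
  x^-1 * (x * g * x^-1) * x = g.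
Proof. by move=> ux; rewrite !mulrA mulVr // mul1r mulrVK. Qed.

Lemma unitr_trmx (T : comUnitRingType) n (x : 'M[T]_n.+1) :
  (x^T \is a GRing.unit) = (x \is a GRing.unit).
Proof. exact: unitmx_tr. Qed.

Section Images.
Variables (F F' : fieldType) (n n' : nat).
Variables (f : 'M[F]_n.+1 -> 'M[F']_n'.+1) (G : set 'M[F]_n.+1).
Hypotheses (lG : linear_group G) (f1 : f 1 = 1).
Hypothesis fM : forall g h, G g -> G h -> f (g * h) = f g * f h.

Lemma image_inv g : G g -> f g^-1 = (f g)^-1.
Proof.
move=> Gg; case: lG => uG G1 GM GV; have gU : g \is a GRing.unit := uG _ Gg.
by apply: inv_uniq; rewrite -fM ?mulrV ?mulVr //; exact: GV.
Qed.

Lemma image_unit g : G g -> f g \is a GRing.unit.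
Proof.
move=> Gg; case: lG => uG G1 GM GV; have gU : g \is a GRing.unit := uG _ Gg.
by apply/unitrP; exists (f g^-1); rewrite -!fM ?mulrV ?mulVr //; exact: GV.
Qed.

Lemma linear_group_image : linear_group (f @` G).
Proof.
case: (lG) => uG G1 GM GV; split.
- by move=> _ [g Gg <-]; apply: image_unit.
- by exists 1.
- by move=> _ _ [g Gg <-] [h Gh <-]; exists (g * h); [apply: GM | rewrite fM].
- by move=> _ [g Gg <-]; exists (g^-1); [apply: GV | rewrite image_inv].
Qed.

Lemma linear_group_preimage L : linear_group L -> linear_group [set g | G g /\ L (f g)].
Proof.
case: (lG) => uG G1 GM GV [uL L1 LM LV]; split.
- by move=> g [/uG].
- by rewrite /= f1.
- by move=> g h [Gg Lg] [Gh Lh]; split; [apply: GM | rewrite fM //; apply: LM].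
- by move=> g [Gg Lg]; split; [apply: GV | rewrite image_inv //; apply: LV].
Qed.

(** [f] is multiplicative on [G] only, as is the real part of a conjugated representation, so [L] is
    pulled back inside [G]. *)
Lemma generated_by_image (P : 'M[F]_n.+1 -> Prop) (P' : 'M[F']_n'.+1 -> Prop) :
  (forall g, G g -> P g -> P' (f g)) -> generated_by P G -> generated_by P' (f @` G).
Proof.
move=> fP gG; apply: generated_byI => [|L lL GL]; first exact: linear_group_image.
move=> _ [g Gg <-].
have : [set g | G g /\ L (f g)] g; last by case.
apply: (generated_by_sub gG) Gg; first exact: linear_group_preimage.
by move=> h [Gh Ph]; split=> //; apply: GL; split; [exists h | apply: fP].
Qed.

End Images.

Section Conjugation.
Variables (F : fieldType) (n : nat).
Implicit Types (g h s x : 'M[F]_n.+1) (G H K L : set 'M[F]_n.+1).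

Lemma conjgM_mx x g h : x \is a GRing.unit ->
  x * (g * h) * x^-1 = (x * g * x^-1) * (x * h * x^-1).
Proof. by move=> xU; rewrite !mulrA mulrVK // -!mulrA. Qed.

Lemma conjg1_mx x : x \is a GRing.unit -> x * 1 * x^-1 = 1.
Proof. by move=> xU; rewrite mulr1 mulrV. Qed.

Lemma conj_groups_refl G : conjugate_groups G G.
Proof.
exists 1; first exact: unitr1.
by under eq_imagel => g _ do rewrite invr1 mulr1 mul1r; rewrite image_id.
Qed.

Lemma conj_groups_sym G H : conjugate_groups G H -> conjugate_groups H G.
Proof.
move=> [x xU ->]; exists x^-1; first by rewrite unitrV.
rewrite image_comp; under eq_imagel => g _.
  by rewrite /= invrK !mulrA mulVr // mul1r mulrVK //; over.
by rewrite image_id.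
Qed.

Lemma conj_groups_trans G H K :
  conjugate_groups G H -> conjugate_groups H K -> conjugate_groups G K.
Proof.
move=> [x xU ->] [y yU ->]; exists (y * x); first by rewrite unitrMr.
by rewrite image_comp; apply: eq_imagel => g _ /=; rewrite invrM // !mulrA.
Qed.

Lemma conj_classE G H : conj_class G = conj_class H <-> conjugate_groups G H.
Proof.
split=> [E|GH].
  by have : conj_class H H by [exact: conj_groups_refl]; rewrite -E.
rewrite eqEsubset; split=> K; first exact/conj_groups_trans/conj_groups_sym.
exact: conj_groups_trans.
Qed.

Section Invariants.
Variables (x : 'M[F]_n.+1) (xU : x \is a GRing.unit).

Lemma conjX_mx g k : (x * g * x^-1) ^+ k = x * g ^+ k * x^-1.
Proof.
by elim: k => [|k IH]; rewrite ?expr0 ?conjg1_mx // !exprS IH conjgM_mx.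
Qed.

Lemma reflection_conj g : reflection g -> reflection (x * g * x^-1).
Proof.
move=> /reflectionE[[k k0 gk] r]; apply/reflectionE; split.
  by exists k => //; rewrite conjX_mx gk conjg1_mx.
rewrite -(conjg1_mx xU) -mulrBl -mulrBr.
rewrite -[LHS]/(\rank (x *m (g - 1) *m x^-1)) mxrankMfree ?row_free_unit; last first.
  by rewrite unitmxE -[_ \is a _]/(x^-1 \in unitmx) unitrV.
by rewrite (eqmxMfull (g - 1)) // row_full_unit.
Qed.

Let conjM G g h : G g -> G h ->
  x * (g * h) * x^-1 = (x * g * x^-1) * (x * h * x^-1) := fun _ _ => conjgM_mx g h xU.

Lemma linear_group_conj G :
  linear_group G -> linear_group ((fun g => x * g * x^-1) @` G).
Proof. by move=> lG; apply: linear_group_image; [|exact: conjg1_mx|exact: conjM]. Qed.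

Lemma generated_by_conj (P : 'M[F]_n.+1 -> Prop) G :
  (forall g, P g -> P (x * g * x^-1)) -> linear_group G ->
  generated_by P G -> generated_by P ((fun g => x * g * x^-1) @` G).
Proof.
move=> Px lG; apply: generated_by_image => //; [exact: conjg1_mx|exact: conjM|].
by move=> g _; apply: Px.
Qed.

End Invariants.

End Conjugation.

(** * Orthogonal reflections *)

Section OrthogonalReflections.
Variables (R : rcfType) (n : nat).
Implicit Types (u v w : 'cV[R]_n.+1) (g h s : 'M[R]_n.+1).

Definition dotv u v : R := (u^T *m v) 0 0.

Lemma dotvE u v : dotv u v = \sum_i u i 0 * v i 0.
Proof. by rewrite /dotv mxE; apply: eq_bigr => i _; rewrite mxE. Qed.

Lemma dotvC u v : dotv u v = dotv v u.
Proof. by rewrite !dotvE; apply: eq_bigr => i _; rewrite mulrC. Qed.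

Lemma dotvDr u v w : dotv u (v + w) = dotv u v + dotv u w.
Proof. by rewrite /dotv mulmxDr mxE. Qed.

Lemma dotvZr u v a : dotv u (a *: v) = a * dotv u v.
Proof. by rewrite /dotv -scalemxAr mxE. Qed.

Lemma dotvNr u v : dotv u (- v) = - dotv u v.
Proof. by rewrite -scaleN1r dotvZr mulN1r. Qed.

Lemma dotvBr u v w : dotv u (v - w) = dotv u v - dotv u w.
Proof. by rewrite dotvDr dotvNr. Qed.

Lemma dotvDl u v w : dotv (v + w) u = dotv v u + dotv w u.
Proof. by rewrite !(dotvC _ u) dotvDr. Qed.

Lemma dotvZl u v a : dotv (a *: v) u = a * dotv v u.
Proof. by rewrite !(dotvC _ u) dotvZr. Qed.

Lemma dotvNl u v : dotv (- v) u = - dotv v u.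
Proof. by rewrite !(dotvC _ u) dotvNr. Qed.

Lemma dotvBl u v w : dotv (v - w) u = dotv v u - dotv w u.
Proof. by rewrite dotvDl dotvNl. Qed.

Lemma dotv0r u : dotv u 0 = 0.
Proof. by rewrite /dotv mulmx0 mxE. Qed.

Lemma dotv_sumr I (r : seq I) (P : pred I) u (F : I -> 'cV[R]_n.+1) :
  dotv u (\sum_(i <- r | P i) F i) = \sum_(i <- r | P i) dotv u (F i).
Proof. by rewrite /dotv mulmx_sumr summxE. Qed.

Lemma dotv_ge0 u : 0 <= dotv u u.
Proof. by rewrite dotvE sumr_ge0 // => i _; rewrite -expr2 sqr_ge0. Qed.

Lemma dotv_eq0 u : dotv u u = 0 -> u = 0.
Proof.
move=> /eqP; rewrite dotvE psumr_eq0 => [/allP H|i _]; last by rewrite -expr2 sqr_ge0.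
apply/matrixP => i j; rewrite (ord1 j) mxE.
have := H i (mem_index_enum _); rewrite mulf_eq0 orbb.
by move/eqP.
Qed.

Lemma dotv_gt0 u : u != 0 -> 0 < dotv u u.
Proof. by move=> u0; rewrite lt_def dotv_ge0 andbT; apply: contra_neq u0; apply: dotv_eq0. Qed.

Lemma dotv_mulmx h u v : dotv (h *m u) v = dotv u (h^T *m v).
Proof. by rewrite /dotv trmx_mul mulmxA. Qed.

Lemma orthogonal_dotv h u v : h^T * h = 1 -> dotv (h *m u) (h *m v) = dotv u v.
Proof. by move=> hh; rewrite dotv_mulmx mulmxA [h^T *m h]hh mul1mx. Qed.

Definition refl v : 'M[R]_n.+1 := 1 - 2 *: (v *m v^T).

Lemma reflE v u : refl v *m u = u - (2 * dotv v u) *: v.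
Proof.
rewrite /refl mulmxBl mul1mx -scalemxAl -mulmxA [v^T *m u]mx11_scalar mul_mx_scalar scalerA.
by [].
Qed.

Lemma refl_sym v : (refl v)^T = refl v.
Proof. by rewrite /refl linearB /= trmx1 linearZ /= trmx_mul trmxK. Qed.

Lemma refl_sqr v : dotv v v = 1 -> refl v * refl v = 1.
Proof.
move=> vv; have -> : refl v = 1 + v *m (- 2 *: v^T) by rewrite -scalemxAr scaleNr.
rewrite sqr_transvection; have -> : ((- 2 *: v^T) *m v) 0 0 = - 2.
  by rewrite -scalemxAl mxE -/(dotv v v) vv mulr1.
by rewrite subrr scale0r addr0.
Qed.

(** For [h = 1 + a *m f], applying the identity [h^T * h = 1] to [u = f^T] shows that [a = c *: u];
    putting this back forces [c = - 2 / dotv u u]. The root is then [u] divided by its length. *)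
Lemma orthogonal_reflection h : h^T * h = 1 -> reflection h ->
  exists2 v, dotv v v = 1 & h = refl v.
Proof.
move=> hh /reflectionP[a [f [hE af]]]; set u := f^T; have uE : u^T = f by rewrite /u trmxK.
have u0 : u != 0 by apply: contra_neq af => u0; rewrite -uE u0 trmx0 mulmx0.
have b0 := dotv_gt0 u0; set b := dotv u u in b0.
have E : a *m f + u *m a^T + dotv a a *: (u *m f) = 0.
  apply: (addrI 1); rewrite addr0 -[RHS]hh hE linearD /= trmx1 trmx_mul -/u.
  rewrite mulrDl mul1r mulrDr mulr1 -[X in _ + (_ + X)]/((u *m a^T) *m (a *m f)).
  by rewrite mulmx_col_row -/(dotv a a) !addrA.
have ff : f *m u = b%:M by rewrite [LHS]mx11_scalar /b /dotv uE.
have [c aE] : exists c, a = c *: u.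
  move/(congr1 (mulmx^~ u)): E; rewrite !mulmxDl -scalemxAl -!mulmxA ff mul0mx.
  rewrite [a^T *m u]mx11_scalar !mul_mx_scalar -addrA => /eqP; rewrite addr_eq0 => /eqP.
  rewrite scalerA -scalerDl -scaleNr => /(congr1 (fun w => b^-1 *: w)).
  by rewrite !scalerA mulVf ?gt_eqF // scale1r => aE; eexists; exact: aE.
have c2 : c * b = - 2.
  have uf : u *m f != 0.
    by apply: contra_neq af; rewrite aE -scalemxAl => ->; rewrite scaler0.
  have c0 : c != 0 by apply: contra_neq af => c0; rewrite aE c0 scale0r mul0mx.
  move/eqP: E; rewrite aE linearZ /= uE -scalemxAr -scalemxAl -!scalerDl scaler_eq0 (negPf uf) orbF.
  rewrite dotvZl dotvZr -/b => /eqP E; apply: (mulfI c0); apply/eqP; rewrite -subr_eq0 -E.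
  by apply/eqP; ring.
set k := (Num.sqrt b)^-1; have kk : k * k = b^-1.
  by rewrite -expr2 exprVn sqr_sqrtr ?ltW.
exists (k *: u); first by rewrite dotvZl dotvZr -/b mulrA kk mulVf ?gt_eqF.
rewrite /refl [(_ *: u)^T]linearZ /= -scalemxAr -scalemxAl !scalerA -?mulrA kk.
rewrite hE aE -scalemxAl uE -scaleNr; congr (_ + _ *: _).
by rewrite -mulNr -c2 mulfK ?gt_eqF.
Qed.

End OrthogonalReflections.

(** * The tangent representation *)

Definition mx_of_rows (T : nzRingType) m n (r : seq (seq T)) : 'M[T]_(m, n) :=
  \matrix_(i, j) (nth [::] r i)`_j.

Lemma cforall_ord2 (P : 'I_2 -> Prop) : P ord0 -> P (lift ord0 ord0) -> forall i, P i.
Proof.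
move=> P0 P1 [[|[|//]] ilt].
- by rewrite (_ : Ordinal _ = ord0) //; apply/val_inj.
- by rewrite (_ : Ordinal _ = lift ord0 ord0) //; apply/val_inj.
Qed.

Lemma cforall_ord3 (P : 'I_3 -> Prop) :
  P ord0 -> P (lift ord0 ord0) -> P (lift ord0 (lift ord0 ord0)) -> forall i, P i.
Proof.
move=> P0 P1 P2 [[|[|[|//]]] ilt].
- by rewrite (_ : Ordinal _ = ord0) //; apply/val_inj.
- by rewrite (_ : Ordinal _ = lift ord0 ord0) //; apply/val_inj.
- by rewrite (_ : Ordinal _ = lift ord0 (lift ord0 ord0)) //; apply/val_inj.
Qed.

Definition sumE := (big_ord_recl, big_ord0, addr0).

Section Phi.
Variable F : fieldType.
Implicit Types g h : 'M[F]_2.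

Local Notation o0 := ord0.
Local Notation o1 := (lift ord0 ord0).
Local Notation o2 := (lift ord0 (lift ord0 ord0)).

Lemma quad_mapE (v : 'cV[F]_2) : 
  quad_map v = mx_of_rows 3 1 [:: [:: v o0 0 * v o1 0]; [:: v o0 0 ^+ 2]; [:: v o1 0 ^+ 2]].
Proof.
apply/matrixP => k j; rewrite ord1 !mxE /quad_inv mpoly.mevalX /quad_mon (tnth_nth (@mpoly.mnm0 2)).
move: k; apply: cforall_ord3; rewrite /= !sumE /=;
 rewrite ?mpoly.mulmnE ?mpoly.mnmDE ?mpoly.mnm1E /= ?mpoly.mulmnE ?mpoly.mnm1E /= ?expr0 ?expr1
   ?mulr1 ?mul1r //.
Qed.

(** No polynomial is expanded: the columns are read off from the action on the points
    [quad_map (x, y)] for [(1, 0)], [(0, 1)] and [(1, 1)], which span the space. *)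
Lemma phiE g : let a := g o0 o0 in let b := g o0 o1 in let c := g o1 o0 in let d := g o1 o1 in
  phi g = mx_of_rows 3 3 [:: [:: a * d + b * c; a * c; b * d];
     [:: 2 * a * b; a ^+ 2; b ^+ 2]; [:: 2 * c * d; c ^+ 2; d ^+ 2]].
Proof.
move=> a b c d.
pose e (x y : F) : 'cV_2 := mx_of_rows 2 1 [:: [:: x]; [:: y]].
have H x y i : phi g i o0 * (x * y) + (phi g i o1 * x ^+ 2 + phi g i o2 * y ^+ 2) = quad_map (g
  *m e x y) i 0.
  by rewrite -phi_quad_map [RHS]mxE quad_mapE !sumE; congr (_ * _ + (_ * _ + _ * _)); rewrite !mxE.
have {}H x y i : phi g i o0 * (x * y) + (phi g i o1 * x ^+ 2 + phi g i o2 * y ^+ 2) = 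
  ([:: (a * x + b * y) * (c * x + d * y); (a * x + b * y) ^+ 2; (c * x + d * y) ^+ 2])`_i.
  by rewrite H quad_mapE !mxE !sumE !mxE; move: i; apply: cforall_ord3.
have H1 i : phi g i o1 = [:: a * c; a ^+ 2; c ^+ 2]`_i.
  by have := H 1 0 i; rewrite !(mulr0, expr0n, mulr1, expr1n, add0r, addr0).
have H2 i : phi g i o2 = [:: b * d; b ^+ 2; d ^+ 2]`_i.
  by have := H 0 1 i; rewrite !(mulr0, mul0r, expr0n, mulr1, expr1n, add0r, addr0).
have H0 i : phi g i o0 = [:: a * d + b * c; 2 * a * b; 2 * c * d]`_i.
  have := H 1 1 i; rewrite !mulr1 expr1n !mulr1 H1 H2 => /(canRL (addrK _)) ->.
  by move: i; apply: cforall_ord3 => /=; ring.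
by apply/matrixP => i; apply: cforall_ord3; rewrite ?H0 ?H1 ?H2 mxE; move: i;
  apply: cforall_ord3.
Qed.

Lemma phiM g h : phi (g * h) = phi g * phi h.
Proof.
apply/matrixP; apply: cforall_ord3; apply: cforall_ord3;
  rewrite -!mulmxE [in RHS]mxE !sumE !phiE !mxE !sumE /=; ring.
Qed.

Lemma phi1 : phi (1 : 'M[F]_2) = 1.
Proof.
apply/matrixP; apply: cforall_ord3; apply: cforall_ord3;
  rewrite !phiE !mxE /=; ring.
Qed.

Lemma phiN g : phi (- g) = phi g.
Proof.
apply/matrixP; apply: cforall_ord3; apply: cforall_ord3;
  rewrite !phiE !mxE /=; ring.
Qed.

Lemma phi_unit g : g \is a GRing.unit -> phi g \is a GRing.unit.
Proof.
move=> ug; apply/unitrP; exists (phi g^-1).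
by split; rewrite -phiM ?mulVr ?mulrV // phi1.
Qed.

Lemma phiV g : g \is a GRing.unit -> phi g^-1 = (phi g)^-1.
Proof. by move=> ug; apply: inv_uniq; rewrite -phiM ?mulVr ?mulrV // phi1. Qed.

Lemma det2E g : \det g = g o0 o0 * g o1 o1 - g o0 o1 * g o1 o0.
Proof.
rewrite (expand_det_row _ o0) !sumE /cofactor !det_mx11 !mxE /= !expr0 !mul1r expr1.
rewrite mulN1r mulrN; congr (_ * g _ _ - _ * g _ _); exact/val_inj.
Qed.

Lemma mx2_charpoly g : g ^+ 2 = (\tr g) *: g - (\det g)%:M.
Proof.
rewrite det2E /mxtrace !sumE.
by apply/matrixP; apply: cforall_ord2; apply: cforall_ord2;
  rewrite expr2 -!mulmxE !mxE !sumE /=; ring.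
Qed.

Lemma quadRE (v : 'cV[F]_3) : quadR v = v o0 0 ^+ 2 - v o1 0 * v o2 0.
Proof.
have H (i : 'I_3) k : val i = k -> inord k = i by move=> <-; apply: inord_val.
by rewrite /quadR (H o0) // (H o1) // (H o2).
Qed.

(** View a vector as the symmetric matrix [M] with diagonal [X_2, X_3] and off-diagonal entry [X_1]:
    then [phi g] is [M |-> g M g^T], and [quadR] is [- det M]. *)
Lemma quadR_phi g v : quadR (phi g *m v) = \det g ^+ 2 * quadR v.
Proof. by rewrite !quadRE det2E !mxE !sumE !phiE !mxE /=; ring. Qed.

Lemma quadR_nondegenerate : (2 : F) != 0 -> nondegenerate_form (@quadR F).
Proof.
move=> two u H.
pose e (x y z : F) : 'cV_3 := mx_of_rows 3 1 [:: [:: x]; [:: y]; [:: z]].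
have {}H x y z : 2 * (u o0 0) * x - u o1 0 * z - u o2 0 * y = 0.
  by rewrite -(H (e x y z)) !quadRE !mxE /=; ring.
have H0 := H 1 0 0; have H1 := H 0 0 (-1); have H2 := H 0 (-1) 0.
apply/matrixP => i j; rewrite ord1 mxE; move: i; apply: cforall_ord3.
- by apply/eqP; rewrite -(mulrI_eq0 _ (mulfI two)) -[X in X == 0]mulr1 -H0; apply/eqP; ring.
- by rewrite -H1; ring.
- by rewrite -H2; ring.
Qed.

(** Squares of entries, and products of two entries in one row or one column, agree for [g] and [h].
    A sign chosen at the first nonzero entry therefore propagates to the others; the sum [a d + b c]
    settles the opposite entry. *)
Lemma phi_eq g h : (2 : F) != 0 -> phi g = phi h <-> h = g \/ h = - g.
Proof.
move=> two; split; last by case=> ->; rewrite ?phiN.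
move=> E; have {}E i j : phi g i j = phi h i j by rewrite E.
have:= (E o0 o0, E o0 o1, E o0 o2, (E o1 o0, E o1 o1, E o1 o2), (E o2 o0, E o2 o1, E o2 o2)).
rewrite !phiE !mxE /= => -[[[[E00 E01] E02] [[E10 E11] E12]] [[E20 E21] E22]].
suff [e [e1 A]] : exists e : F, (e = 1 \/ e = -1) /\
  [/\ h o0 o0 = e * g o0 o0, h o0 o1 = e * g o0 o1, h o1 o0 = e * g o1 o0 & h o1 o1 = e * g o1 o1].
  case: A => A00 A01 A10 A11.
  have -> : h = e *: g.
    by apply/matrixP; apply: cforall_ord2; apply: cforall_ord2; rewrite mxE.
  by case: e1 => ->; rewrite ?scale1r ?scaleN1r; [left|right].
move: (g o0 o0) (g o0 o1) (g o1 o0) (g o1 o1) (h o0 o0) (h o0 o1) (h o1 o0) (h o1 o1)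
  E00 E01 E02 E10 E11 E12 E20 E21 E22 => a b c d a' b' c' d' {E}.
move=> E00 E01 E02; rewrite -!mulrA => /(mulfI two) E10 E11 E12 /(mulfI two) E20 E21 E22.
have sg (x y : F) : x ^+ 2 = y ^+ 2 -> exists2 e, (e = 1 \/ e = -1) & y = e * x.
  move=> /eqP; rewrite eq_sym eqf_sqr => /orP[/eqP ->|/eqP ->].
    by exists 1; [left|rewrite mul1r].
  by exists (-1); [right|rewrite mulN1r].
have se (e : F) : (e = 1 \/ e = -1) -> e * e = 1 by case=> ->; rewrite ?mulrNN mulr1.
have key (e x y z : F) : (e = 1 \/ e = -1) -> x != 0 -> x * y = e * x * z -> z = e * y.
  by move=> /se ee x0; rewrite [e * x]mulrC -mulrA => /(mulfI x0) ->; rewrite mulrA ee mul1r.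
have [a0|a0] := eqVneq a 0; last first.
  have [e He Ha] := sg _ _ E11; exists e; split=> //.
  have Hb : b' = e * b by apply: (key e a) => //; rewrite E10 Ha.
  have Hc : c' = e * c by apply: (key e a) => //; rewrite E01 Ha.
  split=> //; apply: (key e a) => //; move: E00; rewrite Hb Hc Ha => /(canRL (addrK _)) ->.
  by rewrite mulrACA se // mul1r addrK.
have a'0 : a' = 0 by apply/eqP; rewrite -sqrf_eq0 -E11 a0 expr0n.
rewrite {}a0 {}a'0 !mul0r !add0r in E00 E01 E10 E11 *.
have [b0|b0] := eqVneq b 0; last first.
  have [e He Hb] := sg _ _ E12; exists e; rewrite mulr0; split=> //.
  by split=> //; apply: (key e b); rewrite // -Hb.
have b'0 : b' = 0 by apply/eqP; rewrite -sqrf_eq0 -E12 b0 expr0n.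
rewrite {}b0 {}b'0 !mul0r in E00 E02 E12 *.
have [c0|c0] := eqVneq c 0; last first.
  have [e He Hc] := sg _ _ E21; exists e; rewrite mulr0; split=> //.
  by split=> //; apply: (key e c); rewrite // -Hc.
have c'0 : c' = 0 by apply/eqP; rewrite -sqrf_eq0 -E21 c0 expr0n.
have [e He Hd] := sg _ _ E22; exists e; rewrite c0 c'0 mulr0; split=> //.
Qed.

Lemma order2_reflection_phi g : (2 : F) != 0 -> order2_reflection g ->
  [/\ \tr g = 0, \det g = -1 & reflection (phi g)].
Proof.
move=> two [rg _ g2].
have tg : \tr g = 0 by rewrite (mxtrace_reflection rg g2) subrr.
have dg : \det g = -1.
  move/matrixP/(_ o0 o0): (mx2_charpoly g).
  by rewrite g2 tg scale0r !mxE eqxx sub0r !mulr1n => ->; rewrite opprK.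
(* As [g] has trace 0, its product with the alternating matrix with rows [(0, 1)] and [(-1, 0)] is
   symmetric; [a] is this symmetric matrix, and [R a = - det g = 1]. The form [f] is minus the polar
   form of [R] at [a], so [1 + a *m f] is the reflection in [a] for [R]. *)
split=> //; pose a : 'cV[F]_3 := mx_of_rows 3 1 [:: [:: g o0 o0]; [:: - g o0 o1]; [:: g o1 o0]].
pose f : 'rV[F]_3 := mx_of_rows 1 3 [:: [:: - 2 * g o0 o0; g o1 o0; - g o0 o1]].
move: tg dg; rewrite det2E /mxtrace !sumE => /eqP; rewrite addrC addr_eq0 => /eqP g11 dg.
rewrite g11 mulrN in dg.
have one : 1 = g o0 o0 ^+ 2 + g o0 o1 * g o1 o0 by rewrite -[1]opprK -dg; ring.
have -> : phi g = 1 + a *m f.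
  apply/matrixP; apply: cforall_ord3; apply: cforall_ord3;
    by rewrite !phiE !mxE !sumE !mxE /= ?g11; try ring;
       rewrite [X in _ = X + _]one; ring.
apply: reflection_involutionI => //.
transitivity (- 2 * (g o0 o0 ^+ 2 + g o0 o1 * g o1 o0)); last by rewrite -one mulr1.
by rewrite !mxE !sumE !mxE /=; ring.
Qed.

End Phi.

(** * Square roots of matrices and conjugation by isometries *)

Section PolynomialSquareRoot.
Variable C : numClosedFieldType.

(* A Hensel step: if [p ^ 2 = 'X] modulo [m], a correction [p + t m] also
   works modulo [m * ('X - a)]; [t] solves an equation of degree 1 or 2. *)
Lemma sqrt_mod_split (s : seq C) : 0 \notin s ->
  exists p : {poly C}, \prod_(a <- s) ('X - a%:P) %| p ^+ 2 - 'X.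
Proof.
elim: s => [|a s IH]; first by exists 0; rewrite big_nil dvd1p.
rewrite inE negb_or eq_sym => /andP[a0 /IH[p]].
rewrite big_cons; set m := \prod_(_ <- _) _ => /dvdpP[q pq].
have [t tE] : exists t, q.[a] + 2 * t * p.[a] + t ^+ 2 * m.[a] = 0.
  have paE : p.[a] ^+ 2 = a + q.[a] * m.[a].
    by have /eqP := congr1 (horner^~ a) pq; rewrite !hornerE subr_eq addrC => /eqP.
  have [ma|ma] := eqVneq m.[a] 0.
    have pa0 : p.[a] != 0 by apply: contra_neq a0 => pa; move: paE;
      rewrite ma mulr0 addr0 pa expr0n.
    exists (- q.[a] / (2 * p.[a])); rewrite ma mulr0 addr0.
    by field.
  exists ((sqrtC a - p.[a]) / m.[a]).
  transitivity ((sqrtC a ^+ 2 - p.[a] ^+ 2 + q.[a] * m.[a]) / m.[a]); first by field.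
  by rewrite paE sqrtCK; field.
exists (p + t *: m).
have -> : (p + t *: m) ^+ 2 - 'X = (q + 2 *: (t *: p) + (t ^+ 2) *: m) * m.
  have -> : (p + t *: m) ^+ 2 - 'X = (p ^+ 2 - 'X) + (2 *: (t *: p) + (t ^+ 2) *: m) * m.
    by rewrite -!mul_polyC !rmorphM /=; ring.
  by rewrite pq; ring.
rewrite dvdp_mul // dvdp_XsubCl rootE !hornerE.
by apply/eqP; exact: tE.
Qed.

(** ['X] has a square root modulo the characteristic polynomial, whose roots are nonzero because [A]
    is invertible; Cayley-Hamilton turns the congruence into an equality. *)
Lemma polynomial_sqrt n (A : 'M[C]_n.+1) : A \is a GRing.unit ->
  exists p, horner_mx A p ^+ 2 = A.
Proof.
move=> uA; have [s sE] := closed_field_poly_normal (char_poly A).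
move: sE; rewrite (monicP (char_poly_monic A)) scale1r => sE.
have [|p] := @sqrt_mod_split s.
  apply/negP; rewrite -root_prod_XsubC -sE -eigenvalue_root_char => /eigenvalueP[v vA].
  case/eqP; rewrite -[v](mulmxK uA) vA scale0r mul0mx //.
rewrite -sE => /dvdpP[q pq]; exists p.
apply/eqP; rewrite -subr_eq0 -{2}(horner_mx_X A) -rmorphXn -rmorphB /= pq rmorphM /=.
by rewrite Cayley_Hamilton mulr0.
Qed.

Definition form_isometry n (J g : 'M[C]_n.+1) := g^T *m J *m g = J.

(** [A] compares [J] with its pullback by [x]. Both forms are [G]-invariant, so [A] commutes with
    [G], and [A] is self-adjoint for [J]. A polynomial [B] in [A] inherits both properties: the
    first gives [x B^-1] the same conjugation action on [G] as [x], the second makes it an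
    isometry. *)
Lemma form_isometry_conj n (J x : 'M[C]_n.+1) (G : set 'M[C]_n.+1) :
  J \is a GRing.unit -> x \is a GRing.unit -> J^T = J ->
  (forall g, G g -> [/\ g \is a GRing.unit, form_isometry J g & form_isometry J (x * g * x^-1)]) ->
  exists y, [/\ y \is a GRing.unit, form_isometry J y
              & forall g, G g -> y * g * y^-1 = x * g * x^-1].
Proof.
move=> uJ ux JT GJ.
pose A := J^-1 * (x^T * J * x).
have uxT : x^T \is a GRing.unit by rewrite unitr_trmx.
have uA : A \is a GRing.unit by rewrite unitrMr ?unitrV // unitrMl // unitrMl.
have JA : J * A = x^T * J * x by rewrite /A mulVKr.
clearbody A.
have [p pA] := polynomial_sqrt uA;
  have [B BE] : exists B, B = horner_mx A p by exists (horner_mx A p).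
rewrite -BE in pA.
have uB : B \is a GRing.unit by rewrite -(unitrX_pos _ (isT : 0 < 2)%N) pA.
have XT : (x^T * J * x)^T = x^T * J * x by rewrite -!mulmxE !trmx_mul JT trmxK mulmxA.
have AJ : A^T * J = J * A.
  by transitivity ((J * A)^T); [rewrite -!mulmxE trmx_mul JT | rewrite JA XT].
have cA g : G g -> g * A = A * g.
  move=> /GJ[ug Jg Jxg]; have uT : g^T \is a GRing.unit by rewrite unitr_trmx.
  apply: (mulrI uJ); apply: (mulrI uT); rewrite !mulrA [g^T * J * g]Jg.
  rewrite -[g^T * J * A]mulrA !JA.
  have : x^T * J * x = (x * g * x^-1 * x)^T * J * (x * g * x^-1 * x).
    by rewrite -{1}Jxg -!mulmxE [in RHS]trmx_mul !mulmxA.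
  by rewrite mulrVK // => E; rewrite {1}E -!mulmxE trmx_mul !mulmxA.
have cB g : G g -> g * B = B * g by rewrite BE; move=> /cA; apply: comm_mx_horner.
have BJ : B^T * J = J * B.
  rewrite BE; elim/poly_ind: (p) => [|r c IH]; first by rewrite !rmorph0 trmx0 mul0r mulr0.
  have cAr : A * horner_mx A r = horner_mx A r * A by apply: comm_mx_horner.
  rewrite rmorphD rmorphM /= horner_mx_X horner_mx_C linearD /= tr_scalar_mx.
  rewrite mulrDl mulrDr; congr (_ + _); last by rewrite -!mulmxE scalar_mxC.
  by rewrite -{1}cAr -!mulmxE trmx_mul !mulmxE -mulrA AJ !mulrA IH.
have uBT : B^T \is a GRing.unit by rewrite unitr_trmx.
exists (x * B^-1); split; first by rewrite unitrMl // unitrV.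
  have yB : x * B^-1 * B = x by rewrite mulrVK.
  apply: (mulrI uBT); apply: (mulIr uB).
  transitivity ((x * B^-1 * B)^T * J * (x * B^-1 * B)).
    by rewrite -!mulmxE [in RHS]trmx_mul !mulmxA.
  by rewrite yB BJ -[RHS]mulrA -expr2 pA JA.
move=> g /cB gB; rewrite invrM ?unitrV // invrK -!mulrA; congr (x * _).
by rewrite [g * (B * _)]mulrA gB -mulrA mulKr.
Qed.

End PolynomialSquareRoot.

(** * Unitarizability *)

Lemma poly_nonroot (F : numDomainType) (p : {poly F}) : p != 0 -> exists x, p.[x] != 0.
Proof.
move=> p0; apply: contrapT => /forallNP H.
have := @max_poly_roots _ p [seq k%:R | k <- iota 0 (size p)] p0.
rewrite size_map size_iota ltnn => E; suff : false by []; apply: E.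
- by apply/allP => x _; rewrite rootE; apply: contrapT => /negP; apply: H.
- by rewrite map_inj_uniq ?iota_uniq // => m k /eqP; rewrite eqr_nat => /eqP.
Qed.

Section Cholesky.
Variables (F : numFieldType) (sigma : {rmorphism F -> F}).
Hypothesis sigmaK : involutive sigma.
Hypothesis sigma_sqrt : forall x, 0 < x -> exists2 y, y != 0 & sigma y * y = x.

(** [sigma] will be the identity of the reals or complex conjugation, so that the orthogonal and the
    unitary case share one factorization. *)
Definition star m n (A : 'M[F]_(m, n)) : 'M[F]_(n, m) := map_mx sigma A^T.

Lemma star_mul m n p (A : 'M_(m, n)) (B : 'M_(n, p)) : star (A *m B) = star B *m star A.
Proof. by rewrite /star trmx_mul map_mxM. Qed.

Lemma starK m n (A : 'M_(m, n)) : star (star A) = A.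
Proof. by apply/matrixP => i j; rewrite !mxE sigmaK. Qed.

Definition posdef n (A : 'M[F]_n) :=
  forall v : 'cV_n, v != 0 -> 0 < (star v *m A *m v) 0 0.

(** Induction on the size: the Schur complement of the corner [a] is again positive definite, and
    its factor completes a block triangular one. *)
Lemma cholesky n (A : 'M[F]_n) : star A = A -> posdef A -> exists x : 'M_n, star x *m x = A.
Proof.
elim: n A => [|n IH] A sA pA; first by exists 0; apply/matrixP => -[].
have sub (m p : nat) (B : 'M[F]_(1 + m, 1 + p)) : star B =
  block_mx (star (ulsubmx B)) (star (dlsubmx B)) (star (ursubmx B)) (star (drsubmx B)).
  by rewrite -{1}[B]submxK /star tr_block_mx map_block_mx.
pose a := A 0 0; pose b := dlsubmx (A : 'M_(1 + n)); pose D := drsubmx (A : 'M_(1 + n)).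
have AE : A = block_mx a%:M (star b) b D :> 'M_(1 + n).
  rewrite -[LHS](@submxK _ 1 n 1 n); congr block_mx.
    by rewrite [LHS]mx11_scalar !mxE; congr (A _ _)%:M; apply/val_inj.
  by rewrite /b -{1}sA sub block_mxKur.
have sD : star D = D by rewrite /D -{2}sA sub block_mxKdr.
have a0 : 0 < a.
  have := pA (delta_mx 0 0); rewrite -colE.
  have -> : (star (delta_mx 0 0 : 'cV[F]_n.+1)) = delta_mx 0 0.
    by apply/matrixP => i j; rewrite !mxE andbC rmorph_nat.
  rewrite -rowE !mxE; apply.
  by apply/eqP => /matrixP/(_ 0 0); rewrite !mxE eqxx => /eqP; rewrite oner_eq0.
have [z z0 za] := sigma_sqrt a0.
have sz0 : sigma z != 0 by rewrite fmorph_eq0.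
have az : a^-1 = z^-1 * (sigma z)^-1 by rewrite -za invfM mulrC.
have sa : sigma a = a by rewrite -za rmorphM /= sigmaK mulrC.
have sZ c m p (B : 'M[F]_(m, p)) : star (c *: B) = sigma c *: star B.
  by apply/matrixP => i j; rewrite !mxE rmorphM.
have sB m p (B B' : 'M[F]_(m, p)) : star (B - B') = star B - star B'.
  by apply/matrixP => i j; rewrite !mxE rmorphB.
have [||x xE] := IH (D - b *m (a^-1 *: star b)).
- by rewrite sB sD star_mul sZ starK fmorphV sa -scalemxAr scalemxAl.
(* This first coordinate cancels the first row of [A *m v], so the form of [A] at [v] equals the
   form of the Schur complement at [w]. *)
- move=> w w0; pose v : 'cV_(1 + n) := col_mx (- (a^-1 *: star b *m w)) w.
  have v0 : v != 0.
    by apply: contra_neq w0 => v0; rewrite -[w](col_mxKd (- (a^-1 *: star b *m w))) -/v v0 linear0.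
  have : 0 < (star v *m block_mx a%:M (star b) b D *m v) 0 0 by have := pA v v0; rewrite AE.
  rewrite -!mulmxA mul_block_col mulmxN mul_scalar_mx -scalemxAl scalerA mulfV ?gt_eqF //.
  rewrite scale1r addNr /star tr_col_mx map_row_mx -/(star w) mul_row_col mulmx0 add0r.
  by rewrite mulmxN addrC mulmxBl -mulmxA -scalemxAl.
pose X : 'M_(1 + n) := block_mx z%:M ((sigma z)^-1 *: star b) 0 x.
suff E : star X *m X = block_mx a%:M (star b) b D by exists X; rewrite AE; exact: E.
rewrite {1}/star tr_block_mx map_block_mx -!/(star _) mulmx_block.
rewrite ![star 0]/star trmx0 map_mx0 !mul0mx !mulmx0 !addr0.
have sz : star z%:M = (sigma z)%:M :> 'M_1 by rewrite /star tr_scalar_mx map_scalar_mx.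
rewrite sZ starK fmorphV sigmaK sz; congr block_mx.
- by rewrite -scalar_mxM za.
- by rewrite mul_scalar_mx scalerA mulfV // scale1r.
- by rewrite -scalemxAl mul_mx_scalar scalerA mulVf // scale1r.
- by rewrite xE -scalemxAl -!scalemxAr scalerA -az addrC subrK.
Qed.

Hypothesis sigma_ge0 : forall x, 0 <= sigma x * x.

Lemma star_mul_self_ge0 n (v : 'cV[F]_n) : 0 <= (star v *m v) 0 0.
Proof. by rewrite !mxE sumr_ge0 // => i _; rewrite !mxE. Qed.

Lemma star_mul_self_gt0 n (v : 'cV[F]_n) : v != 0 -> 0 < (star v *m v) 0 0.
Proof.
move=> v0; rewrite lt_def star_mul_self_ge0 andbT; apply: contra v0.
rewrite mxE psumr_eq0 => [/allP H|i _]; last by rewrite !mxE.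
apply/eqP/matrixP => i j; rewrite ord1 mxE.
have := H i (mem_index_enum _); rewrite !mxE mulf_eq0 fmorph_eq0 orbb.
by move/eqP.
Qed.

(** The sum [A] of all [star g *m g] is [G]-invariant, and its term [g = 1] makes it positive
    definite. A factor [x] with [star x *m x = A] carries this form to the standard one. *)
Lemma finite_group_unitarizable n (G : set 'M[F]_n.+1) :
  linear_group G -> finite_set G ->
  exists2 x, x \is a GRing.unit & forall g, G g -> star (x * g * x^-1) * (x * g * x^-1) = 1.
Proof.
move=> lG /(finite_group_enum lG)[s [us sG sM]]; case: lG => uG G1 GM GV.
pose A := \sum_(g <- s) (star g *m g).
have sD (B B' : 'M[F]_n.+1) : star (B + B') = star B + star B'.
  by apply/matrixP => i j; rewrite !mxE rmorphD.
have sA : star A = A.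
  rewrite /A; elim: (s) => [|g t IH]; rewrite ?big_nil ?big_cons.
    by apply/matrixP => i j; rewrite !mxE rmorph0.
  by rewrite sD IH star_mul starK.
have AG h : G h -> star h * A * h = A.
  move=> Gh; rewrite {2}/A -(perm_big _ (sM h Gh)) big_map mulr_sumr mulr_suml.
  by apply: eq_bigr => g _; rewrite -!mulmxE star_mul !mulmxA.
have pA : posdef A.
  move=> v v0; rewrite /A mulmx_sumr mulmx_suml summxE.
  have s1 : 1 \in s by apply/sG.
  rewrite (bigD1_seq 1) //= mulmxA -star_mul -mulmxA mul1mx ltr_wpDr ?star_mul_self_gt0 //.
  by rewrite sumr_ge0 // => g _; rewrite mulmxA -star_mul -mulmxA star_mul_self_ge0.
have [x xA] := cholesky sA pA.
have ux : x \is a GRing.unit.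
  rewrite -[_ \is a _]/(x \in unitmx) -unitmx_tr -row_free_unit -kermx_eq0.
  apply/eqP/row_matrixP => i; rewrite row0; apply/eqP/negPn/negP => r0.
  set r := row i _ in r0; have rx : r *m x^T = 0 by apply/sub_kermxP; apply: row_sub.
  have := pA r^T; rewrite -trmx_eq0 trmxK => /(_ r0).
  by rewrite -xA -!mulmxA -(trmxK x) -trmx_mul rx trmx0 !mulmx0 mxE ltxx.
exists x => // g /AG gA.
have sux : star x \is a GRing.unit.
  by rewrite /star -[_ \is a _]/(_ \in unitmx) map_unitmx unitmx_tr.
apply: (mulrI sux); apply: (mulIr ux); rewrite mulr1 -[star x * x]/(star x *m x) xA -gA -xA.
set U := x * g * x^-1; have Ux : U *m x = x *m g by rewrite [LHS]mulrVK.
transitivity (star (U *m x) *m (U *m x)); first by rewrite star_mul -!mulmxE !mulmxA.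
by rewrite Ux star_mul -!mulmxE !mulmxA.
Qed.

End Cholesky.

(** * The quadric and its isometry group *)

Section QuadricGroup.
Variable C : numClosedFieldType.
Local Notation o0 := ord0.
Local Notation o1 := (lift ord0 ord0).
Local Notation o2 := (lift ord0 (lift ord0 ord0)).

Lemma natC_neq0 n : (n.+1%:R : C) != 0. Proof. by rewrite pnatr_eq0. Qed.
Let two : (2 : C) != 0 := natC_neq0 1.

(** The matrix of the polar form of [quadR]. *)
Definition quadJ : 'M[C]_3 := mx_of_rows 3 3 [:: [:: 2; 0; 0]; [:: 0; 0; -1]; [:: 0; -1; 0]].

Lemma quadJE (v : 'cV[C]_3) : (v^T *m quadJ *m v) 0 0 = 2 * quadR v.
Proof. by rewrite quadRE !mxE !sumE !mxE !sumE !mxE /=; ring. Qed.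

Lemma quadJ_unit : quadJ \is a GRing.unit.
Proof.
apply/unitrP; exists (mx_of_rows 3 3 [:: [:: 2^-1; 0; 0]; [:: 0; 0; -1]; [:: 0; -1; 0]]).
split; apply/matrixP; apply: cforall_ord3; apply: cforall_ord3;
  by rewrite -!mulmxE !mxE !sumE !mxE /=; field.
Qed.

Lemma quadJ_sym : quadJ^T = quadJ.
Proof. by apply/matrixP; apply: cforall_ord3; apply: cforall_ord3; rewrite !mxE. Qed.

Lemma isom_phi (g : 'M[C]_2) : \det g ^+ 2 = 1 -> form_isometry quadJ (phi g).
Proof.
move=> dg; rewrite /form_isometry; transitivity (\det g ^+ 2 *: quadJ); last by rewrite dg scale1r.
apply/matrixP; apply: cforall_ord3; apply: cforall_ord3;
  by rewrite det2E phiE !mxE !sumE !mxE !sumE !mxE /=; ring.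
Qed.

Lemma isom_quadR (y : 'M[C]_3) v : form_isometry quadJ y -> quadR (y *m v) = quadR v.
Proof.
move=> iy; apply: (mulfI two); rewrite -!quadJE; congr (fun_of_matrix _ 0 0).
by rewrite trmx_mul -[in RHS]iy !mulmxA.
Qed.

Lemma isotropic_quad_map (v : 'cV[C]_3) : quadR v = 0 -> exists u, quad_map u = v.
Proof.
rewrite quadRE => /eqP; rewrite subr_eq0 => /eqP q0.
suff [a [c [A B D]]] : exists a c : C, [/\ a * c = v o0 0, a ^+ 2 = v o1 0 & c ^+ 2 = v o2 0].
  exists (mx_of_rows 2 1 [:: [:: a]; [:: c]]); rewrite quad_mapE.
  by apply/matrixP => i j; rewrite (ord1 j) !mxE; move: i; apply: cforall_ord3; rewrite /= ?A ?B ?D.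
have [v1|v1] := eqVneq (v o1 0) 0.
  exists 0, (sqrtC (v o2 0)); rewrite sqrtCK mul0r expr0n v1; split=> //=.
  by apply/esym/eqP; rewrite -sqrf_eq0 q0 v1 mul0r.
have s0 : sqrtC (v o1 0) != 0 by rewrite sqrtC_eq0.
exists (sqrtC (v o1 0)), (v o0 0 / sqrtC (v o1 0)); rewrite sqrtCK; split=> //.
  by rewrite mulrC mulfVK.
by rewrite exprMn exprVn sqrtCK q0 mulrAC mulfV ?mul1r.
Qed.

(** The last two basis vectors are isotropic, the images of the basis of the plane. Their images
    under [y] lie on the cone and lift to [u1] and [u2], the columns of [g]. Then
    [y' = phi g^-1 * y] is an isometry that fixes both isotropic vectors, which leaves only a sign
    on the first coordinate. *)
Lemma isom_lift (y : 'M[C]_3) : form_isometry quadJ y ->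
  exists g : 'M[C]_2, \det g ^+ 2 = 1 /\ phi g = y.
Proof.
move=> iy; pose e (a b c : C) : 'cV_3 := mx_of_rows 3 1 [:: [:: a]; [:: b]; [:: c]].
have yq a b c : quadR (y *m e a b c) = a ^+ 2 - b * c by rewrite isom_quadR // quadRE !mxE.
have [u1 E1] : exists u, quad_map u = y *m e 0 1 0.
  by apply: isotropic_quad_map; rewrite yq mulr0 expr0n subr0.
have [u2 E2] : exists u, quad_map u = y *m e 0 0 1.
  by apply: isotropic_quad_map; rewrite yq mul0r expr0n subr0.
pose g : 'M[C]_2 := mx_of_rows 2 2 [:: [:: u1 o0 0; u2 o0 0]; [:: u1 o1 0; u2 o1 0]].
have g1 : phi g *m e 0 1 0 = y *m e 0 1 0.
  rewrite -E1 quad_mapE; rewrite phiE; apply/matrixP => i j; rewrite (ord1 j) mxE !sumE !mxE;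
    move: i.
  by apply: cforall_ord3 => /=; ring.
have g2 : phi g *m e 0 0 1 = y *m e 0 0 1.
  rewrite -E2 quad_mapE; rewrite phiE; apply/matrixP => i j; rewrite (ord1 j) mxE !sumE !mxE;
    move: i.
  by apply: cforall_ord3 => /=; ring.
(* The vector [e 0 1 1] has [R = -1], and [phi g] agrees with [y] on it; comparing with [quadR_phi]
   gives the determinant. *)
have dg : \det g ^+ 2 = 1.
  have eD : e 0 1 1 = e 0 1 0 + e 0 0 1.
    by apply/matrixP => i j; rewrite (ord1 j) !mxE; move: i; apply: cforall_ord3;
      rewrite /= ?addr0 ?add0r.
  apply: oppr_inj; rewrite -[RHS](_ : 0 ^+ 2 - 1 * 1 = _); last by rewrite mulr1 expr0n sub0r.
  by rewrite -yq eD mulmxDr -g1 -g2 -mulmxDr -eD quadR_phi quadRE !mxE /=; ring.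
have ug : g \is a GRing.unit.
  rewrite -[_ \is a _]/(g \in unitmx) unitmxE unitfE.
  by apply/eqP => d0; move: dg; rewrite d0 expr0n => /eqP; rewrite eq_sym oner_eq0.
have dgV : \det g^-1 ^+ 2 = 1 by rewrite [\det _]det_inv exprVn dg invr1.
pose y' := phi g^-1 * y.
have iy' v : quadR (y' *m v) = quadR v.
  by rewrite /y' -mulmxE -mulmxA quadR_phi dgV mul1r isom_quadR.
have gy' : phi g * y' = y by rewrite /y' mulrA -phiM mulrV // phi1 mul1r.
have y1 : y' *m e 0 1 0 = e 0 1 0.
  by rewrite /y' -mulmxE -mulmxA -g1 mulmxA mulmxE -phiM mulVr // phi1 mul1mx.
have y2 : y' *m e 0 0 1 = e 0 0 1.
  by rewrite /y' -mulmxE -mulmxA -g2 mulmxA mulmxE -phiM mulVr // phi1 mul1mx.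
clearbody y'.
have {}y1 i : y' i o1 = [:: 0; 1; 0]`_i.
  by move/matrixP/(_ i 0): y1; rewrite mxE !sumE !mxE /= !(mulr0, mulr1, addr0, add0r) => ->;
    move: i; apply: cforall_ord3.
have {}y2 i : y' i o2 = [:: 0; 0; 1]`_i.
  by move/matrixP/(_ i 0): y2; rewrite mxE !sumE !mxE /= !(mulr0, mulr1, addr0, add0r) => ->;
    move: i; apply: cforall_ord3.
have {}iy' a b c : quadR (y' *m e a b c) = a ^+ 2 - b * c by rewrite iy' quadRE !mxE.
have {}iy' a b c : (y' o0 o0 * a) ^+ 2 - (y' o1 o0 * a + b) * (y' o2 o0 * a + c) = a ^+ 2 - b * c.
  by rewrite -[RHS]iy' quadRE !mxE !sumE !mxE ?y1 ?y2 /=; ring.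
have y10 : y' o1 o0 = 0.
  by have := iy' 1 0 1; have := iy' 1 0 0;
    rewrite !mulr1 !mul0r !addr0 !subr0 mulrDr mulr1 opprD addrA => ->
   /(canRL (addKr _)) /eqP; rewrite addNr oppr_eq0 => /eqP.
have y20 : y' o2 o0 = 0.
  by have := iy' 1 1 0; have := iy' 1 0 0;
    rewrite !mulr1 !mulr0 !addr0 !subr0 mulrDl mul1r opprD addrA => ->
   /(canRL (addKr _)) /eqP; rewrite addNr oppr_eq0 => /eqP.
have : y' o0 o0 ^+ 2 = 1 by have := iy' 1 0 0;
  rewrite y10 y20 !mul0r !addr0 mul0r !subr0 mulr1 expr1n.
move=> /eqP; rewrite sqrf_eq1 => /orP[]/eqP y00.
  exists g; split=> //; rewrite -gy'; suff -> : y' = 1 by rewrite mulr1.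
  by apply/matrixP; apply: cforall_ord3; apply: cforall_ord3; rewrite ?y1 ?y2 ?y00 ?y10 ?y20 mxE.
(* [phi] sends the diagonal matrix [(1, -1)] to the diagonal matrix [(-1, 1, 1)], which is the
   missing sign. *)
exists (g * mx_of_rows 2 2 [:: [:: 1; 0]; [:: 0; -1]]); split.
  rewrite det_mulmx exprMn dg mul1r det2E !mxE /=; ring.
rewrite phiM -gy'; congr (_ * _).
by apply/matrixP; apply: cforall_ord3; apply: cforall_ord3;
  rewrite ?y1 ?y2 ?y00 ?y10 ?y20 phiE !mxE /=; ring.
Qed.

(** The trace of [phi g] is [(\tr g)^2 - \det g]. If [\tr g] were nonzero, Cayley-Hamilton and
    [g^2 = 1] or [-1] would make [g] a scalar [l], with trace [3 l^2], that is [3] or [-3], instead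
    of 1. So [\tr g = 0], which gives [\det g = -1] and [g^2 = 1]. *)
Lemma order2_reflection_lift (g : 'M[C]_2) :
  \det g ^+ 2 = 1 -> phi g ^+ 2 = 1 -> \tr (phi g) = 1 -> order2_reflection g.
Proof.
move=> dg pg2 tp.
have trphi : \tr (phi g) = \tr g ^+ 2 - \det g.
  by rewrite phiE /mxtrace !sumE det2E !mxE /=; ring.
have g2 : g ^+ 2 = 1 \/ g ^+ 2 = - 1.
  have : phi 1 = phi (g ^+ 2) by rewrite phi1 expr2 phiM -expr2.
  by move/(phi_eq _ _ two).
have tg : \tr g = 0.
  apply/eqP/negPn/negP => tg.
  have [l gl] : exists l : C, g = l%:M.
    have gE : \tr g *: g = g ^+ 2 + (\det g)%:M by rewrite mx2_charpoly subrK.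
    have [m g2m] : exists m, g ^+ 2 = m%:M.
      by case: g2 => ->; [exists 1 | exists (-1); rewrite raddfN].
    exists ((\tr g)^-1 * (m + \det g)); rewrite -scale_scalar_mx raddfD /= -g2m -gE.
    by rewrite scalerK.
  have l2 : l ^+ 2 = 1 \/ l ^+ 2 = -1.
    case: g2; rewrite gl expr2 -mulmxE -scalar_mxM => /matrixP/(_ o0 o0);
      rewrite !mxE eqxx => E; [left|right]; exact: E.
  move: tp; rewrite trphi gl det2E /mxtrace !sumE !mxE /= !mulr1n !mulr0n.
  have -> : (l + l) ^+ 2 - (l * l - 0 * 0) = 3 * l ^+ 2 by ring.
  have three : (3 : C) <> 1.
    by move=> /eqP; rewrite -[X in _ == X]/(1%:R) eqr_nat.
  have three' : 3 * -1 <> 1 :> C.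
    move=> /eqP; rewrite mulrN1 -subr_eq0 -opprD oppr_eq0 -[X in _ + X]/(1%:R) -natrD.
    by rewrite pnatr_eq0.
  by case: l2 => ->; rewrite ?mulr1.
have dg1 : \det g = - 1 by move: tp; rewrite trphi tg expr0n sub0r => <-; rewrite opprK.
have {}g2 : g ^+ 2 = 1.
  by rewrite mx2_charpoly tg dg1 scale0r sub0r raddfN opprK.
have g1 : g <> 1.
  move=> g1; move: tg; rewrite g1 mxtrace1 => /eqP; apply/negP; exact: two.
split=> //; apply/reflectionE; split; first by exists 2%N.
apply/eqP; rewrite eqn_leq lt0n mxrank_eq0 subr_eq0; apply/andP; split; last exact/eqP.
rewrite -ltnS ltn_neqAle rank_leq_row andbT -/(row_free _) row_free_unit unitmxE unitfE negbK.
move: tg dg1; rewrite !det2E /mxtrace !sumE !mxE /= !mulr1n !mulr0n => tg dg1.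
apply/eqP; transitivity (g o0 o0 * g o1 o1 - g o0 o1 * g o1 o0 - (g o0 o0 + g o1 o1) + 1);
  first ring.
by rewrite tg dg1 subr0 addNr.
Qed.

Local Notation star := (star (@Num.conj C)).

(** The antilinear map [(x, y) |-> (- conj y, conj x)] of the plane induces
    [v |-> - quad_conj (conj v)] on the quadratic monomials. With the opposite sign, the fixed
    points of [v |-> quad_conj (conj v)] form a real structure on which [R] is positive definite. *)
Definition quad_conj : 'M[C]_3 := mx_of_rows 3 3 [:: [:: 1; 0; 0]; [:: 0; 0; -1]; [:: 0; -1; 0]].

Lemma unitary_phi_conj (g : 'M[C]_2) : star g * g = 1 -> \det g ^+ 2 = 1 ->
  map_mx Num.conj (phi g) = quad_conj * phi g * quad_conj.
Proof.
move=> gu; rewrite det2E.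
have e00 : (g o0 o0)^* * g o0 o0 + (g o1 o0)^* * g o1 o0 = 1.
  by move/matrixP/(_ o0 o0): gu; rewrite -mulmxE !mxE !sumE !mxE.
have e01 : (g o0 o0)^* * g o0 o1 + (g o1 o0)^* * g o1 o1 = 0.
  by move/matrixP/(_ o0 o1): gu; rewrite -mulmxE !mxE !sumE !mxE.
have e10 : (g o0 o1)^* * g o0 o0 + (g o1 o1)^* * g o1 o0 = 0.
  by move/matrixP/(_ o1 o0): gu; rewrite -mulmxE !mxE !sumE !mxE.
have e11 : (g o0 o1)^* * g o0 o1 + (g o1 o1)^* * g o1 o1 = 1.
  by move/matrixP/(_ o1 o1): gu; rewrite -mulmxE !mxE !sumE !mxE.
rewrite phiE; move: (g o0 o0) (g o0 o1) (g o1 o0) (g o1 o1) e00 e01 e10 e11 =>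
  a b c d e00 e01 e10 e11.
set e := a * d - b * c => e2.
have e1 : e = 1 \/ e = -1 by move/eqP: e2; rewrite sqrf_eq1 => /orP[]/eqP; [left|right].
have ce : e^* = e.
  by case: e1 => ->; rewrite ?rmorphN rmorph1.
(* Unitarity and the determinant [e] express the second row by the first one; [e] is real, being a
   sign. *)
have dE : d = e * a^*.
  transitivity (d * 1 - c * 0); first by rewrite mulr1 mulr0 subr0.
  by rewrite -e00 -e01 /e; ring.
have cE : c = - e * b^*.
  transitivity (c * 1 - d * 0); first by rewrite mulr1 mulr0 subr0.
  by rewrite -e11 -e10 /e; ring.
clearbody e; rewrite {}dE {}cE {e00 e01 e10 e11}.
apply/matrixP; apply: cforall_ord3; apply: cforall_ord3;
  rewrite -!mulmxE !mxE !sumE !mxE !sumE !mxE /= !(rmorphM, rmorphD, rmorphXn, rmorphN,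
    rmorph_nat) /= ?conjCK ?ce;
  by case: e1 => ->; ring.
Qed.

End QuadricGroup.

(** * A frame in which the quadratic form is a sum of squares *)

Section RealFrame.
Variable C : numClosedFieldType.

(** The columns are fixed by [v |-> quad_conj (conj v)]. In the coordinates [x, y, z] of this frame
    [X_2 = y + i z] and [X_3 = - y + i z], hence [R = x^2 + y^2 + z^2]. *)
Definition real_frame : 'M[C]_3 := mx_of_rows 3 3 [:: [:: 1; 0; 0]; [:: 0; 1; 'i]; [:: 0; -1; 'i]].

Let iX : 'i * 'i = -1 :> C. Proof. by rewrite -expr2 sqrCi. Qed.
Let two : (2 : C) != 0. Proof. by rewrite pnatr_eq0. Qed.

Lemma real_frame_form : real_frame^T * quadJ C * real_frame = 2%:M.
Proof.
by apply/matrixP; apply: cforall_ord3; apply: cforall_ord3;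
  rewrite -!mulmxE !mxE !sumE !mxE !sumE !mxE /= ?(mulrN, mulNr, mulr1, mul1r, iX, mulr0, mul0r,
    add0r, addr0, opprK, oppr0, subrr, addNr).
Qed.

Lemma real_frame_unit : real_frame \is a GRing.unit.
Proof.
rewrite -[_ \is a _]/(real_frame \in unitmx) unitmxE unitfE.
have := congr1 determinant real_frame_form; rewrite -!mulmxE !det_mulmx det_scalar => E.
by apply/eqP => d0; move/eqP: E; rewrite d0 mulr0 eq_sym expf_eq0 (negPf two).
Qed.

Lemma quad_conjK : quad_conj C * quad_conj C = 1.
Proof.
by apply/matrixP; apply: cforall_ord3; apply: cforall_ord3;
  rewrite -!mulmxE !mxE !sumE !mxE /= ?(mulrN, mulNr, mulr1, mul1r, mulr0, mul0r,  add0r, addr0,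
    opprK, oppr0).
Qed.

Lemma real_frame_conj : map_mx Num.conj real_frame = quad_conj C * real_frame.
Proof.
by apply/matrixP; apply: cforall_ord3; apply: cforall_ord3;
  rewrite -!mulmxE !mxE !sumE !mxE /= ?(rmorphN, rmorph0, rmorph1, conjCi) /=;
  rewrite ?(mulrN, mulNr, mulr1, mul1r, mulr0, mul0r,  add0r, addr0, opprK, oppr0).
Qed.

Lemma unitary_phi_real (g : 'M[C]_2) : star Num.conj g * g = 1 -> \det g ^+ 2 = 1 ->
  let A := real_frame^-1 * phi g * real_frame in map_mx Num.conj A = A.
Proof.
move=> gu dg A; apply: (mulrI real_frame_unit).
have uKP : quad_conj C * real_frame \is a GRing.unit.
  rewrite unitrMl ?real_frame_unit //; apply/unitrP; exists (quad_conj C).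
  by rewrite !quad_conjK.
rewrite /A -!mulmxE !map_mxM /= unitary_phi_conj // real_frame_conj !mulmxE.
have -> : map_mx Num.conj real_frame^-1 = (quad_conj C * real_frame)^-1.
  by rewrite [map_mx _ _]map_invmx -/(_^-1) real_frame_conj.
apply: (mulrI (x := quad_conj C)).
  by apply/unitrP; exists (quad_conj C); rewrite quad_conjK.
rewrite !mulrA mulrV // mul1r -!mulrA (mulrA (quad_conj C) (quad_conj C)) quad_conjK mul1r.
by rewrite mulVKr ?real_frame_unit // !mulrA.
Qed.

Lemma orthogonal_form_isometry (h : 'M[C]_3) : h^T * h = 1 ->
  form_isometry (quadJ C) (real_frame * h * real_frame^-1).
Proof.
move=> hh; have uP := real_frame_unit.
have uPT : real_frame^T \is a GRing.unit by rewrite unitr_trmx.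
apply: (mulrI uPT); apply: (mulIr uP); rewrite real_frame_form.
set U := real_frame * h * real_frame^-1.
have UP : U * real_frame = real_frame * h by rewrite /U mulrVK.
transitivity ((U * real_frame)^T * quadJ C * (U * real_frame)).
  by rewrite -!mulmxE [in RHS]trmx_mul !mulmxA.
rewrite UP; transitivity (h^T * (real_frame^T * quadJ C * real_frame) * h).
  by rewrite -!mulmxE trmx_mul !mulmxA.
by rewrite real_frame_form -!mulmxE mul_mx_scalar -scalemxAl mulmxE hh scalemx1.
Qed.

End RealFrame.

(** * Real forms *)

Lemma eq_cols (T : nzRingType) m n (A B : 'M[T]_(m, n)) : (forall j, col j A = col j B) -> A = B.
Proof.
move=> E; apply/matrixP => i j; have /matrixP/(_ i 0) := E j.
by rewrite [LHS]mxE [RHS]mxE.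
Qed.

Section RealForms.
Variable R : realType.
Local Notation C := R[i].
Implicit Types (G : set 'M[C]_3) (H : set 'M[R]_3) (W : set 'M[C]_2).

Let two : (2 : C) != 0. Proof. by rewrite pnatr_eq0. Qed.

Lemma complexifyM m n p (A : 'M[R]_(m, n)) (B : 'M_(n, p)) :
  complexify (A *m B) = complexify A *m complexify B.
Proof. exact: map_mxM. Qed.

Lemma complexifyMr n (A B : 'M[R]_n.+1) : complexify (A * B) = complexify A * complexify B.
Proof. exact: complexifyM. Qed.

Lemma complexify_tr m n (A : 'M[R]_(m, n)) : complexify A^T = (complexify A)^T.
Proof. exact: esym (map_trmx _ _). Qed.

Lemma complexify1 n : complexify 1%:M = 1%:M :> 'M[C]_n.
Proof. exact: map_mx1. Qed.

Lemma complexify_inj m n : injective (@complexify R m n).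
Proof. by move=> A B /matrixP E; apply/matrixP => i j; have := E i j; rewrite !mxE => -[]. Qed.

Lemma complexify_unit n (A : 'M[R]_n.+1) :
  (complexify A \is a GRing.unit) = (A \is a GRing.unit).
Proof. exact: map_unitmx. Qed.

Lemma complexifyV n (A : 'M[R]_n.+1) : complexify A^-1 = (complexify A)^-1.
Proof. exact: map_invmx. Qed.

Lemma complexify_conj m n (A : 'M[C]_(m, n)) :
  map_mx Num.conj A = A -> exists B, A = complexify B.
Proof.
move=> /matrixP cA; exists (map_mx (@complex.Re R) A); apply/matrixP => i j; rewrite !mxE.
have := cA i j; rewrite mxE => /eqP; rewrite -CrealE => /complex_realP[x ->].
by [].
Qed.

Lemma real_modelP G H : real_model G H <-> exists P, [/\ P \is a GRing.unit,
    forall g, G g -> exists h, P^-1 * g * P = complexify h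
  & H = [set h | G (P * complexify h * P^-1)]].
Proof.
split=> -[P [uP sP HE]]; exists P; split=> //.
- move=> g Gg.
  have col j : exists x : 'cV[R]_3,
    g *m (P *m complexify (delta_mx j (0 : 'I_1))) = P *m complexify x.
    have [|x _ <-] := sP g (P *m complexify (delta_mx j 0)) Gg; last by exists x.
    by exists (delta_mx j 0).
  have [x xE] := choice col; exists (\matrix_(i, j) x j i 0).
  apply: (mulrI uP); rewrite !mulrA mulrV // mul1r; apply: eq_cols => j.
  rewrite !colE; have -> : delta_mx j 0 = complexify (delta_mx j 0) :> 'cV[C]_3.
    by apply/matrixP => a b; rewrite !mxE; case: (_ && _).
  rewrite -!mulmxE -!mulmxA xE -complexifyM -colE; congr (_ *m complexify _).
  by apply/matrixP => i k; rewrite !mxE (ord1 k).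
- rewrite HE; apply/seteqP; split=> h.
    by move=> [g Gg /esym gP]; rewrite /= [P * _]gP [_ *m _ * _]mulrK.
  by move=> GPh; exists (P * complexify h * P^-1); rewrite ?mulmxE ?mulrVK.
- move=> g u Gg [x _ <-]; have [h hE] := sP g Gg.
  exists (h *m x) => //; rewrite complexifyM mulmxA -hE.
  by rewrite -!mulmxE !mulmxA [P *m P^-1]mulrV // mul1mx.
- rewrite HE; apply/seteqP; split=> h.
    by move=> GPh; exists (P * complexify h * P^-1); rewrite ?mulmxE ?mulrVK.
  by move=> [g Gg /esym gP]; rewrite /= [P * _]gP [_ *m _ * _]mulrK.
Qed.

(* Two real matrix groups conjugate over the complex numbers by [A + i B] are
   conjugate over the reals by [A + t B] for all but finitely many real [t]. *)
Lemma real_conj (H H' : set 'M[R]_3) (X : 'M[C]_3) : X \is a GRing.unit ->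
  @complexify R 3 3 @` H' = (fun g => X * g * X^-1) @` (@complexify R 3 3 @` H) ->
  conjugate_groups H H'.
Proof.
move=> uX HH'.
pose A := map_mx (@complex.Re R) X; pose B := map_mx (@complex.Im R) X.
have ME (M N : 'M[R]_3) i j :
    (complexify M + 'i *: complexify N) i j = Complex (M i j) (N i j).
  rewrite !mxE -complexiE; apply/eqP; rewrite eq_complex /=.
  by rewrite !mul0r !mul1r oppr0 !addr0 !add0r !eqxx.
have XE : X = complexify A + 'i *: complexify B.
  by apply/matrixP => i j; rewrite ME !mxE; case: (X i j).
have AB h h' : X * complexify h = complexify h' * X -> A * h = h' * A /\ B * h = h' * B.
  rewrite XE mulrDl mulrDr -!mulmxE -scalemxAl -scalemxAr -!complexifyM => /matrixP E.
  by split; apply/matrixP => i j; have := E i j; rewrite !ME => -[].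
pose p := \det (map_mx polyC A + 'X *: map_mx polyC B).
have p0 : p != 0.
  apply: contraTneq uX => p0; rewrite -[_ \is a _]/(X \in unitmx) unitmxE unitfE negbK.
  suff -> : \det X = (map_poly (real_complex R) p).['i] by rewrite p0 rmorph0 horner0.
  rewrite /p -det_map_mx -[RHS]/(horner_eval 'i _) -det_map_mx.
  rewrite XE; congr determinant; apply/matrixP => i j; rewrite !mxE /horner_eval.
  by rewrite rmorphD rmorphM /= map_polyX !map_polyC /horner_eval hornerD hornerM hornerX !hornerC.
have [t pt] := poly_nonroot p0.
pose x := A + t *: B.
have ux : x \is a GRing.unit.
  rewrite -[_ \is a _]/(x \in unitmx) unitmxE unitfE; move: pt.
  rewrite -[p.[t]]/(horner_eval t _) -det_map_mx; congr (_ != 0); congr determinant.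
  by apply/matrixP => i j; rewrite !mxE /= /horner_eval hornerD hornerM hornerX !hornerC.
have xh h h' : X * complexify h = complexify h' * X -> x * h = h' * x.
  by move=> /AB[Ah Bh]; rewrite mulrDl mulrDr Ah -!mulmxE -scalemxAl -scalemxAr !mulmxE Bh.
exists x => //; apply/seteqP; split=> [h' Hh'|_ [h Hh <-]].
  have : (@complexify R 3 3 @` H') (complexify h') by exists h'.
  rewrite HH' => -[_ [h Hh <-] E]; exists h => //.
  by rewrite (xh h h') ?mulrK // -E mulrVK.
have : ((fun g => X * g * X^-1) @` (@complexify R 3 3 @` H)) (X * complexify h * X^-1).
  by exists (complexify h) => //; exists h.
rewrite -HH' => -[h' Hh' E].
by rewrite (xh h h') ?mulrK // E mulrVK.
Qed.

Lemma real_model_complexify G H P : P \is a GRing.unit ->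
  (forall g, G g -> exists h, P^-1 * g * P = complexify h) ->
  H = [set h | G (P * complexify h * P^-1)] ->
  @complexify R 3 3 @` H = (fun g => P^-1 * g * P) @` G.
Proof.
move=> uP GP ->; apply/seteqP; split=> [_ [h Gh <-]|_ [g Gg <-]].
  by exists (P * complexify h * P^-1); rewrite // !mulrA mulVr // mul1r mulrVK.
have [h hE] := GP g Gg; exists h; rewrite /= ?hE // -hE.
by rewrite !mulrA mulrV // mul1r mulrK.
Qed.

(** The change of frame [P'^-1 * P] conjugates the complexified models, and [real_conj] descends
    this to the reals. It makes the class attached to [phi W] well defined. *)
Lemma real_model_uniq G H H' : real_model G H -> real_model G H' -> conjugate_groups H H'.
Proof.
move=> /real_modelP[P [uP GP HE]] /real_modelP[P' [uP' GP' HE']].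
apply: (@real_conj _ _ (P'^-1 * P)); first by rewrite unitrMl ?unitrV.
rewrite (real_model_complexify uP GP HE) (real_model_complexify uP' GP' HE').
rewrite image_comp; apply: eq_imagel => g _ /=.
by rewrite invrM ?unitrV // invrK !mulrA !mulrK.
Qed.

Lemma real_model_conj G H x : x \is a GRing.unit ->
  real_model ((fun g => x * g * x^-1) @` G) H -> real_model G H.
Proof.
move=> ux /real_modelP[P [uP GP HE]]; apply/real_modelP; exists (x^-1 * P); split.
- by rewrite unitrMl // unitrV.
- move=> g Gg; have [|h hE] := GP (x * g * x^-1); first by exists g.
  by exists h; rewrite -hE invrM ?unitrV // invrK !mulrA.
- rewrite HE; apply/seteqP; split=> h /=; rewrite invrM ?unitrV // invrK.
    move=> [g Gg gE].
    have -> : x^-1 * P * complexify h * (P^-1 * x) = x^-1 * (P * complexify h * P^-1) * x.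
      by rewrite !mulrA.
    by rewrite -gE !mulrA mulVr // mul1r mulrVK.
  move=> Gh; exists (x^-1 * P * complexify h * (P^-1 * x)) => //.
  by rewrite /= !mulrA mulrV // mul1r mulrK.
Qed.

End RealForms.

Lemma finite_group_orthogonalizable (R : realType) n (H : set 'M[R]_n.+1) :
  linear_group H -> finite_set H ->
  exists2 x, x \is a GRing.unit & forall h, H h -> (x * h * x^-1)^T * (x * h * x^-1) = 1.
Proof.
move=> lH fH; have sq (y : R) : 0 < y -> exists2 z, z != 0 & idfun z * z = y.
  move=> y0; exists (Num.sqrt y); first by rewrite gt_eqF // sqrtr_gt0.
  by rewrite /= -expr2 sqr_sqrtr // ltW.
have [//|y|x ux xH] := finite_group_unitarizable (sigma := idfun) _ sq _ lH fH.
  by rewrite /= -expr2 sqr_ge0.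
exists x => // h /xH; rewrite /star; congr (_ * _ = _).
by apply/matrixP => i j; rewrite !mxE.
Qed.

Lemma finite_group_unitary (C : numClosedFieldType) n (W : set 'M[C]_n.+1) :
  linear_group W -> finite_set W ->
  exists2 x, x \is a GRing.unit
    & forall g, W g -> star Num.conj (x * g * x^-1) * (x * g * x^-1) = 1.
Proof.
apply: finite_group_unitarizable => [|y y0|y]; first exact: conjCK.
  exists (sqrtC y); first by rewrite sqrtC_eq0 gt_eqF.
  rewrite [X in X * _](_ : _ = sqrtC y) -?expr2 ?sqrtCK //.
  by apply: geC0_conj; rewrite sqrtC_ge0 ltW.
by rewrite mulrC mul_conjC_ge0.
Qed.

Local Opaque phi real_frame quadJ quad_conj.

(** * From reflection groups in the plane to real reflection groups and back *)

Section MainParts.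
Variable R : realType.
Local Notation C := R[i].
Implicit Types (G : set 'M[C]_3) (H : set 'M[R]_3) (W : set 'M[C]_2).

Let two : (2 : C) != 0. Proof. by rewrite pnatr_eq0. Qed.

Lemma order2_group_det W g : order2_reflection_groups W -> W g -> \det g ^+ 2 = 1.
Proof.
move=> [lW fW gW W1]; suff H : W `<=` [set h | h \is a GRing.unit /\ \det h ^+ 2 = 1].
  by move=> /H[].
apply: (generated_by_sub gW).
  split=> [h []//|/=|h k [uh dh] [uk dk] /=|h [uh dh] /=].
  - by rewrite unitr1 det1 expr1n.
  - by rewrite unitrMl // uh det_mulmx exprMn dh dk mulr1.
  - by rewrite unitrV uh [\det _]det_inv exprVn dh invr1.
move=> s [Ws rs] /=; case: lW => uW _ _ _; split; first exact: uW.
by have [_ -> _] := order2_reflection_phi two rs; rewrite sqrrN expr1n.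
Qed.

Lemma order2_group_reflection W : order2_reflection_groups W ->
  exists2 s, W s & order2_reflection s.
Proof.
move=> [lW _ gW W1]; apply: (generated_by_nontrivial lW gW) => E; move: W1; rewrite E => /=.
move=> /matrixP/(_ 0 0); rewrite !mxE eqxx mulr1n => /eqP.
by rewrite -subr_eq0 -opprD oppr_eq0 -[_ + _]/(1 *+ 2) (negPf two).
Qed.

Lemma linear_group_phi W : linear_group W -> linear_group (@phi C @` W).
Proof. by move=> lW; apply: linear_group_image => [//||g h _ _]; [exact: phi1|exact: phiM]. Qed.

Lemma order2_group_real W : order2_reflection_groups W ->
  exists2 P, P \is a GRing.unit &
    forall g, (@phi C @` W) g -> exists h : 'M[R]_3, P^-1 * g * P = complexify h.
Proof.
move=> oW; have [lW fW _ _] := oW.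
have [x ux xW] := finite_group_unitary lW fW.
have upx := phi_unit ux; have pV := phiV ux.
exists ((phi x)^-1 * real_frame C).
  have uF : real_frame C \is a GRing.unit := real_frame_unit C.
  by rewrite (unitrMl _ uF) unitrV; exact: upx.
move=> _ [g Wg <-]; apply: complexify_conj.
have := @unitary_phi_real C (x * g * x^-1) (xW g Wg).
rewrite !det_mulmx [\det _^-1]det_inv mulrAC mulfV ?mul1r; last first.
  by rewrite -unitfE -unitmxE.
move/(_ (order2_group_det oW Wg)); rewrite !phiM pV => E.
by rewrite (conjr_invM _ upx (real_frame_unit C)).
Qed.

Lemma real_model_ex W : order2_reflection_groups W -> exists H, real_model (@phi C @` W) H.
Proof.
move=> /order2_group_real[P uP GP].
by exists [set h | (@phi C @` W) (P * complexify h * P^-1)]; apply/real_modelP; exists P.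
Qed.

Lemma complexify_reflection (h : 'M[R]_3) : reflection (complexify h) -> reflection h.
Proof.
have cB : complexify (h - 1) = complexify h - 1 by rewrite /complexify map_mxB map_mx1.
have cX k : complexify (h ^+ k) = complexify h ^+ k.
  elim: k => [|k IH]; first by rewrite !expr0 complexify1.
  by rewrite !exprS -mulmxE complexifyM IH.
move=> /reflectionE[[k k0 hk] rk]; apply/reflectionE; split.
  by exists k => //; apply: complexify_inj; rewrite cX hk complexify1.
by move: rk; rewrite -cB mxrank_map.
Qed.

Lemma real_model_reflection_group W H : order2_reflection_groups W ->
  real_model (@phi C @` W) H -> real_reflection_groups H.
Proof.
move=> oW /real_modelP[P [uP GP HE]]; have [lW fW gW W1] := oW.
(* Taking real parts makes [f] total; it is the conjugated representation only on [W], which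
   suffices for the image lemmas. *)
pose f (g : 'M[C]_2) := map_mx (@complex.Re R) (P^-1 * phi g * P).
have fE g : W g -> complexify (f g) = P^-1 * phi g * P.
  move=> Wg; have [|h hE] := GP (phi g); first by exists g.
  by rewrite /f hE; congr complexify; apply/matrixP => i j; rewrite !mxE.
clearbody f.
have f1 : f 1 = 1.
  case: lW => _ W11 _ _; apply: complexify_inj.
  by rewrite fE // phi1 mulr1 mulVr // complexify1.
have fM g h : W g -> W h -> f (g * h) = f g * f h.
  move=> Wg Wh; case: (lW) => _ _ WM _; apply: complexify_inj.
  by rewrite complexifyMr (fE _ Wg) (fE _ Wh) (fE _ (WM _ _ Wg Wh)) phiM conjr_mul.
have HfW : H = f @` W.
  rewrite HE; apply/seteqP; split=> [h [g Wg gE]|_ [g Wg <-] /=].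
    exists g => //; apply: complexify_inj; rewrite (fE _ Wg) gE.
    exact: conjrVK.
  exists g => //; rewrite (fE _ Wg); exact/esym/conjrK.
have fr g : W g -> order2_reflection g -> reflection (f g).
  move=> Wg rg; apply: complexify_reflection; rewrite fE //.
  have [_ _ rp] := order2_reflection_phi two rg.
  by rewrite -{2}[P]invrK; apply: reflection_conj; rewrite ?unitrV.
rewrite HfW; split.
- exact: linear_group_image.
- exact: finite_image.
- exact: generated_by_image gW.
- have [s Ws rs] := order2_group_reflection oW.
  move=> E; have : (f @` W) (f s) by exists s.
  by rewrite E => /=; apply: reflection_neq1; apply: fr.
Qed.

Lemma real_reflection_groups_conj H x : x \is a GRing.unit ->
  real_reflection_groups H -> real_reflection_groups ((fun h => x * h * x^-1) @` H).
Proof.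
move=> ux [lH fH gH H1]; split.
- exact: linear_group_conj.
- exact: finite_image.
- by apply: generated_by_conj gH => // g; apply: reflection_conj.
- move=> E; apply: H1; have : conjugate_groups H [set 1] by exists x; rewrite ?E.
  move=> /conj_groups_sym[y uy ->]; rewrite image_set1 conjg1_mx //.
Qed.

Lemma real_model_lift H : real_reflection_groups H ->
  (forall h, H h -> h^T * h = 1) ->
  exists2 W, order2_reflection_groups W & real_model (@phi C @` W) H.
Proof.
move=> [lH fH gH H1] oH; have [uH H11 HM HV] := lH.
have uF : real_frame C \is a GRing.unit := real_frame_unit C.
pose F (h : 'M[R]_3) := real_frame C * complexify h * (real_frame C)^-1.
have Finj : injective F.
  by move=> h k; rewrite /F => /(mulIr _)/(mulrI _) E; apply: complexify_inj; apply: E;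
    rewrite ?unitrV.
have FM h k : F (h * k) = F h * F k by rewrite /F complexifyMr conjgM_mx.
have F1 : F 1 = 1 by rewrite /F complexify1 conjg1_mx.
have FK h : (real_frame C)^-1 * F h * real_frame C = complexify h by exact: conjrVK.
have FE h : F h = real_frame C * complexify h * (real_frame C)^-1 by [].
have lift h : H h -> exists g : 'M[C]_2, \det g ^+ 2 = 1 /\ phi g = F h.
  move=> /oH hh; apply: isom_lift; apply: orthogonal_form_isometry.
  by rewrite -complexify_tr -complexifyMr hh complexify1.
clearbody F.
pose W : set 'M[C]_2 := [set g | \det g ^+ 2 = 1 /\ exists2 h, H h & phi g = F h].
have phiW : @phi C @` W = F @` H.
  apply/seteqP; split=> [_ [g [_ [h Hh gh]] <-]|_ [h Hh <-]]; first by exists h.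
  by have [g [dg gh]] := lift h Hh; exists g => //; split=> //; exists h.
have uW g : W g -> g \is a GRing.unit.
  move=> [dg _]; rewrite -[_ \is a _]/(g \in unitmx) unitmxE unitfE.
  by apply: contra_eq_neq dg => ->; rewrite expr0n eq_sym oner_eq0.
have lW : linear_group W.
  split; first exact: uW.
  - split; first by rewrite det1 expr1n.
    by exists 1; [exact: H11 | rewrite phi1 F1].
  - move=> g k [dg [h Hh gh]] [dk [l Hl kl]]; split.
      by rewrite det_mulmx exprMn dg dk mulr1.
    by exists (h * l); [exact: HM | rewrite phiM gh kl FM].
  - move=> g Wg; case: (Wg) => dg [h Hh gh]; split.
      by rewrite [\det _]det_inv exprVn dg invr1.
    have uh : h \is a GRing.unit := uH _ Hh.
    exists h^-1; first exact: HV.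
    rewrite (phiV (uW _ Wg)) gh; apply/esym/inv_uniq.
      by rewrite -FM mulrV.
    by rewrite -FM mulVr.
have WN g : W g -> W (- g).
  move=> [dg [h Hh gh]]; split; last by exists h; rewrite ?phiN.
  by rewrite -scaleN1r detZ exprMn -exprM muln2 -signr_odd odd_double expr0 mul1r.
have refl_lift h g : H h -> reflection h -> W g -> phi g = F h -> order2_reflection g.
  move=> Hh rh [dg _] gh; have [v v1 hE] := orthogonal_reflection (oH h Hh) rh.
  have h2 : h ^+ 2 = 1.
    by rewrite expr2 hE refl_sqr.
  apply: order2_reflection_lift => //.
    by rewrite gh expr2 -FM -expr2 h2 F1.
  rewrite gh FE -mulmxE mxtrace_mulC mulmxA [(real_frame C)^-1 *m real_frame C]mulVr // mul1mx.
  rewrite -[LHS]/(\tr (map_mx (real_complex R) h)) trace_map_mx (mxtrace_reflection rh h2).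
  by rewrite -[3]/(1 + 2)%:R natrD addrK.
have [s Hs rs] := generated_by_nontrivial lH gH H1.
have fW : finite_set W.
  have [L LE] : exists L : 'M[R]_3 -> 'M[C]_2, forall h, H h -> phi (L h) = F h.
    have /choice[L LE] h : exists g : 'M[C]_2, H h -> phi g = F h.
      have [Hh|nHh] := pselect (H h); last by exists 0.
      by have [g [_ gh]] := lift h Hh; exists g.
    by exists L.
  apply: (@sub_finite_set _ _ ((L @` H) `|` ((fun h => - L h) @` H))).
    move=> g [_ [h Hh gh]]; have /(phi_eq _ _ two)[->|->] : phi (L h) = phi g by rewrite LE.
      by left; exists h.
    by right; exists h.
  by rewrite finite_setU; split; apply: finite_image.
have [WU W11 WM WV] := lW.
have gW : generated_by (@order2_reflection _ _) W.
  apply: generated_byI => // L lL WL; have [_ L1 LM LV] := lL.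
  (* A nontrivial [H] contains a reflection [s], and its two lifts [g] and [- g] are both
     generators; their product is [- g^2 = -1]. *)
  have LN1 : L (- 1).
    have [g [dg gs]] := lift s Hs; have Wg : W g by split=> //; exists s.
    have rg := refl_lift s g Hs rs Wg gs.
    have rNg : order2_reflection (- g).
      apply: (refl_lift s (- g) Hs rs (WN _ Wg)); rewrite phiN; exact: gs.
    have -> : - 1 = g * (- g) by case: rg => _ _ g2; rewrite mulrN -expr2 g2.
    apply: LM; apply: WL; split; [exact: Wg|exact: rg|exact: (WN _ Wg)|exact: rNg].
  (* The induction runs over [H] with a property of all lifts at once: it starts at [h = 1], whose
     lifts are [1] and [-1]. *)
  suff LH : H `<=` [set h | H h /\ forall g, W g -> phi g = F h -> L g].
    by move=> g Wg; have [_ [h Hh gh]] := Wg; have [_] := LH h Hh; apply.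
  apply: (generated_by_sub gH) => [|h [Hh rh]]; last first.
    by split=> // g Wg gh; apply: WL; split=> //; apply: refl_lift gh.
  split.
  - by move=> h [/uH].
  - split=> // g Wg; rewrite F1 -phi1 => /esym/(phi_eq _ _ two)[]->; [exact: L1|exact: LN1].
  - move=> h k [Hh Lh] [Hk Lk]; split; first exact: HM.
    move=> g Wg ghk; have [b [db bk]] := lift k Hk.
    have Wb : W b by split=> //; exists k.
    have ub := WU b Wb; rewrite -[g](mulrVK ub); apply: LM; last exact: (Lk b Wb bk).
    apply: Lh; first exact: (WM _ _ Wg (WV _ Wb)).
    have uk : k \is a GRing.unit := uH _ Hk.
    have uFk : F k \is a GRing.unit by rewrite -bk; exact: phi_unit.
    by rewrite phiM (phiV ub) bk ghk FM (mulrK uFk).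
  - move=> h [Hh Lh]; split; first exact: HV.
    move=> g Wg gh; have ug := WU g Wg; rewrite -[g]invrK; apply: LV; apply: Lh;
      first exact: (WV _ Wg).
    have uh : h \is a GRing.unit := uH _ Hh.
    rewrite (phiV ug) gh; apply/esym/inv_uniq; rewrite -FM ?mulVr ?mulrV //.
exists W; first by split; [exact: lW|exact: fW|exact: gW|exact: (WN _ W11)].
rewrite phiW; apply/real_modelP; exists (real_frame C); split; first exact: uF.
  by move=> _ [h _ <-]; exists h; rewrite FK.
apply/seteqP; split=> [h Hh|h [k Hk]] /=; first by exists h; rewrite ?FE.
by rewrite -FE => /Finj <-.
Qed.

End MainParts.

(** The conjugating matrix is replaced by an isometry, which lifts to [z] in [GL_2]. Conjugation by
    [z] matches [W] and [W'] up to signs, and these are absorbed because both groups contain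
    [-1]. *)
Lemma conj_of_phi_conj (C : numClosedFieldType) (W W' : set 'M[C]_2) :
  linear_group W -> linear_group W' -> W (- 1) -> W' (- 1) ->
  (forall g, W g -> \det g ^+ 2 = 1) -> (forall g, W' g -> \det g ^+ 2 = 1) ->
  conjugate_groups (@phi C @` W) (@phi C @` W') -> conjugate_groups W W'.
Proof.
move=> [uW W1 WM WV] [uW' W1' WM' WV'] WN WN' dW dW' [x ux xW].
have two : (2 : C) != 0 by rewrite pnatr_eq0.
have [||g|y [uy iy yx]] := @form_isometry_conj C 2 (quadJ C) x (@phi C @` W) _ ux.
- exact: quadJ_unit.
- exact: quadJ_sym.
- move=> [k Wk <-]; split.
  + by apply: phi_unit; apply: uW.
  + by apply: isom_phi; apply: dW.
  + have : (@phi C @` W') (x * phi k * x^-1) by rewrite xW; exists (phi k) => //; exists k.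
    by move=> [k' Wk' <-]; apply: isom_phi; apply: dW'.
have [z [dz zy]] := isom_lift iy.
have uz : z \is a GRing.unit.
  rewrite -[_ \is a _]/(z \in unitmx) unitmxE unitfE.
  by apply: contra_eq_neq dz => ->; rewrite expr0n eq_sym oner_eq0.
have phiz g : W g -> phi (z * g * z^-1) = x * phi g * x^-1.
  by move=> Wg; rewrite !phiM (phiV uz) zy yx //; exists g.
have N1 (V : set 'M[C]_2) g : (forall g h, V g -> V h -> V (g * h)) -> V (- 1) -> V g -> V (- g).
  by move=> VM VN Vg; rewrite -mulN1r; apply: VM.
exists z => //; apply/seteqP; split=> [g' Wg'|_ [g Wg <-]].
  have : (@phi C @` W') (phi g') by exists g'.
  rewrite xW => -[_ [g Wg <-] E].
  have /(phi_eq _ _ two)[->|->] : phi (z * g * z^-1) = phi g' by rewrite phiz.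
    by exists g.
  by exists (- g); [exact: N1 | rewrite mulrN mulNr].
have : ((fun g => x * g * x^-1) @` (@phi C @` W)) (x * phi g * x^-1).
  by exists (phi g) => //; exists g.
rewrite -xW -(phiz _ Wg) => -[g' Wg' /(phi_eq _ _ two)[->|->]] //.
exact: N1.
Qed.

Section MainParts.
Variable R : realType.
Local Notation C := R[i].
Implicit Types (G : set 'M[C]_3) (H : set 'M[R]_3) (W : set 'M[C]_2).

Let two : (2 : C) != 0. Proof. by rewrite pnatr_eq0. Qed.

Lemma real_model_conj_complexify G H : real_model G H ->
  conjugate_groups G (@complexify R 3 3 @` H).
Proof.
move=> /real_modelP[P [uP GP HE]]; exists P^-1; first by rewrite unitrV.
by rewrite (real_model_complexify uP GP HE) invrK.
Qed.

Lemma complexify_conj_groups H H' : conjugate_groups H H' ->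
  conjugate_groups (@complexify R 3 3 @` H) (@complexify R 3 3 @` H').
Proof.
move=> [y uy ->]; exists (complexify y); first by rewrite complexify_unit.
rewrite !image_comp; apply: eq_imagel => h _ /=.
by rewrite -complexifyV -!complexifyMr.
Qed.

Lemma order2_groups_conj W W' H H' :
  order2_reflection_groups W -> order2_reflection_groups W' ->
  real_model (@phi C @` W) H -> real_model (@phi C @` W') H' ->
  conjugate_groups H H' -> conjugate_groups W W'.
Proof.
move=> oW oW' mH mH' HH'; have [lW _ _ WN] := oW; have [lW' _ _ WN'] := oW'.
apply: conj_of_phi_conj => //.
- by move=> g; apply: order2_group_det.
- by move=> g; apply: order2_group_det.
apply: conj_groups_trans (real_model_conj_complexify mH) _.
apply: conj_groups_trans (complexify_conj_groups HH') _.
exact: conj_groups_sym (real_model_conj_complexify mH').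
Qed.

Lemma order2_groups_conj_model W W' H H' :
  conjugate_groups W W' -> real_model (@phi C @` W) H -> real_model (@phi C @` W') H' ->
  conjugate_groups H H'.
Proof.
move=> [x ux ->] mH; have upx := phi_unit ux.
have -> : @phi C @` ((fun g => x * g * x^-1) @` W) =
   (fun g => phi x * g * (phi x)^-1) @` (@phi C @` W).
  by rewrite !image_comp; apply: eq_imagel => g _ /=; rewrite !phiM (phiV ux).
by move=> /(real_model_conj upx) mH'; exact: real_model_uniq mH mH'.
Qed.

Lemma phi_group_spec W : linear_group W -> finite_set W -> W (- 1) ->
  [/\ linear_group (@phi C @` W), finite_set (@phi C @` W),
      forall g h, W g -> W h -> phi (g * h) = phi g * phi h
    & forall g h, W g -> W h -> phi g = phi h <-> h = g \/ h = - g].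
Proof.
move=> lW fW _; split.
- exact: linear_group_phi.
- exact: finite_image.
- by move=> g h _ _; exact: phiM.
- by move=> g h _ _; exact: phi_eq.
Qed.

Lemma phi_group_preserves W : order2_reflection_groups W ->
  preserves_form (@quadR C) (@phi C @` W) /\
  exists2 U, real_structure U & stabilizes (@phi C @` W) U.
Proof.
move=> oW; split.
  move=> _ v [g Wg <-]; apply: isom_quadR; apply: isom_phi; exact: (order2_group_det oW Wg).
have [H [P [uP sP _]]] := real_model_ex oW.
by exists (real_span P) => //; exists P.
Qed.

Lemma order2_groups_bijection :
  exists Phi : set (set 'M[C]_2) -> set (set 'M[R]_3),
    set_bij (@conj_class _ _ @` order2_reflection_groups (R := R))
            (@conj_class _ _ @` real_reflection_groups (R := R)) Phi /\
    forall W, order2_reflection_groups W ->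
      (exists H, real_model (@phi C @` W) H) /\
      (forall H, real_model (@phi C @` W) H -> Phi (conj_class W) = conj_class H).
Proof.
(* All representatives and all their real models are allowed, so nothing is chosen; [PhiE] shows
   that they yield a single class. *)
pose Phi (X : set (set 'M[C]_2)) : set (set 'M[R]_3) :=
  [set H' | exists W H, [/\ order2_reflection_groups W, X = conj_class W,
                            real_model (@phi C @` W) H & conjugate_groups H H']].
have PhiE W H : order2_reflection_groups W -> real_model (@phi C @` W) H ->
    Phi (conj_class W) = conj_class H.
  move=> oW mH; apply/seteqP; split=> [H' [W1 [H1 [oW1 /conj_classE WW1 mH1 HH1]]]|H' HH'].
    exact: conj_groups_trans (order2_groups_conj_model WW1 mH mH1) HH1.
  by exists W, H.
exists Phi; split; last by move=> W oW; split=> [|H]; [exact: real_model_ex | exact: PhiE].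
split.
- move=> _ [W oW <-]; have [H mH] := real_model_ex oW; rewrite (PhiE _ _ oW mH).
  by exists H => //; exact: real_model_reflection_group mH.
- move=> X Y /set_mem[W oW <-] /set_mem[W' oW' <-].
  have [H mH] := real_model_ex oW; have [H' mH'] := real_model_ex oW'.
  rewrite (PhiE _ _ oW mH) (PhiE _ _ oW' mH') => /conj_classE HH'.
  by apply/conj_classE; exact: order2_groups_conj oW oW' mH mH' HH'.
(* Only orthogonal groups are lifted, so [H] is first moved inside its class. *)
- move=> _ [H rH <-]; have [lH fH _ _] := rH.
  have [x ux oH] := finite_group_orthogonalizable lH fH.
  have rH' := real_reflection_groups_conj ux rH.
  have [|W oW mW] := real_model_lift rH'; first by move=> _ [h Hh <-]; exact: oH.
  exists (conj_class W); first by exists W.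
  rewrite (PhiE _ _ oW mW); apply/conj_classE; apply: conj_groups_sym.
  by exists x.
Qed.

End MainParts.

(** * Words in reflections and positivity of roots *)

Section AlternatingWords.
Variable I : eqType.
Implicit Types (i j a b : I) (w u v : seq I).

(* Built from the right: [alt a b k] ends in [b]. *)
Fixpoint alt a b k : seq I := if k is k'.+1 then rcons (alt b a k') b else [::].

Lemma size_alt a b k : size (alt a b k) = k.
Proof. by elim: k a b => //= k IH a b; rewrite size_rcons IH. Qed.

Lemma alt_suffix a b k l : exists v, alt a b (k + l) = v ++ alt a b l.
Proof.
elim: l a b => [|l IH] a b; first by exists (alt a b k); rewrite addn0 cats0.
by have [v E] := IH b a; exists v; rewrite addnS /= E rcons_cat.
Qed.

(** The parity of [l] decides which letter comes last, hence the existential pair. *)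
Lemma alt_rev a b k l : exists a' b', (a', b') \in [:: (a, b); (b, a)] /\
  alt a b k ++ rev (alt b a l) = alt a' b' (k + l).
Proof.
elim: l a b k => [|l IH] a b k.
  by exists a, b; rewrite mem_head addn0 cats0.
have [a' [b' [ab E]]] := IH b a k.+1.
exists a', b'; split; first by move: ab; rewrite !inE orbC.
by rewrite /= rev_rcons -cat_rcons -[rcons _ a]/(alt b a k.+1) E addSnnS.
Qed.

Lemma alt_double a b k : alt a b (k + k) = flatten (nseq k [:: a; b]).
Proof.
elim: k => //= k IH; rewrite addnS /= IH -!cats1 -catA /=.
by elim: k {IH} => //= k IH; rewrite IH.
Qed.

End AlternatingWords.

(** * Reflections with prescribed angles *)

Section Tits.
Variables (R : realType) (n : nat) (I : finType).
Variables (m : I -> I -> nat) (al : I -> 'cV[R]_n.+1) (b : I -> 'rV[R]_n.+1).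
Hypothesis m_diag : forall i, m i i = 1%N.
Hypothesis m_sym : forall i j, m i j = m j i.
Hypothesis m_off : forall i j, i != j -> (1 < m i j)%N.
Hypothesis form : forall i j, (b i *m al j) 0 0 = - cos (pi / (m i j)%:R).

(** [b i] will be a row of cosines in the geometric representation, and the transpose of a unit root
    in an orthogonal group. *)
Definition sref i : 'M[R]_n.+1 := 1 - 2 *: (al i *m b i).
Definition wmx (w : seq I) : 'M[R]_n.+1 := \prod_(i <- w) sref i.

Lemma wmx_cat w v : wmx (w ++ v) = wmx w *m wmx v.
Proof. exact: big_cat. Qed.

Lemma wmx_nil : wmx [::] = 1. Proof. exact: big_nil. Qed.

Lemma wmx_rcons w i : wmx (rcons w i) = wmx w *m sref i.
Proof. by rewrite -cats1 wmx_cat /wmx big_seq1. Qed.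

Lemma srefE i v : sref i *m v = v - (2 * (b i *m v) 0 0) *: al i.
Proof.
rewrite /sref mulmxBl mul1mx -scalemxAl -mulmxA [b i *m v]mx11_scalar mul_mx_scalar scalerA.
by rewrite !mxE.
Qed.

Lemma sref_al i j : sref i *m al j = al j + (2 * cos (pi / (m i j)%:R)) *: al i.
Proof. by rewrite srefE form mulrN scaleNr opprK. Qed.

Lemma sref_al_id i : sref i *m al i = - al i.
Proof. by rewrite sref_al m_diag divr1 cospi mulrN1 scaleNr scaler_nat mulr2n opprD addNKr. Qed.

Lemma sref_sqr i : sref i * sref i = 1.
Proof.
have -> : sref i = 1 + al i *m (- 2 *: b i) by rewrite -scalemxAr scaleNr.
rewrite sqr_transvection; have -> : ((- 2 *: b i) *m al i) 0 0 = - 2.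
  by rewrite -scalemxAl mxE form m_diag divr1 cospi opprK mulr1.
by rewrite subrr scale0r addr0.
Qed.

(* For [i != j], the reflections [sref i] and [sref j] act on the vectors [dvec] by
   shifting [x] by [pi / m i j] and exchanging [i] and [j]. *)
Definition dvec i j (x : R) : 'cV[R]_n.+1 :=
  sin (x + pi / (m i j)%:R) *: al i + sin x *: al j.

Lemma sref_dvec i j x : sref i *m dvec j i x = dvec i j (x + pi / (m i j)%:R).
Proof.
rewrite /dvec (m_sym j i) mulmxDr -!scalemxAr sref_al_id sref_al; set t := _ / _.
rewrite scalerDr scalerA scalerN -scaleNr -addrA -scalerDl addrC; congr (_ *: _ + _).
(* The identity is [sin x + sin (x + 2 t) = 2 cos t sin (x + t)]. *)
by have := sinB (x + t) t; rewrite addrK (sinD (x + t) t); lra.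
Qed.

Lemma wmx_alt_dvec i j k x : i != j -> exists i' j', (i', j') \in [:: (i, j); (j, i)] /\
  wmx (alt i j k) *m dvec i j x = dvec i' j' (x + k%:R * (pi / (m i j)%:R)).
Proof.
elim: k i j x => [|k IH] i j x ij.
  by exists i, j; rewrite mem_head wmx_nil mul1mx mul0r addr0.
have [|i' [j' [ij' E]]] := IH j i (x + pi / (m i j)%:R); first by rewrite eq_sym.
exists i', j'; split; first by move: ij'; rewrite !inE orbC.
rewrite /= wmx_rcons -mulmxA sref_dvec (m_sym j i) E (m_sym j i).
by congr (dvec _ _ _); rewrite -natr1; ring.
Qed.

Lemma dihedral_angle i j k : i != j -> (k <= m i j)%N ->
  0 <= sin (k%:R * (pi / (m i j)%:R) : R).
Proof.
move=> ij km; have m0 : (0 : R) < (m i j)%:R by rewrite ltr0n; have := m_off ij; lia.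
apply: sin_ge0_pi; apply/andP; split.
  by apply: mulr_ge0 => //; apply: divr_ge0; [exact: pi_ge0 | exact: ltW].
by rewrite mulrA ler_pdivrMr // mulrC ler_wpM2l ?pi_ge0 // ler_nat.
Qed.

Lemma dihedral_angle_gt0 i j : i != j -> 0 < sin (pi / (m i j)%:R : R).
Proof.
move=> ij; have m0 : (0 : R) < (m i j)%:R by rewrite ltr0n; have := m_off ij; lia.
apply: sin_gt0_pi; rewrite (divr_gt0 (pi_gt0 R) m0) /= ltr_pdivrMr // ltr_pMr ?pi_gt0 //.
by rewrite ltr1n m_off.
Qed.

Definition cone (v : 'cV[R]_n.+1) :=
  exists2 c : I -> R, (forall i, 0 <= c i) & v = \sum_i c i *: al i.

Lemma cone_al i : cone (al i).
Proof.
exists (fun j => (j == i)%:R) => [j|]; first by rewrite ler0n.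
by rewrite (bigD1 i) //= eqxx scale1r big1 ?addr0 // => j /negPf ->; rewrite scale0r.
Qed.

Lemma coneD u v : cone u -> cone v -> cone (u + v).
Proof.
move=> [c c0 ->] [d d0 ->]; exists (fun i => c i + d i) => [i|]; first exact: addr_ge0.
by rewrite -big_split; apply: eq_bigr => i _; rewrite scalerDl.
Qed.

Lemma coneZ a v : 0 <= a -> cone v -> cone (a *: v).
Proof.
move=> a0 [c c0 ->]; exists (fun i => a * c i) => [i|]; first exact: mulr_ge0.
by rewrite scaler_sumr; apply: eq_bigr => i _; rewrite scalerA.
Qed.

(** Up to a positive factor [al i] is [dvec i j 0], and [k] reflections take it to the angle [k t]
    with [t = pi / m i j]. The coefficients become sines of [k t] and [(k + 1) t], both at most
    [pi]. *)
Lemma wmx_alt_al i j k : i != j -> (k < m i j)%N ->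
  exists c d, [/\ 0 <= c, 0 <= d & wmx (alt i j k) *m al i = c *: al i + d *: al j].
Proof.
move=> ij km; have s0 := dihedral_angle_gt0 ij.
have [i' [j' [ij' E]]] := wmx_alt_dvec k 0 ij.
have aE : al i = (sin (pi / (m i j)%:R))^-1 *: dvec i j 0.
  by rewrite /dvec add0r sin0 scale0r addr0 scalerA mulVf ?gt_eqF // scale1r.
have p0 := dihedral_angle ij (ltnW km); have q0 := dihedral_angle ij km.
rewrite aE -scalemxAr {}E add0r -aE.
have q0' : 0 <= sin (k%:R * (pi / (m i j)%:R) + pi / (m i j)%:R : R).
  by move: q0; rewrite -natr1 mulrDl mul1r.
move: ij'; rewrite !inE => /orP[]/eqP[-> ->]; rewrite /dvec scalerDr !scalerA.
  by do 2!eexists; split; last reflexivity; rewrite mulr_ge0 // invr_ge0 ltW.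
rewrite addrC (m_sym j i).
by do 2!eexists; split; last reflexivity; rewrite mulr_ge0 // invr_ge0 ltW.
Qed.

(** On the span of [al i] and [al j] the product turns [dvec] by [2 pi] in total; on the common
    kernel of [b i] and [b j] both reflections are trivial. These subspaces span everything because
    the form on the plane has determinant [sin t ^ 2], which is nonzero. *)
Lemma wmx_braid i j : wmx (flatten (nseq (m i j) [:: i; j])) = 1.
Proof.
have [<-|ij] := eqVneq i j.
  by rewrite m_diag /= -[[:: i; i]]/(rcons [:: i] i) wmx_rcons /wmx big_seq1 [_ *m _]sref_sqr.
set t := pi / (m i j)%:R : R; have s0 := dihedral_angle_gt0 ij; rewrite -/t in s0.
have m0 : (m i j)%:R != 0 :> R by rewrite pnatr_eq0 -lt0n; have := m_off ij; lia.
have D k x : wmx (flatten (nseq k [:: i; j])) *m dvec i j x = dvec i j (x + k%:R * (t *+ 2)).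
  elim: k x => [|k IH] x; first by rewrite /= wmx_nil mul1mx mul0r addr0.
  rewrite /= -[i :: _]/([:: i; j] ++ _) wmx_cat -mulmxA IH.
  rewrite -[[:: i; j]]/(rcons [:: i] j) wmx_rcons /wmx big_seq1 -mulmxA !sref_dvec.
  by congr (dvec i j _); rewrite (m_sym j i) -/t -natr1; ring.
have Dm x : wmx (flatten (nseq (m i j) [:: i; j])) *m dvec i j x = dvec i j x.
  have E : (m i j)%:R * (t *+ 2) = pi *+ 2 by rewrite mulrnAr /t mulrC mulfVK.
  by rewrite D E /dvec addrAC !sinD2pi.
set W := wmx _ in Dm *.
have Wi : W *m al i = al i.
  have := Dm 0; rewrite /dvec add0r sin0 scale0r addr0 -/t -scalemxAr => /(congr1 (fun v =>
    (sin t)^-1 *: v)).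
  by rewrite !scalerA mulVf ?gt_eqF // !scale1r.
have Wj : W *m al j = al j.
  have := Dm (- t); rewrite /dvec -/t addNr sin0 scale0r add0r sinN -scalemxAr =>
    /(congr1 (fun v => (- sin t)^-1 *: v)).
  by rewrite !scalerA mulVf ?oppr_eq0 ?gt_eqF // !scale1r.
have W0 (v : 'cV_n.+1) : (b i *m v) 0 0 = 0 -> (b j *m v) 0 0 = 0 -> W *m v = v.
  move=> vi vj; rewrite /W; elim: (m i j) => [|k IH]; first by rewrite /= wmx_nil mul1mx.
  rewrite /= -[i :: _]/([:: i; j] ++ _) wmx_cat -mulmxA IH.
  rewrite -[[:: i; j]]/(rcons [:: i] j) wmx_rcons /wmx big_seq1 -mulmxA !srefE vj mulr0 scale0r
    subr0.
  by rewrite vi mulr0 scale0r subr0.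
suff H (v : 'cV_n.+1) : W *m v = v.
  by apply/matrixP => k l; have /matrixP/(_ k 0) := H (delta_mx l 0); rewrite -colE !mxE eqxx andbT.
pose p := (b i *m v) 0 0; pose q := (b j *m v) 0 0.
(* The solution of the linear system saying that [v - x al_i - y al_j] is killed by [b i] and
   [b j]. *)
pose x := (p + cos t * q) / sin t ^+ 2; pose y := (q + cos t * p) / sin t ^+ 2.
have bv k : (b k *m (v - x *: al i - y *: al j)) 0 0 =
    (b k *m v) 0 0 - x * (b k *m al i) 0 0 - y * (b k *m al j) 0 0.
  by rewrite !mulmxBr -!scalemxAr !mxE.
have s1 : sin t != 0 by rewrite gt_eqF.
have c2 : cos t ^+ 2 = 1 - sin t ^+ 2 by exact: cos2sin2.
have [v0 v0E] : exists v0, v0 = v - x *: al i - y *: al j by eexists.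
have -> : v = v0 + y *: al j + x *: al i by rewrite v0E !subrK.
rewrite !mulmxDr -!scalemxAr Wi Wj W0 //.
- rewrite v0E bv !form m_diag divr1 cospi -/t -/p /x /y.
  transitivity ((p * sin t ^+ 2 - p * (1 - cos t ^+ 2)) / sin t ^+ 2); first by field.
  by rewrite c2; field.
- rewrite v0E bv !form m_diag divr1 cospi (m_sym j i) -/t -/q /x /y.
  transitivity ((q * sin t ^+ 2 - q * (1 - cos t ^+ 2)) / sin t ^+ 2); first by field.
  by rewrite c2; field.
Qed.

(** * Reduced words modulo a congruence *)

Section Congruence.
Variable E : seq I -> seq I -> Prop.
Hypothesis Erefl : forall u, E u u.
Hypothesis Esym : forall u v, E u v -> E v u.
Hypothesis Etrans : forall u v w, E u v -> E v w -> E u w.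
Hypothesis Ecat : forall u u' v v', E u u' -> E v v' -> E (u ++ v) (u' ++ v').
Hypothesis Ebraid : forall i j, E (flatten (nseq (m i j) [:: i; j])) [::].
Hypothesis Ewmx : forall u v, E u v -> wmx u = wmx v.

Definition reduced w := forall w', E w w' -> (size w <= size w')%N.
(** The weak inequality is enough to exclude words that end in [i]. *)
Definition ascent w i := forall w', E (rcons w i) w' -> (size w <= size w')%N.

Lemma Esquare i : E [:: i; i] [::].
Proof. by have := Ebraid i i; rewrite m_diag. Qed.

Lemma Ercons2 w i : E (rcons (rcons w i) i) w.
Proof. by rewrite -!cats1 -catA -[X in E _ X]cats0; apply: Ecat => //; apply: Esquare. Qed.

Lemma Erev w : E (rev w ++ w) [::].
Proof.
elim: w => [|i w IH]; first exact: Erefl.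
rewrite rev_cons -cats1 -catA /=; apply: (Etrans _ IH).
by apply: Ecat => //; rewrite -[i :: i :: w]/([:: i; i] ++ w) -[X in E _ X]cat0s;
  apply: Ecat => //; apply: Esquare.
Qed.

(** With [v] and [u] the two words, [v ++ rev u] alternates with length [2 m i j], so it is trivial
    by [Ebraid]; then [rev u] cancels against [u]. *)
Lemma alt_braid i j : E (alt i j (m i j)) (alt j i (m i j)).
Proof.
have [i' [j' [ij' rE]]] := alt_rev i j (m i j) (m i j).
have mE : m i j = m i' j' by move: ij'; rewrite !inE => /orP[]/eqP[-> ->] //.
set u := alt j i _ in rE *; set v := alt i j _ in rE *.
have Evu : E (v ++ rev u) [::] by rewrite rE mE alt_double; apply: Ebraid.
have H1 : E (v ++ (rev u ++ u)) v by rewrite -[X in E _ X]cats0; apply: Ecat => //; apply: Erev.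
apply: (Etrans (Esym H1)); rewrite catA -[X in E _ X]cat0s; exact: Ecat.
Qed.

Lemma reduced_ex w : exists2 w', E w w' & reduced w'.
Proof.
suff H k v : (size v <= k)%N -> E w v -> exists2 w', E w w' & reduced w'.
  exact: (H (size w) w).
elim: k v => [|k IH] v sv Ev.
  by exists v => // w' _; move: sv; rewrite leqn0 => /eqP ->.
have [rv|nrv] := pselect (reduced v); first by exists v.
move: nrv => /existsNP[w' /not_implyP[Ew' /negP]]; rewrite -ltnNge => lt.
by apply: (IH w'); [move: (leq_trans lt sv); rewrite ltnS | exact: Etrans Ew'].
Qed.

Lemma reduced_rcons w i : reduced (rcons w i) -> reduced w /\ ascent w i.
Proof.
move=> rw; split=> w' Ew'; have := rw (rcons w' i); rewrite !size_rcons.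
  by rewrite ltnS; apply; rewrite -!cats1; apply: Ecat.
by move=> _; have := rw w' Ew'; rewrite size_rcons; apply: ltnW.
Qed.

Lemma not_ascent_rcons w i : ~ ascent (rcons w i) i.
Proof. by move=> /(_ w (Ercons2 w i)); rewrite size_rcons ltnn. Qed.

(** Since [i] is an ascent, [u] cannot end in [i], and peeling off last letters shows that it
    alternates. If it had at least [m i j] letters, the braid relation would make its last letter an
    [i], and a further [i] would shorten it. *)
Lemma dihedral_reduced u i j : i != j -> {subset u <= [:: i; j]} ->
  reduced u -> ascent u i -> u = alt i j (size u) /\ (size u < m i j)%N.
Proof.
move=> ij us ru au; have uE : u = alt i j (size u).
  elim/last_ind: u i j {ij} us ru au => [//|u x IH] i j us ru au.
  have xj : x = j.
    have := us x; rewrite mem_rcons mem_head !inE => /(_ isT)/orP[]/eqP // xi.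
    by move: au; rewrite xi => /not_ascent_rcons.
  rewrite size_rcons /= xj in us ru *; congr (rcons _ _).
  have [ru' au'] := reduced_rcons ru; apply: IH => // y yu.
  by have := us y; rewrite mem_rcons in_cons yu orbT => /(_ isT); rewrite !inE orbC.
split=> //; rewrite ltnNge; apply/negP => mu.
have [v vE] := alt_suffix i j (size u - m i j) (m i j); rewrite subnK // -uE in vE.
have m0 : (0 < m i j)%N by apply: ltnW; apply: m_off.
have Eu : E (rcons u i) (v ++ alt i j (m i j).-1).
  rewrite vE rcons_cat; apply: Ecat => //; rewrite -cats1.
  apply: (Etrans (Ecat (alt_braid i j) (Erefl [:: i]))).
  by case: (m i j) m0 => // k _ /=; rewrite cats1; apply: Ercons2.
have := au _ Eu; rewrite {1}vE !size_cat !size_alt leq_add2l.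
by rewrite leqNgt prednK // leqnn.
Qed.

(** Let [j] be the last letter of [w]. Among the factorizations of [w] as [v ++ u], of the same
    total length and with [u] a word in [i] and [j], take one with [v] shortest. The dihedral part
    [u] sends [al i] to a nonnegative combination of [al i] and [al j], and induction applies to the
    shorter [v], for which [i] and [j] are both ascents. *)
Lemma ascent_cone w i : reduced w -> ascent w i -> cone (wmx w *m al i).
Proof.
have [k] := ubnP (size w); elim: k w i => // k IH w i.
case/lastP: w => [|w0 j] => [_ _ _|]; first by rewrite wmx_nil mul1mx; apply: cone_al.
rewrite ltnS => szw rw aw; set w := rcons w0 j in szw rw aw *.
have ij : i != j by apply/negP => /eqP ij; move: aw; rewrite /w ij => /not_ascent_rcons.
pose P (v u : seq I) := [/\ {subset u <= [:: i; j]}, E (v ++ u) w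
                          & (size v + size u)%N = size w].
have [v [u [[us Evu szvu] vlt minv]]] : exists v u, [/\ P v u, (size v < size w)%N &
    forall v' u', P v' u' -> (size v <= size v')%N].
  suff H l v u : P v u -> (size v <= l)%N -> (size v < size w)%N -> exists v u,
      [/\ P v u, (size v < size w)%N & forall v' u', P v' u' -> (size v <= size v')%N].
    apply: (H (size w0) w0 [:: j]) => //; last by rewrite /w size_rcons.
    split; last by rewrite /w size_rcons addn1.
      by move=> x; rewrite !inE => ->; rewrite orbT.
    by rewrite cats1; apply: Erefl.
  elim: l v u => [|l IHl] v u Pvu vl vw.
    by exists v, u; split=> // v' u' _; move: vl; rewrite leqn0 => /eqP ->.
  have [mv|] := pselect (forall v' u', P v' u' -> (size v <= size v')%N).
    by exists v, u.
  move=> /existsNP[v' /existsNP[u' /not_implyP[Pv' /negP]]]; rewrite -ltnNge => lt.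
  by apply: (IHl v' u') => //; [rewrite -ltnS (leq_trans lt) | apply: ltn_trans vw].
have rv : reduced v.
  move=> v' Ev'; have := rw (v' ++ u); rewrite -szvu size_cat leq_add2r; apply.
  exact: Etrans (Esym Evu) (Ecat Ev' (Erefl u)).
have ru : reduced u.
  move=> u' Eu'; have := rw (v ++ u'); rewrite -szvu size_cat leq_add2l; apply.
  exact: Etrans (Esym Evu) (Ecat (Erefl v) Eu').
(* Otherwise a letter could be moved from [v] to [u], against the minimality of [v]. *)
have av l : l \in [:: i; j] -> ascent v l.
  move=> lij v' Ev'; rewrite leqNgt; apply/negP => lt.
  have Ew : E (v' ++ l :: u) w.
    rewrite -cat_rcons; apply: (Etrans _ Evu); apply: Ecat => //.
    by apply: (Etrans _ (Ercons2 v l)); rewrite -!cats1; apply: Ecat => //; rewrite cats1;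
      apply: Esym.
  have szle := rw _ (Esym Ew); rewrite size_cat /= in szle.
  have := minv v' (l :: u); rewrite leqNgt lt; suff H : P v' (l :: u) by move=> /(_ H).
  split=> //; first by move=> x; rewrite in_cons => /orP[/eqP ->|/us].
  by rewrite /=; lia.
have au : ascent u i.
  move=> u' Eu'; have := aw (v ++ u'); rewrite -szvu size_cat leq_add2l; apply.
  rewrite -!cats1; apply: (Etrans (Ecat (Esym Evu) (Erefl [:: i]))).
  by rewrite -catA; apply: Ecat => //; rewrite cats1.
have [uE ult] := dihedral_reduced ij us ru au.
have [c [d [c0 d0 cdE]]] := wmx_alt_al ij ult.
rewrite -(Ewmx Evu) wmx_cat -mulmxA uE cdE mulmxDr -!scalemxAr.
apply: coneD; apply: coneZ => //; apply: IH => //; try exact: leq_trans szw;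
  by apply: av; rewrite !inE eqxx ?orbT.
Qed.

Section PositiveForm.
Variable lam : 'rV[R]_n.+1.
Hypothesis lam_gt0 : forall i, 0 < (lam *m al i) 0 0.

Lemma cone_pos v : cone v -> 0 <= (lam *m v) 0 0.
Proof.
move=> [c c0 ->]; rewrite mulmx_sumr summxE sumr_ge0 // => i _.
by rewrite -scalemxAr mxE mulr_ge0 // ltW.
Qed.

(* An element [w <> 1] shortened by [s_i] on the right makes the root [al i] negative. *)
Lemma stabilizer_trivial w : (forall i, (lam *m wmx w *m al i) 0 0 = (lam *m al i) 0 0) ->
  E w [::].
Proof.
have [w' Ew rw] := reduced_ex w; rewrite (Ewmx Ew) => fixw.
case/lastP: w' => [//|w0 i] in Ew rw fixw *.
have [rw0 aw0] := reduced_rcons rw; have := cone_pos (ascent_cone rw0 aw0).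
move: (fixw i); rewrite wmx_rcons -!mulmxA sref_al_id !mulmxN [X in X = _]mxE => H.
by have := lam_gt0 i; rewrite -H oppr_gt0 ltNge => /negP.
Qed.

Lemma wmx_faithful w : wmx w = 1 -> E w [::].
Proof. by move=> w1; apply: stabilizer_trivial => i; rewrite w1 mulmx1. Qed.

End PositiveForm.

Hypothesis al_dual : forall x : I -> R,
  exists f : 'rV[R]_n.+1, forall i, (f *m al i) 0 0 = x i.

Lemma wmx_sub_span w v : exists c : I -> R, wmx w *m v = v + \sum_i c i *: al i.
Proof.
elim/last_ind: w v => [|w j IH] v.
  exists (fun=> 0); rewrite wmx_nil mul1mx big1 ?addr0 // => i _; exact: scale0r.
have [c cE] := IH (sref j *m v); set d := - (2 * (b j *m v) 0 0).
exists (fun i => c i + d * (i == j)%:R).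
rewrite wmx_rcons -mulmxA cE srefE -addrA; congr (_ + _).
under [RHS]eq_bigr => i _ do rewrite scalerDl.
rewrite big_split /= addrC; congr (_ + _); rewrite (bigD1 j) //= eqxx mulr1 big1 ?addr0.
  by rewrite scaleNr.
by move=> i /negPf ->; rewrite mulr0 scale0r.
Qed.

(* If the coordinates of a root [v] had both signs, some form positive on the
   [al i] would vanish on [v], hence be fixed by the reflection in [v]. *)
Lemma root_sign w v : reflection (wmx w) -> v <> 0 -> wmx w *m v = - v ->
  exists2 c : I -> R, v = \sum_i c i *: al i &
    (forall i, 0 <= c i) \/ (forall i, c i <= 0).
Proof.
move=> rw v0 wv; have [c cE] := wmx_sub_span w v.
have vE : v = \sum_i (- c i / 2) *: al i.
  have : (- 2) *: v = \sum_i c i *: al i.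
    by apply: (addrI v); rewrite -cE wv scaleNr scaler_nat mulr2n opprD addrA subrr sub0r.
  move/(congr1 (fun u => (- 2)^-1 *: u));
    rewrite scalerA mulVf ?oppr_eq0 ?pnatr_eq0 // scale1r => ->.
  rewrite scaler_sumr; apply: eq_bigr => i _; rewrite scalerA invrN !mulNr.
  by rewrite [2^-1 * _]mulrC.
move: vE; set e := fun i => - c i / 2 => vE.
have {}vE : v = \sum_i e i *: al i := vE.
exists e => //.
apply: contrapT => /not_orP[/existsNP[j /negP]]; rewrite -ltNge => ej.
move=> /existsNP[k /negP]; rewrite -ltNge => ek.
pose P := \sum_(i | 0 < e i) e i; pose N := \sum_(i | e i <= 0) - e i.
have P0 : 0 < P.
  by rewrite /P (bigD1 k) //= ltr_wpDr // sumr_ge0 // => i /andP[/ltW].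
have N0 : 0 < N.
  rewrite /N (bigD1 j) ?ltW //= ltr_wpDr ?oppr_gt0 // sumr_ge0 // => i /andP[ei _].
  by rewrite oppr_ge0.
(* With these weights the positive coordinates contribute [P N] to [f v] and the others [- N P]. *)
have [f fE] := al_dual (fun i => if 0 < e i then N else P).
have f0 i : 0 < (f *m al i) 0 0 by rewrite fE; case: ifP.
have fv : f *m v = 0.
  apply/matrixP => r s; rewrite (ord1 r) (ord1 s) vE mulmx_sumr summxE mxE.
  rewrite (bigID (fun i => 0 < e i)) /=.
  rewrite (eq_bigr (fun i => e i * N)) => [|i ei]; last by rewrite -scalemxAr mxE fE ei.
  rewrite -mulr_suml -/P [X in _ + X](eq_bigr (fun i => e i * P)) => [|i ei]; last first.
    by rewrite -scalemxAr mxE fE (negPf ei).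
  rewrite -mulr_suml (eq_bigl (fun i => e i <= 0)) => [|i]; last by rewrite -leNgt.
  have -> : \sum_(i | e i <= 0) e i = - N by rewrite /N sumrN opprK.
  by rewrite mulNr mulrC subrr.
have v1 : -1 != 1 :> R by rewrite -subr_eq0 -opprD oppr_eq0 -[_ + _]/(1 *+ 2) pnatr_eq0.
have [g gE] : exists g : 'rV_n.+1, wmx w = 1 + v *m g.
  by apply: (reflection_vec rw v1 v0); rewrite scaleN1r.
have fw : f *m wmx w = f by rewrite gE mulmxDr mulmx1 mulmxA fv mul0mx addr0.
have /Ewmx : E w [::] by apply: (stabilizer_trivial f0) => i; rewrite fw.
by rewrite wmx_nil; apply: reflection_neq1.
Qed.

End Congruence.

End Tits.

(** * The geometric representation of a Coxeter system *)

Section UnitMatrixGroup.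
Variables (F : fieldType) (n : nat).

(** The universal property in [coxeter_system] has a [groupType] as target, so the general linear
    group is packaged as one. *)
Definition gl_mx := {g : 'M[F]_n.+1 | g \is a GRing.unit}.
HB.instance Definition _ := Choice.on gl_mx.
Implicit Types x y z : gl_mx.

Definition gl_one : gl_mx := exist _ 1 (unitr1 _).

Lemma gl_mul_subproof x y : val x * val y \is a GRing.unit.
Proof. by rewrite unitrMl (valP x, valP y). Qed.
Definition gl_mul x y : gl_mx := exist _ (val x * val y) (gl_mul_subproof x y).

Lemma gl_inv_subproof x : (val x)^-1 \is a GRing.unit.
Proof. by rewrite unitrV (valP x). Qed.
Definition gl_inv x : gl_mx := exist _ (val x)^-1 (gl_inv_subproof x).

Lemma gl_mulA : associative gl_mul.
Proof. by move=> x y z; apply/val_inj; rewrite /= mulrA. Qed.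
Lemma gl_mul1g : left_id gl_one gl_mul.
Proof. by move=> x; apply/val_inj; rewrite /= mul1r. Qed.
Lemma gl_mulg1 : right_id gl_one gl_mul.
Proof. by move=> x; apply/val_inj; rewrite /= mulr1. Qed.
Lemma gl_mulVg : left_inverse gl_one gl_inv gl_mul.
Proof. by move=> x; apply/val_inj; rewrite /= mulVr // (valP x). Qed.
Lemma gl_mulgV : right_inverse gl_one gl_inv gl_mul.
Proof. by move=> x; apply/val_inj; rewrite /= mulrV // (valP x). Qed.

HB.instance Definition _ := isGroup.Build gl_mx gl_mulA gl_mul1g gl_mulg1 gl_mulVg gl_mulgV.

Lemma val_glM x y : val (x * y)%g = val x * val y. Proof. by []. Qed.
Lemma val_glX x k : val (x ^+ k)%g = val x ^+ k.
Proof. by elim: k => [|k IH]; rewrite ?expg0 ?expr0 // expgS exprS val_glM IH. Qed.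

End UnitMatrixGroup.

(* [s * t] is unipotent, hence trivial when its order is finite. *)
Lemma reflection_uniq (F : numFieldType) n (H : set 'M[F]_n.+1) s t (v : 'cV_n.+1) :
  linear_group H -> finite_set H -> H s -> H t -> reflection s -> reflection t ->
  v <> 0 -> s *m v = - v -> t *m v = - v -> s = t.
Proof.
move=> lH fH Hs Ht rs rt v0 sv tv; have [_ _ HM _] := lH.
have v1 : -1 != 1 :> F by rewrite -subr_eq0 -opprD oppr_eq0 -[_ + _]/(1 *+ 2) pnatr_eq0.
have [f sE] : exists f : 'rV_n.+1, s = 1 + v *m f.
  by apply: (reflection_vec rs v1 v0); rewrite scaleN1r.
have [g tE] : exists g : 'rV_n.+1, t = 1 + v *m g.
  by apply: (reflection_vec rt v1 v0); rewrite scaleN1r.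
have ev (h : 'rV_n.+1) : (1 + v *m h) *m v = - v -> (h *m v) 0 0 = - 2.
  rewrite mulmxDl mul1mx -mulmxA [h *m v]mx11_scalar mul_mx_scalar => /eqP.
  rewrite addrC -subr_eq0 opprK -addrA -mulr2n -scaler_nat -scalerDl scaler_eq0.
  by case/orP=> [|/eqP//]; rewrite addr_eq0 => /eqP ->; rewrite mxE eqxx.
have fv : (f *m v) 0 0 = - 2 by apply: ev; rewrite -sE.
have gv : (g *m v) 0 0 = - 2 by apply: ev; rewrite -tE.
have st k : (s * t) ^+ k = 1 + k%:R *: (v *m (f - g)).
  have fgv : ((f - g) *m v) 0 0 = 0 by rewrite mulmxBl mxE [X in _ + X]mxE fv gv subrr.
  have st1 : s * t = 1 + v *m (f - g).
    rewrite sE tE mulrDl mul1r mulrDr mulr1 -[X in _ + (_ + X)]/((v *m f) *m (v *m g)).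
    rewrite mulmx_col_row fv mulmxBr -addrA; congr (1 + _).
    by rewrite addrCA scaleNr scaler_nat mulr2n opprD addNKr.
  elim: k => [|k IH]; first by rewrite expr0 scale0r addr0.
  rewrite exprS IH st1 mulrDl mul1r mulrDr mulr1 -[X in _ + (_ + X)]/((v *m (f - g)) *m _).
  rewrite -scalemxAr mulmx_col_row fgv scale0r scaler0 addr0.
  by rewrite -addrA -natr1 scalerDl scale1r.
have [k k0 stk] := finite_order lH fH (HM _ _ Hs Ht).
have : k%:R *: (v *m (f - g)) = 0.
  by apply: (addrI 1); rewrite addr0 -st stk.
move=> /eqP; rewrite scaler_eq0 pnatr_eq0 eqn0Ngt k0 /= mulmxBr subr_eq0 => /eqP E.
by rewrite sE tE E.
Qed.

Lemma gen_words (gT : finGroupType) (S : {set gT}) : <<S>>%g = [set: gT]%SET ->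
  forall x : gT, exists w : seq {y : gT | y \in S}, x = (\prod_(i <- w) val i)%g.
Proof.
move=> gS x; have : x \in <<S>>%g by rewrite gS inE.
move=> /gen_prodgP[k [c cS ->]].
exists [seq exist _ (c i) (cS i) | i <- index_enum 'I_k].
by rewrite big_map.
Qed.

Section GeometricRepresentation.
Variables (R : realType) (c : finCoxeter).
Local Notation gT := (cox_group c).
Local Notation S := (cox_gens c).
Let I : finType := {y : gT | y \in S}.
Implicit Types (i j : I).

Definition cox_m (i j : I) : nat := #[(val i * val j)%g]%g.

Lemma cox_gens_order2 (i : I) : (val i * val i = 1)%g.
Proof.
have [_ o2 _] := cox_axiom c; have := o2 _ (valP i) => o.
by have := expg_order (val i); rewrite o expgS expg1.
Qed.

Lemma cox_m_diag i : cox_m i i = 1%N.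
Proof. by rewrite /cox_m cox_gens_order2 order1. Qed.

Lemma cox_m_sym i j : cox_m i j = cox_m j i.
Proof.
rewrite /cox_m -orderV invMg; congr #[(_ * _)%g]%g; apply/eqP.
  by rewrite eq_invg_mul cox_gens_order2.
by rewrite eq_invg_mul cox_gens_order2.
Qed.

Lemma cox_m_off i j : i != j -> (1 < cox_m i j)%N.
Proof.
move=> ij; rewrite /cox_m order_gt1; apply: contra ij; rewrite -eq_invg_mul => /eqP E.
by apply/eqP/val_inj; rewrite -E; apply/eqP; rewrite eq_sym eq_invg_mul cox_gens_order2.
Qed.

Hypothesis small : (cox_rank c <= 3)%N.

Lemma card_cox_index : #|I| = cox_rank c.
Proof. by rewrite card_sig. Qed.

Lemma cox_index_le3 : (#|I| <= 3)%N. Proof. by rewrite card_cox_index. Qed.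

Definition cox_coord (i : I) : 'I_3 := widen_ord cox_index_le3 (enum_rank i).

Lemma cox_coord_inj : injective cox_coord.
Proof. by move=> i j /(congr1 val) /= /val_inj /enum_rank_inj. Qed.

Definition cox_al (i : I) : 'cV[R]_3 := delta_mx (cox_coord i) 0.
(** The sum has at most one term, as [cox_coord] is injective. It vanishes at coordinates that
    belong to no generator, which all reflections therefore fix. *)
Definition cox_b (i : I) : 'rV[R]_3 :=
  \row_k \sum_(j | cox_coord j == k) - cos (pi / (cox_m i j)%:R).

Lemma cox_form i j : (cox_b i *m cox_al j) 0 0 = - cos (pi / (cox_m i j)%:R).
Proof.
rewrite -colE !mxE (big_pred1 j) // => k; exact: (inj_eq cox_coord_inj).
Qed.

Lemma cox_dual (x : I -> R) : exists f : 'rV[R]_3, forall i, (f *m cox_al i) 0 0 = x i.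
Proof.
exists (\row_k \sum_(j | cox_coord j == k) x j) => i; rewrite -colE !mxE (big_pred1 i) // => k.
exact: (inj_eq cox_coord_inj).
Qed.

Let sr := sref cox_al cox_b.
Let wm := wmx cox_al cox_b.

Lemma sr_sqr i : sr i * sr i = 1.
Proof. exact: (sref_sqr cox_m_diag cox_form). Qed.

Lemma sr_unit i : sr i \is a GRing.unit.
Proof. by apply/unitrP; exists (sr i); rewrite sr_sqr. Qed.

Lemma cox_rep_ex : exists rho : gT -> 'M[R]_3,
  (forall x y, rho (x * y)%g = rho x * rho y) /\
  (forall i : I, rho (val i) = sr i).
Proof.
have [_ _ uni] := cox_axiom c.
(* Only the values on generators matter; other elements get the default value 1. *)
pose f (x : gT) : gl_mx R 2 :=
  if insub x is Some i then exist _ (sr i) (sr_unit i) else 1%g.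
have fE (i : I) : f (val i) = exist _ (sr i) (sr_unit i) by rewrite /f valK.
have [|F [FM FS]] := uni _ f.
  move=> s t sS tS; pose i : I := exist _ s sS; pose j : I := exist _ t tS.
  rewrite -[s]/(val i) -[t]/(val j) !fE; apply/val_inj; rewrite val_glX val_glM /=.
  rewrite -[RHS](wmx_braid cox_m_diag cox_m_sym cox_m_off cox_form i j) -/(cox_m i j).
  elim: (cox_m i j) => [|k IH]; first by rewrite /= wmx_nil expr0.
  rewrite exprS IH -[flatten (nseq k.+1 _)]/([:: i; j] ++ flatten (nseq k [:: i; j])) wmx_cat.
  congr (_ *m _).
  by rewrite /wmx big_cons big_seq1.
exists (fun x => val (F x)); split=> [x y|i]; first by rewrite FM.
by rewrite FS ?fE //; exact: (valP i).
Qed.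

Lemma cox_group_model : (0 < cox_rank c)%N ->
  exists H : set 'M[R]_3, real_reflection_groups H /\ coxeter_model H c.
Proof.
move=> rank0; have [rho [rhoM rhoS]] := cox_rep_ex; have [gS _ _] := cox_axiom c.
have rho1 : rho 1%g = 1.
  have [i _] : exists i : I, true by have := rank0; rewrite -card_cox_index => /card_gt0P[i _];
    exists i.
  by rewrite -(cox_gens_order2 i) rhoM rhoS sr_sqr.
have rhow (w : seq I) : rho (\prod_(i <- w) val i)%g = wm w.
  elim: w => [|i w IH]; first by rewrite big_nil rho1 /wm wmx_nil.
  by rewrite big_cons rhoM IH rhoS /wm /wmx big_cons.
(* For this congruence, [wmx_faithful] is the injectivity of [rho] and [root_sign] says that the
   basis vectors form a simple system. *)
pose E (u v : seq I) := (\prod_(i <- u) val i = \prod_(i <- v) val i)%g.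
have Ewm u v : E u v -> wm u = wm v by move=> Euv; rewrite -(rhow u) -(rhow v); congr rho.
have Ecat u u' v v' : E u u' -> E v v' -> E (u ++ v) (u' ++ v').
  by move=> Eu Ev; rewrite /E !big_cat; congr (_ * _)%g.
have Ebraid i j : E (flatten (nseq (cox_m i j) [:: i; j])) [::].
  rewrite /E big_nil big_flatten /= big_nseq -[RHS](expg_order (val i * val j)%g).
  rewrite -/(cox_m i j); elim: (cox_m i j) => //= k ->.
  by rewrite big_cons big_seq1 expgS.
have Erefl u : E u u by [].
have Esym u v : E u v -> E v u by move=> Euv; exact: esym Euv.
have Etrans u v w : E u v -> E v w -> E u w by move=> Euv; exact: etrans Euv.
have [lam lamE] := cox_dual (fun=> 1).
have lam0 i : 0 < (lam *m cox_al i) 0 0 by rewrite lamE.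
have words := gen_words gS.
have faithful w := wmx_faithful cox_m_diag cox_m_sym cox_m_off cox_form
   Erefl Esym Etrans Ecat Ebraid Ewm lam0 (w := w).
have rhoV x : rho x * rho x^-1%g = 1 by rewrite -rhoM mulgV rho1.
have rhoV' x : rho x^-1%g * rho x = 1 by rewrite -rhoM mulVg rho1.
have rho_inj : injective rho.
  move=> x y xy; have [w wE] := words (x^-1 * y)%g.
  have : E w [::] by apply: faithful; rewrite -/wm -rhow -wE rhoM -xy rhoV'.
  by rewrite /E big_nil -wE => /eqP; rewrite -eq_mulVg1 => /eqP.
have lH : linear_group (range rho).
  split.
  - by move=> _ [x _ <-] /=; apply/unitrP; exists (rho x^-1%g); rewrite rhoV rhoV'.
  - by exists 1%g.
  - by move=> _ _ [x _ <-] [y _ <-]; exists (x * y)%g.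
  - by move=> _ [x _ <-]; exists x^-1%g => //; apply: inv_uniq.
have fH : finite_set (range rho) by apply: finite_image; exact: finite_finset.
have srr i : reflection (sr i).
  have -> : sr i = 1 + cox_al i *m (- 2 *: cox_b i) by rewrite /sr /sref -scalemxAr scaleNr.
  apply: reflection_involutionI; first by rewrite pnatr_eq0.
  by rewrite -scalemxAl mxE cox_form cox_m_diag divr1 cospi opprK mulr1.
have Hs i : range rho (sr i) by rewrite -rhoS; exists (val i).
have gH : generated_by (@reflection _ _) (range rho).
  apply: generated_byI => // L [_ L1 LM LV] HL _ [x _ <-].
  have [w ->] := words x; rewrite rhow /wm; elim: w => [|i w IH]; first by rewrite wmx_nil.
  rewrite -cat1s wmx_cat; apply: LM => //; rewrite /wmx big_seq1.
  by apply: HL; split; [exact: Hs | exact: srr].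
have nt : range rho <> [set 1].
  have [i _] : exists i : I, true by have := rank0; rewrite -card_cox_index => /card_gt0P[i _];
    exists i.
  by move=> HE; have := Hs i; rewrite HE => /=; apply: reflection_neq1.
exists (range rho); split; first by split.
exists rho; split => //.
pose A : 'M[R]_(3, #|I|) := \matrix_(k < 3, j < #|I|) cox_al (enum_val j) k 0.
have colA (j : 'I_#|I|) : col j A = cox_al (enum_val j).
  by apply/matrixP => k l; rewrite !mxE (ord1 l).
have al0 i : cox_al i <> 0.
  by move=> /matrixP/(_ (cox_coord i) 0) /eqP; rewrite !mxE !eqxx oner_eq0.
exists #|I|, A; split.
- apply/eqP; rewrite eqn_leq rank_leq_col /=.
  have AA : A^T *m A = 1%:M.
    apply/matrixP => i j; rewrite !mxE; under eq_bigr => k _ do rewrite !mxE andbT andbT.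
    rewrite (bigD1 (cox_coord (enum_val i))) //= eqxx mul1r big1 ?addr0.
      by rewrite (inj_eq cox_coord_inj) (inj_eq enum_val_inj).
    by move=> k /negPf ->; rewrite mul0r.
  by have := mxrankM_maxr A^T A; rewrite AA mxrank1.
- move=> i; rewrite colA; split=> //; exists (sr (enum_val i)); split=> //.
  exact: (sref_al_id cox_m_diag cox_form).
- move=> v [v0 [_ [[x _ <-] rx xv]]]; have [w wE] := words x.
  rewrite wE rhow in rx xv.
  have [e vE e0] := root_sign cox_m_diag cox_m_sym cox_m_off cox_form
    Erefl Esym Etrans Ecat Ebraid Ewm cox_dual rx v0 xv.
  exists (\col_j e (enum_val j)); last first.
    by case: e0 => e0; [left|right] => i; rewrite mxE.
  rewrite vE; apply/matrixP => k l; rewrite mxE summxE (reindex (@enum_val I predT)) /=; last first.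
    by apply: onW_bij; apply: enum_val_bij.
  by apply: eq_bigr => j _; rewrite !mxE (ord1 l) mulrC.
- apply/seteqP; split.
    move=> _ [s sS <-]; pose i : I := exist _ s sS.
    rewrite -[s]/(val i) rhoS; split=> //; exists (enum_rank i).
    by rewrite colA enum_rankK; exact: (sref_al_id cox_m_diag cox_form).
  move=> s [Hs1 rs [j sj]]; rewrite colA in sj.
  have -> : s = sr (enum_val j).
    apply: (reflection_uniq lH fH Hs1 (Hs _) rs (srr _) _ sj); first exact: al0.
    exact: (sref_al_id cox_m_diag cox_form).
  by rewrite -rhoS; exists (val (enum_val j)) => //; exact: (valP (enum_val j)).
Qed.

End GeometricRepresentation.

(** * Simple bases of finite orthogonal reflection groups *)

Section OrthogonalTools.
Variables (R : realType) (n : nat).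
Implicit Types (u v w : 'cV[R]_n.+1) (h Q : 'M[R]_n.+1).

Lemma orthogonal_inv h : h^T * h = 1 -> h^-1 = h^T.
Proof. by move=> hh; apply/esym/inv_uniq => //; exact: (mulmx1C hh). Qed.

Lemma orthogonal_unit h : h^T * h = 1 -> h \is a GRing.unit.
Proof. by move=> hh; apply/unitrP; exists h^T; split=> //; exact: (mulmx1C hh). Qed.

Lemma orthogonalM h Q : h^T * h = 1 -> Q^T * Q = 1 -> (h * Q)^T * (h * Q) = 1.
Proof. by move=> hh QQ; rewrite -!mulmxE trmx_mul mulmxA -(mulmxA _ h^T) [h^T *m h]hh mulmx1. Qed.

Lemma refl_conj h v : h^T * h = 1 -> h * refl v * h^-1 = refl (h *m v).
Proof.
move=> hh; rewrite (orthogonal_inv hh) /refl mulrBr mulr1 mulrBl [h * h^T](mulmx1C hh).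
congr (_ - _); rewrite -!mulmxE -scalemxAr -scalemxAl; congr (_ *: _).
by rewrite trmx_mul !mulmxA.
Qed.

Lemma reflN v : refl (- v) = refl v.
Proof. by rewrite /refl linearN /= mulmxN mulNmx opprK. Qed.

Lemma refl_orthogonal v : dotv v v = 1 -> (refl v)^T * refl v = 1.
Proof. by move=> vv; rewrite refl_sym refl_sqr. Qed.

Lemma refl_self v : dotv v v = 1 -> refl v *m v = - v.
Proof. by move=> vv; rewrite reflE vv mulr1 scaler_nat mulr2n opprD addNKr. Qed.

Lemma refl_reflection v : dotv v v = 1 -> reflection (refl v).
Proof.
move=> vv; have -> : refl v = 1 + v *m (- 2 *: v^T) by rewrite -scalemxAr scaleNr.
apply: reflection_involutionI; first by rewrite pnatr_eq0.
by rewrite -scalemxAl mxE -/(dotv v v) vv mulr1.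
Qed.

Lemma unit_scalar v a : dotv v v = 1 -> dotv (a *: v) (a *: v) = 1 -> a = 1 \/ a = -1.
Proof.
move=> vv; rewrite dotvZl dotvZr vv mulr1 -expr2 => /eqP.
by rewrite sqrf_eq1 => /orP[]/eqP; [left|right].
Qed.

Definition unitv v := (Num.sqrt (dotv v v))^-1 *: v.

Lemma unitv_unit v : v <> 0 -> dotv (unitv v) (unitv v) = 1.
Proof.
move=> /eqP v0; rewrite /unitv dotvZl dotvZr mulrA -expr2 exprVn sqr_sqrtr ?dotv_ge0 //.
by rewrite mulVf // gt_eqF // dotv_gt0.
Qed.

Lemma unitv_scale v : v <> 0 -> exists2 k, 0 < k & v = k *: unitv v.
Proof.
move=> /eqP v0; have k0 : 0 < Num.sqrt (dotv v v) by rewrite sqrtr_gt0 dotv_gt0.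
by exists (Num.sqrt (dotv v v)) => //; rewrite /unitv scalerA mulfV ?gt_eqF // scale1r.
Qed.

(* Householder: the reflection in [u - v] exchanges [u] and [v]. *)
Lemma householder u v : dotv u u = dotv v v ->
  exists h, [/\ h^T * h = 1, h *m u = v &
    forall w, dotv u w = dotv v w -> h *m w = w].
Proof.
move=> uv; have [->|d0] := eqVneq u v.
  by exists 1; split=> [||w _]; rewrite ?trmx1 ?mulr1 ?mul1mx.
have d0' : u - v <> 0 by apply/eqP; rewrite subr_eq0.
exists (refl (unitv (u - v))); split.
- by rewrite refl_orthogonal // unitv_unit.
- rewrite reflE /unitv dotvZl scalerA mulrCA mulrAC -expr2 exprVn sqr_sqrtr ?dotv_ge0 //.
  have -> : 2 * dotv (u - v) u = dotv (u - v) (u - v).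
    by rewrite !dotvBl !dotvBr uv (dotvC u v); ring.
  rewrite mulVf; first by rewrite scale1r opprB addrC subrK.
  by rewrite gt_eqF // dotv_gt0 //; apply/eqP.
- move=> w uvw; have E : dotv (u - v) w = 0 by rewrite dotvBl uvw subrr.
  by rewrite reflE /unitv dotvZl E !mulr0 scale0r subr0.
Qed.

(** The vectors are put in place one at a time by Householder reflections. A new reflection fixes
    the vectors already placed, since these have the same product with [Q *m a k'] and with
    [a' k']. *)
Lemma gram_isometry r (a a' : 'I_r -> 'cV[R]_n.+1) :
  (forall i j, dotv (a i) (a j) = dotv (a' i) (a' j)) ->
  exists Q, Q^T * Q = 1 /\ forall i, Q *m a i = a' i.
Proof.
move=> aa; suff H k : (k <= r)%N -> exists Q, Q^T * Q = 1 /\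
    forall i : 'I_r, (i < k)%N -> Q *m a i = a' i.
  by have [Q [QQ Qa]] := H r (leqnn r); exists Q; split=> // i; apply: Qa.
elim: k => [|k IH] kr; first by exists 1; split=> //; rewrite trmx1 mulr1.
have [Q [QQ Qa]] := IH (ltnW kr); pose k' := Ordinal kr.
have [|h [hh hu hf]] := @householder (Q *m a k') (a' k').
  by rewrite orthogonal_dotv.
exists (h * Q); split; first exact: orthogonalM.
move=> i; rewrite ltnS leq_eqVlt => /orP[/eqP ik|ik].
  by rewrite -mulmxE -mulmxA (_ : i = k') // ; apply/val_inj.
rewrite -mulmxE -mulmxA Qa // hf // -{1}(Qa i ik) orthogonal_dotv //.
Qed.

End OrthogonalTools.

Section SimpleBases.
Variables (R : realType) (n : nat) (H : set 'M[R]_n.+1).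
Hypotheses (lH : linear_group H) (fH : finite_set H).
Hypothesis oH : forall h, H h -> h^T * h = 1.
Implicit Types (u v w : 'cV[R]_n.+1) (h s : 'M[R]_n.+1).

Definition unit_root v := dotv v v = 1 /\ H (refl v).

Lemma unit_rootN v : unit_root v -> unit_root (- v).
Proof. by move=> [vv Hv]; split; rewrite ?reflN // dotvNl dotvNr opprK. Qed.

Lemma unit_root_act h v : H h -> unit_root v -> unit_root (h *m v).
Proof.
move=> Hh [vv Hv]; have [_ _ HM HV] := lH; split; first by rewrite orthogonal_dotv // oH.
by rewrite -refl_conj ?oH //; apply: (HM _ _ (HM _ _ Hh Hv) (HV _ Hh)).
Qed.

Lemma unit_root_neq0 v : unit_root v -> v <> 0.
Proof. by move=> [vv _] v0; move/eqP: vv; rewrite v0 dotv0r eq_sym oner_eq0. Qed.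

Lemma reflection_root s v : H s -> reflection s -> v <> 0 -> s *m v = - v ->
  s = refl (unitv v).
Proof.
move=> Hs rs v0 sv; have [u uu sE] := orthogonal_reflection (oH Hs) rs.
have vE : v = dotv u v *: u.
  have : 2 *: v = 2 *: (dotv u v *: u).
    have : v - s *m v = (2 * dotv u v) *: u by rewrite sE reflE opprB addrC subrK.
    by rewrite sv opprK scalerA => <-; rewrite scaler_nat mulr2n.
  by move/scalerI; apply; rewrite pnatr_eq0.
have [k k0 vk] := unitv_scale v0.
have vu : unitv v = (dotv u v / k) *: u.
  by rewrite mulrC -scalerA -vE {2}vk scalerA mulVf ?gt_eqF // scale1r.
have := unitv_unit v0; rewrite sE vu => /(unit_scalar uu)[]->.
  by rewrite scale1r.
by rewrite scaleN1r reflN.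
Qed.

Lemma root_vectorP v : root_vector H v <-> v <> 0 /\ unit_root (unitv v).
Proof.
split=> [[v0 [s [Hs rs sv]]]|[v0 [vv Hv]]].
  by split=> //; split; [exact: unitv_unit | rewrite -(reflection_root Hs rs v0 sv)].
split=> //; exists (refl (unitv v)); split=> //; first exact: refl_reflection.
have [k k0 {2 3}->] := unitv_scale v0.
by rewrite -scalemxAr refl_self // scalerN.
Qed.

Lemma unit_roots_enum : exists rs : seq 'cV[R]_n.+1, forall v, unit_root v <-> v \in rs.
Proof.
have [s [_ sH _]] := finite_group_enum lH fH.
have /choice[f fE] h : exists v, (H h /\ reflection h) -> dotv v v = 1 /\ h = refl v.
  have [[Hh rh]|nh] := pselect (H h /\ reflection h); last by exists 0.
  by have [v vv hv] := orthogonal_reflection (oH Hh) rh; exists v.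
pose t := [seq f h | h <- s] ++ [seq - f h | h <- s].
exists [seq v <- t | `[< unit_root v >]] => v; rewrite mem_filter; split; last first.
  by move=> /andP[/asboolP].
move=> rv; have [vv Hv] := rv; apply/andP; split; first exact/asboolP.
have [uu E] := fE (refl v) (conj Hv (refl_reflection vv)).
have hs : refl v \in s by apply/sH.
rewrite mem_cat; set u := f (refl v) in uu E.
have vE : v = dotv u v *: u.
  apply: (@scalerI _ _ (- 2)); first by rewrite oppr_eq0 pnatr_eq0.
  apply: (addrI v); rewrite scalerA mulNr [in RHS]scaleNr -reflE -E refl_self //.
  by rewrite scaleNr scaler_nat mulr2n opprD addrA subrr sub0r.
have := vv; rewrite vE => /(unit_scalar uu)[]->.
  by rewrite scale1r map_f.
by rewrite scaleN1r (map_f (fun h => - f h)) ?orbT.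
Qed.

(** A simple system as in [simple_reflections], with roots of length 1, so that a reflection
    determines its root up to sign. *)
Definition simple_base r (al : 'I_r -> 'cV[R]_n.+1) : Prop :=
  [/\ forall i, unit_root (al i),
      forall c : 'I_r -> R, \sum_i c i *: al i = 0 -> forall i, c i = 0
    & forall v, unit_root v -> exists2 c : 'I_r -> R, v = \sum_i c i *: al i &
        (forall i, 0 <= c i) \/ (forall i, c i <= 0)].

Definition mx_of_cols r (al : 'I_r -> 'cV[R]_n.+1) : 'M[R]_(n.+1, r) := \matrix_(k, i) al i k 0.

Lemma mx_of_colsE r (al : 'I_r -> 'cV[R]_n.+1) (c : 'cV[R]_r) :
  mx_of_cols al *m c = \sum_i c i 0 *: al i.
Proof.
apply/matrixP => k l; rewrite (ord1 l) mxE summxE; apply: eq_bigr => i _.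
by rewrite !mxE mulrC.
Qed.

Lemma col_mx_of_cols r (al : 'I_r -> 'cV[R]_n.+1) i : col i (mx_of_cols al) = al i.
Proof. by apply/matrixP => k l; rewrite !mxE (ord1 l). Qed.

Lemma rank_mx_of_cols r (al : 'I_r -> 'cV[R]_n.+1) :
  (forall c : 'I_r -> R, \sum_i c i *: al i = 0 -> forall i, c i = 0) <->
  \rank (mx_of_cols al) = r.
Proof.
rewrite -mxrank_tr; split=> [ind|rk c c0 i].
  apply/eqP; rewrite -/(row_free _) -kermx_eq0; apply/eqP/row_matrixP => k; rewrite row0.
  set u := row k _; have uA : u *m (mx_of_cols al)^T = 0 by apply/sub_kermxP; apply: row_sub.
  apply/matrixP => i j; rewrite (ord1 i) [RHS]mxE; apply: (ind (fun j => u 0 j)).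
  have := congr1 trmx uA; rewrite trmx_mul trmxK trmx0 mx_of_colsE => E.
  by rewrite -[RHS]E; apply: eq_bigr => l _; rewrite [u^T _ _]mxE.
have rf : row_free (mx_of_cols al)^T by rewrite /row_free rk.
pose u : 'rV[R]_r := \row_j c j.
have : u *m (mx_of_cols al)^T = 0 *m (mx_of_cols al)^T.
  rewrite mul0mx; apply: trmx_inj; rewrite trmx_mul trmxK trmx0 mx_of_colsE -[RHS]c0.
  by apply: eq_bigr => j _; rewrite !mxE.
by move/(row_free_inj rf)/matrixP/(_ 0 i); rewrite !mxE.
Qed.

Lemma sum_scale_inj r (al : 'I_r -> 'cV[R]_n.+1) (c d : 'I_r -> R) : simple_base al ->
  \sum_i c i *: al i = \sum_i d i *: al i -> c =1 d.
Proof.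
move=> [_ ind _] E i; apply/eqP; rewrite -subr_eq0; apply/eqP.
apply: (ind (fun i => c i - d i)); under eq_bigr => j _ do rewrite scalerBl.
by rewrite sumrB E subrr.
Qed.

Lemma simple_base_rank r (al : 'I_r -> 'cV[R]_n.+1) : simple_base al -> (r <= n.+1)%N.
Proof. by move=> [_ /rank_mx_of_cols + _] => <-; exact: rank_leq_row. Qed.

Lemma simple_base_dual r (al : 'I_r -> 'cV[R]_n.+1) (x : 'I_r -> R) : simple_base al ->
  exists u, forall i, dotv u (al i) = x i.
Proof.
move=> [_ /rank_mx_of_cols rk _].
have rf : row_full (mx_of_cols al) by rewrite /row_full rk.
exists ((\row_i x i) *m pinvmx (mx_of_cols al))^T => i.
rewrite /dotv trmxK -(col_mx_of_cols al i) colE mulmxA -(mulmxA (\row__ _)) mulVpmx // mulmx1.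
by rewrite -colE !mxE.
Qed.

Lemma simple_reflections_base S : simple_reflections H S ->
  exists r (al : 'I_r -> 'cV[R]_n.+1), simple_base al /\ S = range (fun i => refl (al i)).
Proof.
move=> [r [A [rk rA sA SE]]].
have A0 i : col i A <> 0 by have /root_vectorP[] := rA i.
pose al i := unitv (col i A); exists r, al.
have rU i : unit_root (al i) by have /root_vectorP[] := rA i.
have /choice[k kE] i : exists k, 0 < k /\ col i A = k *: al i.
  by have [k k0 E] := unitv_scale (A0 i); exists k.
have AE : A = mx_of_cols (fun i => col i A) by apply/matrixP => a b; rewrite !mxE.
have cE (c : 'cV_r) : A *m c = \sum_i (k i * c i 0) *: al i.
  rewrite {1}AE mx_of_colsE; apply: eq_bigr => i _.
  by have [_ {1}->] := kE i; rewrite scalerA mulrC.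
split; first split=> //.
- move=> c c0 i; have kc0 : 0 < k i by case: (kE i).
  have Aind := (rank_mx_of_cols (fun i => col i A)).2; rewrite -AE in Aind.
  have E : \sum_j (c j / k j) *: col j A = 0.
    rewrite -[RHS]c0; apply: eq_bigr => j _; have [kj {1}->] := kE j.
    by rewrite scalerA mulfVK // gt_eqF.
  by have /eqP := Aind rk _ E i; rewrite mulf_eq0 invr_eq0 (gt_eqF kc0) orbF => /eqP.
- move=> v rv; have [|c vE c0] := sA v.
    apply/root_vectorP; have v0 := unit_root_neq0 rv; split=> //.
    by have [vv _] := rv; rewrite /unitv vv sqrtr1 invr1 scale1r.
  exists (fun i => k i * c i 0); first by rewrite vE cE.
  by case: c0 => c0; [left|right] => i; have [/ltW ki _] := kE i;
    [rewrite mulr_ge0 | rewrite mulr_ge0_le0].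
rewrite SE; apply/seteqP; split=> [s [Hs rs [i si]]|_ [i _ <-]].
  by exists i => //; rewrite -(reflection_root Hs rs (A0 i) si).
have [uu Hu] := rU i; split=> //; first exact: refl_reflection.
by exists i; have [_ {1 2}->] := kE i; rewrite -scalemxAr refl_self // scalerN.
Qed.

Lemma simple_base_reflections r (al : 'I_r -> 'cV[R]_n.+1) : simple_base al ->
  simple_reflections H (range (fun i => refl (al i))).
Proof.
move=> [rU /rank_mx_of_cols rk sg]; exists r, (mx_of_cols al); split=> //.
- move=> i; rewrite col_mx_of_cols; have [uu Hu] := rU i.
  split; first exact: unit_root_neq0.
  by exists (refl (al i)); split; [|exact: refl_reflection|exact: refl_self].
- move=> v /root_vectorP[v0 rv]; have [c vE c0] := sg _ rv.
  have [k k0 vk] := unitv_scale v0; rewrite {1}vk.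
  exists (\col_i (k * c i)).
    by rewrite vE scaler_sumr mx_of_colsE; apply: eq_bigr => i _; rewrite scalerA mxE.
  by case: c0 => c0; [left|right] => i; rewrite mxE ?mulr_ge0 ?mulr_ge0_le0 // ltW.
apply/seteqP; split=> [_ [i _ <-]|s [Hs rs [i si]]].
  have [uu Hu] := rU i; split=> //; first exact: refl_reflection.
  by exists i; rewrite col_mx_of_cols refl_self.
rewrite col_mx_of_cols in si; have [uu Hu] := rU i; exists i => //.
have a0 : al i <> 0 by exact: unit_root_neq0.
by rewrite (reflection_root Hs rs a0 si) /unitv uu sqrtr1 invr1 scale1r.
Qed.

End SimpleBases.

(** * Angles between simple roots *)

Section Angles.
Variable R : realType.

Lemma sin_sign (x : R) : 0 < x < pi *+ 2 -> sin x = 0 -> x = pi.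
Proof.
move=> /andP[x0 x2] sx; apply/eqP/negPn/negP; rewrite neq_lt => /orP[xp|px].
  by have := @sin_gt0_pi R x; rewrite x0 xp sx ltxx => /(_ isT).
have := @sin_gt0_pi R (x - pi); rewrite subr_gt0 px ltrBlDr -mulr2n x2 => /(_ isT).
by have := sinDpi (x - pi); rewrite subrK sx => /esym/eqP; rewrite oppr_eq0 => /eqP ->;
  rewrite ltxx.
Qed.

(* At the first [k] with [pi <= k * t], the sign of [sin (k * t)] is wrong unless
   [k * t = pi]. *)
Lemma sin_no_change (t : R) : 0 < t < pi ->
  (forall k, 0 <= sin (k%:R * t) * sin (k.+1%:R * t)) ->
  exists2 q, (1 < q)%N & t = pi / q%:R.
Proof.
move=> /andP[t0 tp] S.
have ex : exists k, pi <= k%:R * t.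
  have [k kP] : exists k : nat, pi / t < k%:R.
    by exists (Num.truncn (pi / t)).+1; apply: truncnS_gt.
  by exists k; rewrite -ler_pdivrMr // ltW.
case: (ex_minnP ex) => -[|q] qP qmin.
  by move: qP; rewrite mul0r leNgt pi_gt0.
have q0 : (0 < q)%N.
  by rewrite lt0n; apply/eqP => q0; move: qP; rewrite q0 mul1r leNgt tp.
have qlt : q%:R * t < pi.
  by rewrite ltNge; apply/negP => /qmin; rewrite ltnn.
exists q.+1 => //; have q1 : (q.+1)%:R != 0 :> R by rewrite pnatr_eq0.
suff -> : pi = q.+1%:R * t by rewrite mulrAC mulfV ?mul1r.
have s0 : 0 < sin (q%:R * t) by apply: sin_gt0_pi; rewrite qlt mulr_gt0 // ltr0n.
apply/eqP; rewrite eq_le qP /= leNgt; apply/negP => lt.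
have := @sin_gt0_pi R (q.+1%:R * t - pi); rewrite subr_gt0 lt ltrBlDr /=.
have -> : q.+1%:R * t < pi + pi by rewrite -natr1 mulrDl mul1r ltrD.
move=> /(_ isT) s1; have := S q; rewrite leNgt => /negP; apply.
have := sinDpi (q.+1%:R * t - pi); rewrite subrK => ->.
by rewrite mulrN oppr_lt0 mulr_gt0.
Qed.

End Angles.

Section SimpleBases.
Variables (R : realType) (n : nat) (H : set 'M[R]_n.+1).
Hypotheses (lH : linear_group H) (fH : finite_set H).
Hypothesis oH : forall h, H h -> h^T * h = 1.
Implicit Types (u v w a b : 'cV[R]_n.+1) (h s : 'M[R]_n.+1).

Local Notation unit_root := (unit_root H).
Local Notation simple_base := (simple_base H).

Lemma refl_shift a b t x : dotv a a = 1 -> dotv a b = - cos t ->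
  refl a *m (sin (x + t) *: b + sin x *: a) = sin (x + t + t) *: a + sin (x + t) *: b.
Proof.
move=> aa ab; rewrite reflE dotvDr !dotvZr aa ab mulr1 -addrA -scalerBl addrC; congr (_ *: _ + _).
by have := sinB (x + t) t; rewrite addrK (sinD (x + t) t); lra.
Qed.

Lemma simple_base_angle r (al : 'I_r -> 'cV[R]_n.+1) i j : simple_base al -> i != j ->
  exists q, [/\ (1 < q)%N, dotv (al i) (al j) = - cos (pi / q%:R),
    (refl (al i) * refl (al j)) ^+ q = 1
    & forall k, (0 < k < q)%N -> (refl (al i) * refl (al j)) ^+ k <> 1].
Proof.
move=> sb ij; have [rU ind sg] := sb; set a := al i; set b := al j.
have [aa Ha] := rU i; have [bb Hb] := rU j; rewrite -/a -/b in aa Ha bb Hb.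
have sum2 (c d : R) : c *: a + d *: b = \sum_k ((c * (k == i)%:R) + d * (k == j)%:R) *: al k.
  under eq_bigr => k _ do rewrite scalerDl.
  rewrite big_split /=; congr (_ + _).
    rewrite (bigD1 i) //= eqxx mulr1 big1 ?addr0 // => k /negPf ->.
    by rewrite mulr0 scale0r.
  rewrite (bigD1 j) //= eqxx mulr1 big1 ?addr0 // => k /negPf ->.
  by rewrite mulr0 scale0r.
have ind2 (c d : R) : c *: a + d *: b = 0 -> c = 0 /\ d = 0.
  rewrite sum2 => /ind E; have := E i; have := E j.
  by rewrite !eqxx (negPf ij) eq_sym (negPf ij) !mulr0 !mulr1 addr0 add0r.
have sg2 (c d : R) : unit_root (c *: a + d *: b) -> 0 <= c * d.
  move=> /sg[e eE e0]; rewrite sum2 in eE; have E := sum_scale_inj sb eE.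
  have := E i; have := E j.
  rewrite !eqxx (negPf ij) eq_sym (negPf ij) !mulr0 !mulr1 addr0 add0r => -> ->.
  by case: e0 => e0; [apply: mulr_ge0 | apply: mulr_le0].
(* The vectors [a + b] and [a - b] are nonzero by linear independence, so their squared lengths are
   positive. *)
have dab : -1 < - dotv a b < 1.
  have P (e : R) : e * e = 1 -> 0 < 2 + 2 * e * dotv a b.
    move=> ee; have : a + e *: b != 0.
      by apply/eqP => E; have := ind2 1 e; rewrite scale1r => /(_ E)[/eqP]; rewrite oner_eq0.
    move/dotv_gt0; rewrite dotvDl !dotvDr !dotvZl !dotvZr aa bb (dotvC b a).
    suff -> : 1 + e * dotv a b + (e * dotv a b + e * (e * 1)) = 2 + 2 * e * dotv a b by [].
    by rewrite mulr1 ee; ring.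
  have P1 := P 1 (mulr1 1); have P2 := P (-1); rewrite mulrNN mulr1 in P2.
  by have := P2 erefl; lra.
set t := acos (- dotv a b); have ct : cos t = - dotv a b.
  by rewrite acosK // in_itv /=; move: dab => /andP[/ltW -> /ltW ->].
have abE : dotv a b = - cos t by rewrite ct opprK.
have baE : dotv b a = - cos t by rewrite dotvC.
have t0p : 0 < t < pi.
  by move: dab => /andP[d1 d2]; rewrite acos_gt0 ?acos_ltpi ?d1 ?d2 ?ltW.
have st0 : 0 < sin t by apply: sin_gt0_pi.
(* These are the rotating vectors [dvec], scaled so that [r1 0 = a] and [r2 0 = b]; at the multiples
   of [t] they are roots. *)
pose r1 x := (sin t)^-1 *: (sin (x + t) *: a + sin x *: b).
pose r2 x := (sin t)^-1 *: (sin (x + t) *: b + sin x *: a).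
have r12 x : refl a *m r2 x = r1 (x + t) by rewrite /r1 /r2 -scalemxAr refl_shift.
have r21 x : refl b *m r1 x = r2 (x + t) by rewrite /r1 /r2 -scalemxAr refl_shift.
have r10 : r1 0 = a by rewrite /r1 add0r sin0 scale0r addr0 scalerA mulVf ?scale1r ?gt_eqF.
have r20 : r2 0 = b by rewrite /r2 add0r sin0 scale0r addr0 scalerA mulVf ?scale1r ?gt_eqF.
have roots k : unit_root (r1 (k%:R * t)) /\ unit_root (r2 (k%:R * t)).
  elim: k => [|k [IH1 IH2]]; first by rewrite mul0r r10 r20.
  by rewrite -natr1 mulrDl mul1r -r12 -r21; split; apply: unit_root_act.
have [|q q1 tq] := @sin_no_change R t t0p.
  move=> k; have [+ _] := roots k; rewrite /r1 scalerDr !scalerA => /sg2.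
  rewrite -natr1 mulrDl mul1r mulrACA pmulr_rge0 ?mulr_gt0 ?invr_gt0 //.
  by rewrite mulrC.
have q0 : q%:R != 0 :> R by rewrite pnatr_eq0 -lt0n ltnW.
have qt : q%:R * t = pi by rewrite tq mulrC mulfVK.
have rot k : (refl a * refl b) ^+ k *m r1 0 = r1 (k%:R * (t *+ 2)).
  elim: k => [|k IH]; first by rewrite expr0 mul1mx mul0r.
  rewrite exprS -mulmxE -mulmxA IH -mulmxA r21 r12; congr r1.
  by rewrite -natr1 mulrDl mul1r mulr2n addrA.
exists q; split=> //; first by rewrite abE tq.
(* The relation is [wmx_braid] for the two-letter alphabet [bool]. *)
- pose m (x y : bool) := if x == y then 1%N else q.
  pose al2 (x : bool) := if x then a else b.
  have form2 x y : (((al2 x)^T : 'rV_n.+1) *m al2 y) 0 0 = - cos (pi / (m x y)%:R).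
    rewrite -/(dotv _ _); case: x y => -[] /=; rewrite /m /= ?divr1 ?cospi ?opprK -?tq //.
  have := wmx_braid (I := bool) (m := m) (al := al2) (b := fun x =>
    (al2 x)^T) _ _ _ form2 true false.
  have -> : m true false = q by [].
  move=> <- //.
  + elim: (q) => [|k IH]; first by rewrite /= wmx_nil expr0.
    rewrite exprS IH -[flatten (nseq k.+1 _)]/([:: true; false] ++ flatten (nseq k [:: true;
      false])) wmx_cat.
    by congr (_ *m _); rewrite /wmx big_cons big_seq1.
  + by move=> x; rewrite /m eqxx.
  + by move=> x y; rewrite /m eq_sym.
  + by move=> x y; rewrite /m => /negPf ->.
- move=> k /andP[k0 kq] E; have := rot k; rewrite E mul1mx => E1.
  have {E1} : (sin (k%:R * (t *+ 2) + t) - sin t) *: a + sin (k%:R * (t *+ 2)) *: b = 0.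
    move: E1; rewrite /r1 add0r sin0 => /(scalerI _) E1.
    rewrite scalerBl addrAC -E1; last by rewrite invr_eq0 gt_eqF.
    by rewrite scale0r addr0 subrr.
  move=> /ind2[s1 s2].
  have t0 : 0 < t by case/andP: t0p.
  (* The rotation angle [2 k t] lies strictly between 0 and [2 pi], so a vanishing sine leaves only
     [pi]; then the coefficient of [a] would be [- 2 sin t], which is nonzero. *)
  have ktp : k%:R * (t *+ 2) = pi.
    apply: sin_sign s2; rewrite mulr_gt0 ?pmulrn_rgt0 ?ltr0n //=.
    by rewrite mulrnAr ltrMn2r /= -qt ltr_pM2r // ltr_nat.
  move: s1; rewrite ktp (addrC pi) sinDpi -opprD => /eqP; rewrite oppr_eq0 -mulr2n mulrn_eq0 /=.
  by rewrite gt_eqF.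
Qed.

End SimpleBases.

(** * Generation by simple reflections and conjugacy of simple bases *)

Section SimpleBases.
Variables (R : realType) (n : nat) (H : set 'M[R]_n.+1).
Hypotheses (lH : linear_group H) (fH : finite_set H).
Hypothesis oH : forall h, H h -> h^T * h = 1.
Implicit Types (u v w a b : 'cV[R]_n.+1) (h s : 'M[R]_n.+1).

Local Notation unit_root := (unit_root H).
Local Notation simple_base := (simple_base H).

(* A positive root [v] that is not simple satisfies [0 < (v, al i)] for some [i],
   and then [refl (al i) *m v] is a positive root of smaller height [dotv u _]. *)
Lemma simple_base_refl r (al : 'I_r -> 'cV[R]_n.+1) (L : set 'M[R]_n.+1) v :
  simple_base al -> linear_group L -> (forall i, L (refl (al i))) ->
  unit_root v -> L (refl v).
Proof.
move=> sb [_ _ LM LV] La; have [rU ind sg] := sb.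
have [u uE] := simple_base_dual (fun=> 1) sb.
have [rs rsE] := unit_roots_enum lH fH oH.
suff pos w (c : 'I_r -> R) : unit_root w -> w = \sum_i c i *: al i -> (forall i,
  0 <= c i) -> L (refl w).
  move=> rv; have [c vE [c0|c0]] := sg v rv; first exact: pos vE c0.
  rewrite -reflN; apply: (pos _ (fun i => - c i)) => [||i]; last by rewrite oppr_ge0.
    exact: unit_rootN.
  by rewrite vE -sumrN; apply: eq_bigr => i _; rewrite scaleNr.
(* Heights are real numbers, so the induction is on the number of roots lower than [w]. *)
have [k] := ubnP (count (fun x => dotv u x < dotv u w) rs).
elim: k w c => // k IH w c; rewrite ltnS => cw rw wE c0.
have [[i wi]|nsimple] := pselect (exists i, w = al i); first by rewrite wi.
have [i ci] : exists i, 0 < dotv w (al i).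
  apply: contrapT => /forallNP np; have [ww _] := rw.
  have : dotv w w <= 0.
    rewrite {2}wE dotv_sumr sumr_le0 // => i _; rewrite dotvZr mulr_ge0_le0 //.
    by rewrite leNgt; apply/negP; apply: np.
  by rewrite ww ler10.
have [aa Ha] := rU i; set a := al i in ci aa Ha.
have [j [ji cj]] : exists j, j != i /\ 0 < c j.
  apply: contrapT => np; apply: nsimple; exists i.
  have wi : w = c i *: al i.
    rewrite {1}wE (bigD1 i) //= big1 ?addr0 // => j ji.
    suff -> : c j = 0 by rewrite scale0r.
    apply/eqP; rewrite eq_le c0 andbT leNgt; apply/negP => cj.
    by apply: np; exists j.
  have [ww _] := rw; move: ww; rewrite wi => /(unit_scalar aa)[] E.
    by rewrite E scale1r.
  by have := c0 i; rewrite E oppr_ge0 ler10.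
pose w' := refl a *m w.
have w'E : w' = w - (2 * dotv w a) *: a by rewrite /w' reflE (dotvC a).
have rw' : unit_root w' by apply: unit_root_act.
have w'S : w' = \sum_l (c l - 2 * dotv w a * (l == i)%:R) *: al l.
  rewrite w'E wE; under [RHS]eq_bigr => l _ do rewrite scalerBl.
  rewrite sumrB -wE; congr (_ - _); rewrite (bigD1 i) //= eqxx mulr1 big1 ?addr0 //.
  by move=> l /negPf ->; rewrite mulr0 scale0r.
(* The reflection changes only the coordinate at [i]; the positive coordinate at [j] survives and
   excludes a negative root. *)
have c0' l : 0 <= c l - 2 * dotv w a * (l == i)%:R.
  have [d w'd [d0|d0]] := sg w' rw'; rewrite w'S in w'd; have E := sum_scale_inj sb w'd.
    by rewrite E.
  by have := d0 j; rewrite -E (negPf ji) mulr0 subr0 leNgt cj.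
have -> : refl w = refl a * refl w' * (refl a)^-1.
  have aa' := refl_orthogonal aa.
  by rewrite refl_conj // /w' mulmxA [refl a *m refl a]refl_sqr // mul1mx.
apply: (LM _ _ _ (LV _ (La i))); apply: (LM _ _ (La i)).
apply: (IH w' _ _ rw' w'S c0').
have lt : dotv u w' < dotv u w.
  by rewrite w'E dotvBr dotvZr uE mulr1 ltrBlDr ltrDl mulr_gt0.
apply: leq_trans cw; have : w' \in rs by apply/rsE.
elim: (rs) => //= x rs' IHx; rewrite in_cons => /orP[/eqP <-|/IHx ltc].
  rewrite ltxx lt add0n add1n ltnS; apply: sub_count => y /= yw'; exact: lt_trans lt.
have := ltc; case: (ltP (dotv u x) (dotv u w')) => [xw'|_].
  by rewrite (lt_trans xw' lt) ltn_add2l.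
by move=> _; rewrite add0n; apply: leq_trans ltc _; apply: leq_addl.
Qed.

Lemma simple_base_words r (al : 'I_r -> 'cV[R]_n.+1) : simple_base al ->
  generated_by (@reflection _ _) H ->
  forall h, H h -> exists w : seq 'I_r, h = \prod_(i <- w) refl (al i).
Proof.
move=> sb gH; have [rU _ _] := sb.
have wH (w : seq 'I_r) : H (\prod_(i <- w) refl (al i)).
  have [_ H1 HM _] := lH; elim: w => [|i w IH]; rewrite ?big_nil ?big_cons //.
  by apply: HM => //; have [_] := rU i.
have winv (w : seq 'I_r) : \prod_(i <- rev w) refl (al i) = (\prod_(i <- w) refl (al i))^T.
  elim: w => [|i w IH]; first by rewrite !big_nil trmx1.
  rewrite rev_cons -cats1 big_cat big_seq1 big_cons /= IH -!mulmxE trmx_mul.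
  by rewrite refl_sym.
pose L : set 'M[R]_n.+1 := [set h | exists w : seq 'I_r, h = \prod_(i <- w) refl (al i)].
have lL : linear_group L.
  split.
  - by move=> _ [w ->] /=; apply: orthogonal_unit; apply: oH.
  - by exists [::]; rewrite big_nil.
  - by move=> _ _ [w ->] [w' ->]; exists (w ++ w'); rewrite big_cat.
  - by move=> _ [w ->]; exists (rev w); rewrite winv orthogonal_inv ?oH.
apply: (generated_by_sub gH lL) => s [Hs rs].
have [v vv sE] := orthogonal_reflection (oH Hs) rs.
rewrite sE; apply: (simple_base_refl sb lL).
  by move=> i; exists [:: i]; rewrite big_seq1.
by split=> //; rewrite -sE.
Qed.

(* Maximising [dotv (w *m p) rho] over the group moves [p] into the chamber. *)
Lemma chamber_move r (al : 'I_r -> 'cV[R]_n.+1) p : simple_base al ->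
  exists2 w, H w & forall i, 0 <= dotv (w *m p) (al i).
Proof.
move=> sb; have [rho rhoE] := simple_base_dual (fun=> 1) sb.
have [s [_ sH _]] := finite_group_enum lH fH; have [_ H1 HM _] := lH.
have [w Hw wmax] : exists2 w, H w & forall x, H x -> dotv (x *m p) rho <= dotv (w *m p) rho.
  have : 1 \in s by apply/sH.
  have sub x : x \in s -> H x by move=> /sH.
  have sup x : H x -> x \in s by move=> /sH.
  suff M (t : seq 'M[R]_n.+1) : t != [::] -> exists2 w, w \in t &
      forall x, x \in t -> dotv (x *m p) rho <= dotv (w *m p) rho.
    case: (s) sub sup M => // y t sub sup M _.
    have [//|w ws wm] := M (y :: t).
    by exists w; [exact: sub | move=> x /sup; exact: wm].
  elim: t => // y t IH _; have [->|/IH[w wt wm]] := eqVneq t [::].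
    by exists y => [|x]; rewrite inE // => /eqP ->.
  have [le|lt] := leP (dotv (y *m p) rho) (dotv (w *m p) rho).
    exists w => [|x]; first by rewrite inE wt orbT.
    by rewrite inE => /orP[/eqP ->|/wm].
  exists y => [|x]; first by rewrite inE eqxx.
  by rewrite inE => /orP[/eqP ->//|/wm /le_trans]; apply; exact: ltW.
exists w => // i; have [rU _ _] := sb; have [aa Ha] := rU i.
have := wmax _ (HM _ _ Ha Hw); rewrite -mulmxE -mulmxA reflE dotvBl dotvZl (dotvC (al i)).
rewrite (dotvC (al i) rho) rhoE mulr1 gerBl.
by rewrite pmulr_rge0.
Qed.

Lemma simple_base_act r (al : 'I_r -> 'cV[R]_n.+1) h : H h -> simple_base al ->
  simple_base (fun i => h *m al i).
Proof.
move=> Hh [rU ind sg]; have [_ _ _ HV] := lH; have hh := oH Hh; have hV := orthogonal_inv hh.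
have sumE (c : 'I_r -> R) : \sum_i c i *: (h *m al i) = h *m \sum_i c i *: al i.
  by rewrite mulmx_sumr; apply: eq_bigr => i _; rewrite -scalemxAr.
split.
- by move=> i; apply: unit_root_act.
- move=> c; rewrite sumE => /(congr1 (mulmx h^T)); rewrite mulmxA [h^T *m h]hh mul1mx mulmx0.
  exact: ind.
- move=> v rv; have [|c E c0] := sg (h^T *m v).
    by rewrite -hV; apply: unit_root_act => //; apply: HV.
  exists c => //; rewrite sumE -E mulmxA [h *m h^T](mulmx1C hh) mul1mx //.
Qed.

Lemma simple_base_pos r (al : 'I_r -> 'cV[R]_n.+1) y v : simple_base al ->
  (forall i, 0 < dotv y (al i)) -> unit_root v -> 0 < dotv y v ->
  exists2 c : 'I_r -> R, v = \sum_i c i *: al i & forall i, 0 <= c i.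
Proof.
move=> [_ _ sg] y0 rv yv; have [c vE [c0|c0]] := sg v rv; first by exists c.
move: yv; rewrite vE dotv_sumr ltNge sumr_le0 // => i _.
by rewrite dotvZr mulr_le0_ge0 // ltW.
Qed.

(* Two bases of the same positive cone differ by a monomial matrix. *)
Lemma simple_base_sub r r' (al : 'I_r -> 'cV[R]_n.+1) (be : 'I_r' -> 'cV[R]_n.+1) y :
  simple_base al -> simple_base be ->
  (forall i, 0 < dotv y (al i)) -> (forall i, 0 < dotv y (be i)) ->
  forall j, exists i, be j = al i.
Proof.
move=> sa sb ya yb j; have [rA indA _] := sa; have [rB indB _] := sb.
have [c bE c0] := simple_base_pos sa ya (rB j) (yb j).
have /choice[d dE] i : exists d : 'I_r' -> R, al i = \sum_k d k *: be k /\ forall k, 0 <= d k.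
  by have [d E d0] := simple_base_pos sb yb (rA i) (ya i); exists d.
have bE2 : be j = \sum_k (\sum_i c i * d i k) *: be k.
  rewrite {1}bE; under eq_bigr => i _ do rewrite {1}(dE i).1 scaler_sumr.
  rewrite exchange_big; apply: eq_bigr => k _ /=; rewrite scaler_suml.
  by apply: eq_bigr => i _; rewrite scalerA.
have delta k : \sum_i c i * d i k = (k == j)%:R.
  suff : (fun k => \sum_i c i * d i k) =1 (fun k => (k == j)%:R) by apply.
  apply: (sum_scale_inj sb); rewrite -bE2 (bigD1 j) //=.
  by rewrite eqxx scale1r big1 ?addr0 // => l /negPf ->; rewrite scale0r.
have [i ci] : exists i, 0 < c i.
  apply: contrapT => np; have [bb _] := rB j.
  have c00 i : c i = 0.
    by apply/eqP; rewrite eq_le c0 andbT leNgt; apply/negP => ci; apply: np; exists i.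
  move: (delta j); rewrite eqxx big1 => [/eqP|l _]; last by rewrite c00 mul0r.
  by rewrite eq_sym oner_eq0.
have dk k : k != j -> d i k = 0.
  move=> kj; have := delta k; rewrite (negPf kj) => /eqP; rewrite psumr_eq0.
    move=> /allP/(_ i (mem_index_enum _)); rewrite mulf_eq0 (gt_eqF ci) /=.
    by move/eqP.
  by move=> l _; rewrite mulr_ge0 //; exact: (dE l).2.
have aiE : al i = d i j *: be j.
  by rewrite {1}(dE i).1 (bigD1 j) //= big1 ?addr0 // => k /dk ->; rewrite scale0r.
exists i; have [bb _] := rB j; have [aa _] := rA i; move: aa; rewrite aiE => /(unit_scalar bb)[] E.
  by rewrite E scale1r.
by have := (dE i).2 j; rewrite E oppr_ge0 ler10.
Qed.

(** A point [p] inside the chamber of [be] is moved by [w] into the closed chamber of [al]. It is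
    inside that one too: the coordinates of [al i] in the base [w be] have one sign, so [al i]
    orthogonal to [w p] would be zero. Thus [al] and [w be] are positive on the same point and have
    the same elements. *)
Lemma simple_base_uniq r r' (al : 'I_r -> 'cV[R]_n.+1) (be : 'I_r' -> 'cV[R]_n.+1) :
  simple_base al -> simple_base be ->
  exists2 w, H w & range (fun i => refl (al i)) =
                   (fun s => w * s * w^-1) @` range (fun j => refl (be j)).
Proof.
move=> sa sb; have [p pE] := simple_base_dual (fun=> 1) sb.
have [w Hw wpos] := chamber_move p sa; have ww := oH Hw.
have sb' := simple_base_act Hw sb; set be' := (fun j => w *m be j) in sb'.
have yb j : 0 < dotv (w *m p) (be' j) by rewrite /be' orthogonal_dotv // pE.
have ya i : 0 < dotv (w *m p) (al i).
  rewrite lt_def wpos andbT; have [rA _ _] := sa; have [rB _ sgB] := sb'.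
  have [c aE c0] := sgB _ (rA i); apply/eqP => E.
  have cz k : c k = 0.
    move: E; rewrite aE dotv_sumr; under eq_bigr => l _ do rewrite dotvZr.
    case: c0 => c0 /eqP.
      rewrite psumr_eq0 => [/allP/(_ k (mem_index_enum _))|l _]; last by rewrite mulr_ge0 // ltW.
      by rewrite mulf_eq0 (gt_eqF (yb k)) orbF => /eqP.
    rewrite -oppr_eq0 -sumrN psumr_eq0 => [/allP/(_ k (mem_index_enum _))|l _]; last first.
      by rewrite oppr_ge0 mulr_le0_ge0 // ltW.
    by rewrite oppr_eq0 mulf_eq0 (gt_eqF (yb k)) orbF => /eqP.
  apply: (unit_root_neq0 (rA i)); rewrite aE big1 // => k _; by rewrite cz scale0r.
have s1 := simple_base_sub sa sb' ya yb; have s2 := simple_base_sub sb' sa yb ya.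
exists w => //; rewrite image_comp; apply/seteqP; split=> [_ [i _ <-]|_ [j _ <-]] /=.
  by have [j ->] := s2 i; exists j => //=; rewrite refl_conj.
by have [i E] := s1 j; exists i => //; rewrite -E refl_conj.
Qed.

End SimpleBases.

(** * Existence of simple bases *)

Section Existence.
Variables (R : realType) (n : nat) (H : set 'M[R]_n.+1).
Hypotheses (lH : linear_group H) (fH : finite_set H).
Hypothesis oH : forall h, H h -> h^T * h = 1.
Implicit Types (u v w a b : 'cV[R]_n.+1) (h s : 'M[R]_n.+1).

Local Notation unit_root := (unit_root H).
Local Notation simple_base := (simple_base H).

(* [lam] is taken on the moment curve [t |-> (1, t, t^2, ...)]. *)
Lemma generic_form (rs : seq 'cV[R]_n.+1) : (forall v, v \in rs -> v <> 0) ->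
  exists lam, forall v, v \in rs -> dotv lam v <> 0.
Proof.
move=> rs0; pose p v : {poly R} := \sum_(i < n.+1) (v i 0) *: 'X^i.
have pc v (i : 'I_n.+1) : (p v)`_i = v i 0.
  rewrite coef_sum (bigD1 i) //= coefZ coefXn eqxx mulr1 big1 ?addr0 // => j ji.
  by rewrite coefZ coefXn eq_sym (inj_eq val_inj) (negPf ji) mulr0.
have [|t tP] := @poly_nonroot R (\prod_(v <- rs) p v).
  rewrite prodf_seq_neq0; apply/allP => v /rs0 v0; apply/implyP => _.
  apply/eqP => pv; apply: v0; apply/matrixP => i j; rewrite (ord1 j) -pc pv coef0 mxE.
  by [].
exists (\col_i t ^+ i) => v vrs; move: tP; rewrite horner_prod prodf_seq_neq0.
move=> /allP/(_ v vrs) /= /eqP; rewrite horner_sum dotvE => E E0; apply: E.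
by rewrite -[RHS]E0; apply: eq_bigr => i _; rewrite hornerZ hornerXn !mxE mulrC.
Qed.

Definition seq_cone (D : seq 'cV[R]_n.+1) v :=
  exists2 c : 'cV[R]_n.+1 -> R, (forall d, 0 <= c d) & v = \sum_(d <- D) c d *: d.

Lemma seq_cone_sum (D D' : seq 'cV[R]_n.+1) (c : 'cV[R]_n.+1 -> R) :
  (forall d, d \in D -> seq_cone D' d) -> (forall d, 0 <= c d) ->
  seq_cone D' (\sum_(d <- D) c d *: d).
Proof.
move=> DD' c0; elim: D DD' => [|d D IH] DD'.
  by rewrite big_nil; exists (fun=> 0) => //; rewrite big1 // => i _; exact: scale0r.
rewrite big_cons; have [|e e0 ->] := IH; first by move=> x xD; apply: DD'; rewrite inE xD orbT.
have [f f0 {2}->] := DD' d (mem_head _ _).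
exists (fun x => c d * f x + e x) => [x|]; first by rewrite addr_ge0 // mulr_ge0.
by rewrite scaler_sumr -big_split; apply: eq_bigr => x _; rewrite scalerDl scalerA.
Qed.

(** A generic form [lam] splits the roots into positive and negative ones. A smallest set [D] of
    positive roots whose cone contains all of them is the base: distinct elements of [D] have
    nonpositive products, and such vectors in an open half-space are linearly independent. *)
Lemma simple_base_ex : exists r (al : 'I_r -> 'cV[R]_n.+1), simple_base al.
Proof.
have [rs rsE] := unit_roots_enum lH fH oH.
have [|lam lamE] := @generic_form rs.
  by move=> v /rsE; exact: unit_root_neq0.
pose pr v := unit_root v /\ 0 < dotv lam v.
pose gen D := [/\ uniq D, forall d, d \in D -> pr d & forall v, pr v -> seq_cone D v].
have posneg v : unit_root v -> pr v \/ pr (- v).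
  move=> rv; have := lamE v; rewrite -rsE => /(_ rv)/eqP; rewrite neq_lt => /orP[lt|lt].
    by right; split; [exact: unit_rootN | rewrite dotvNr oppr_gt0].
  by left.
have [D0 gD0] : exists D, gen D.
  exists (undup [seq v <- rs | 0 < dotv lam v]); split; first exact: undup_uniq.
    by move=> d; rewrite mem_undup mem_filter => /andP[l /rsE].
  move=> v [rv lv]; exists (fun d => (d == v)%:R) => [d|]; first by rewrite ler0n.
  rewrite (bigD1_seq v) ?undup_uniq //=; last by rewrite mem_undup mem_filter lv; apply/rsE.
  by rewrite eqxx scale1r big1 ?addr0 // => d /negPf ->; rewrite scale0r.
have [D [[uD prD coneD] minD]] : exists D, gen D /\ forall D', gen D' -> (size D <= size D')%N.
  have [k] := ubnP (size D0); elim: k D0 gD0 => // k IH D gD; rewrite ltnS => sD.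
  have [mD|] := pselect (forall D', gen D' -> (size D <= size D')%N); first by exists D.
  move=> /existsNP[D' /not_implyP[gD' /negP]]; rewrite -ltnNge => lt.
  by apply: (IH D') => //; apply: leq_trans sD.
(* Collecting the terms in [be] and applying [lam] gives [x - c be] positive, so [be] lies in the
   cone of the other elements and could be removed from [D]. *)
have key (be de : 'cV[R]_n.+1) (x : R) (c : 'cV[R]_n.+1 -> R) : be \in D -> de \in D -> de != be ->
    (forall d, 0 <= c d) -> 0 < c de -> x *: be = \sum_(d <- D) c d *: d -> False.
  move=> beD deD db c0 cd; rewrite (bigD1_seq be) //= => E.
  have [_ lbe] := prD be beD.
  have {}E : (x - c be) *: be = \sum_(d <- D | d != be) c d *: d.
    by rewrite scalerBl E addrAC subrr add0r.
  have lE : (x - c be) * dotv lam be = \sum_(d <- D | d != be) c d * dotv lam d.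
    by rewrite -dotvZr E dotv_sumr; apply: eq_bigr => d _; rewrite dotvZr.
  have s0 : 0 < \sum_(d <- D | d != be) c d * dotv lam d.
    rewrite (big_rem de) //= db ltr_wpDr ?mulr_gt0 //; last by case: (prD de deD).
    rewrite big_seq_cond sumr_ge0 // => d /andP[dD _].
    by have [_ ld] := prD d (mem_rem dD); rewrite mulr_ge0 // ltW.
  have xc : 0 < x - c be by rewrite -(pmulr_lgt0 _ lbe) lE.
  have cbe : seq_cone (rem be D) be.
    exists (fun d => (x - c be)^-1 * c d) => [d|]; first by rewrite mulr_ge0 // invr_ge0 ltW.
    under eq_bigr => d _ do rewrite -scalerA.
    rewrite -scaler_sumr rem_filter // big_filter -E scalerA mulVf ?scale1r //.
    by rewrite gt_eqF.
  suff /minD : gen (rem be D).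
    by rewrite size_rem // leqNgt; case: (D) beD => //= ? ? _; rewrite ltnSn.
  split; first exact: rem_uniq.
    by move=> d /mem_rem; exact: prD.
  move=> v /coneD[e e0 ->]; apply: seq_cone_sum => // d dD.
  have [->//|dbe] := eqVneq d be.
  exists (fun y => (y == d)%:R) => [y|]; first by rewrite ler0n.
  rewrite (bigD1_seq d) ?rem_uniq //=; last by rewrite mem_rem_uniq // inE dbe.
  by rewrite eqxx scale1r big1 ?addr0 // => y /negPf ->; rewrite scale0r.
(* If the product were positive, the root [b - 2 (a, b) a] or its opposite would lie in the cone of
   [D]. This writes [b], respectively a multiple of [a], as a combination that [key] forbids. *)
have obtuse a b : a \in D -> b \in D -> a != b -> dotv a b <= 0.
  move=> aD bD ab; rewrite leNgt; apply/negP => dab.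
  have [[aa Ha] la] := prD a aD; have [rb lb] := prD b bD.
  have rg : unit_root (refl a *m b) by apply: unit_root_act.
  have gE : refl a *m b = b - (2 * dotv a b) *: a by rewrite reflE.
  have k0 : 0 < 2 * dotv a b by rewrite mulr_gt0.
  have one (d : 'cV[R]_n.+1) (k : R) : d \in D -> k *: d = \sum_(y <- D) (k * (y == d)%:R) *: y.
    move=> dD; rewrite (bigD1_seq d) //= eqxx mulr1 big1 ?addr0 // => y /negPf ->.
    by rewrite mulr0 scale0r.
  have [pg|pg] := posneg _ rg; have [c c0 E] := coneD _ pg.
    apply: (key b a 1 (fun y => c y + 2 * dotv a b * (y == a)%:R)) => //.
    - by move=> d; apply: addr_ge0 => //; apply: mulr_ge0; [exact: ltW | exact: ler0n].
    - by rewrite eqxx mulr1 ltr_wpDl.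
    under eq_bigr => d _ do rewrite scalerDl.
    by rewrite big_split /= -E -one // gE subrK scale1r.
  apply: (key a b (2 * dotv a b) (fun y => c y + 1 * (y == b)%:R)) => //.
  - by rewrite eq_sym.
  - by move=> d; rewrite addr_ge0 // mul1r ler0n.
  - by rewrite eqxx mulr1 ltr_wpDl.
  under eq_bigr => d _ do rewrite scalerDl.
  by rewrite big_split /= -E -one // gE opprB scale1r subrK.
pose al (i : 'I_(size D)) := nth 0 D i.
have alD i : al i \in D by apply: mem_nth.
exists (size D), al; split.
- by move=> i; have [] := prD _ (alD i).
- move=> c c0.
  have al_inj i j : (al i == al j) = (i == j).
    by rewrite /al nth_uniq.
  (* The terms of positive coefficient and the opposites of the others have the same sum [u]; its
     square is nonpositive by [obtuse], and [lam] then kills the coefficients on both sides. *)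
  pose u := \sum_(i | 0 < c i) c i *: al i.
  have uE : u = \sum_(i | ~~ (0 < c i)) (- c i) *: al i.
    apply/eqP; rewrite -subr_eq0 -sumrN; apply/eqP;
      rewrite -[RHS]c0 [RHS](bigID (fun i => 0 < c i)) /=.
    by congr (_ + _); apply: eq_bigr => i _; rewrite scaleNr opprK.
  have u0 : u = 0.
    apply: dotv_eq0; apply/eqP; rewrite eq_le dotv_ge0 andbT {2}uE dotv_sumr.
    apply: sumr_le0 => i ci; rewrite dotvZr dotvC dotv_sumr.
    apply: mulr_ge0_le0; first by rewrite oppr_ge0 leNgt.
    apply: sumr_le0 => j cj; rewrite dotvZr; apply: mulr_ge0_le0; first exact: ltW.
    apply: obtuse => //; rewrite al_inj; apply: contraNneq ci => ->; exact: cj.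
  have lal i : 0 < dotv lam (al i) by have [] := prD _ (alD i).
  have np i : ~~ (0 < c i).
    apply/negP => ci; have : 0 < dotv lam u.
      rewrite dotv_sumr (bigD1 i) //= ltr_wpDr ?dotvZr ?mulr_gt0 // sumr_ge0 // => j /andP[cj _].
      by rewrite dotvZr mulr_ge0 // ltW.
    by rewrite u0 dotv0r ltxx.
  have := u0; rewrite uE => /(congr1 (dotv lam)); rewrite dotv0r dotv_sumr => /eqP.
  under eq_bigr => i _ do rewrite dotvZr.
  rewrite psumr_eq0 => [/allP E i|i ci]; last by apply: mulr_ge0;
    [rewrite oppr_ge0 leNgt | exact: ltW].
  have := E i (mem_index_enum _); rewrite np /= mulf_eq0 (gt_eqF (lal i)) orbF oppr_eq0.
  by move/eqP.
- move=> v rv; have sumD (c : 'cV[R]_n.+1 -> R) : \sum_(d <- D) c d *: d = \sum_i c (al i) *: al i.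
    by rewrite (big_nth 0) big_mkord.
  have [/coneD[c c0 vE]|/coneD[c c0 vE]] := posneg v rv.
    by exists (fun i => c (al i)); [rewrite vE sumD | left].
  exists (fun i => - c (al i)); last by right => i; rewrite oppr_le0.
  rewrite -[v]opprK vE sumD -sumrN; apply: eq_bigr => i _; by rewrite scaleNr.
Qed.

End Existence.

(** * Coxeter models *)

Section RepFacts.
Variables (F : fieldType) (n : nat) (gT : finGroupType) (rho : gT -> 'M[F]_n.+1).
Hypothesis rhoM : forall x y, rho (x * y)%g = rho x * rho y.
Hypothesis rho_inj : injective rho.
Hypothesis rhoU : forall x, rho x \is a GRing.unit.

Lemma rep1 : rho 1%g = 1.
Proof. by apply: (mulrI (rhoU 1%g)); rewrite -rhoM mulg1 mulr1. Qed.

Lemma repX x k : rho (x ^+ k)%g = rho x ^+ k.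
Proof. by elim: k => [|k IH]; rewrite ?expg0 ?rep1 // expgS rhoM IH exprS. Qed.

Lemma rep_order x q : (0 < q)%N -> rho x ^+ q = 1 ->
  (forall k, (0 < k < q)%N -> rho x ^+ k <> 1) -> #[x]%g = q.
Proof.
move=> q0 xq nk; have : (#[x]%g %| q)%N.
  by rewrite order_dvdn; apply/eqP/rho_inj; rewrite repX xq rep1.
move=> /dvdn_leq -/(_ q0); rewrite leq_eqVlt => /orP[/eqP //|lt].
by case: (nk #[x]%g); rewrite ?order_gt0 // -repX expg_order rep1.
Qed.

Lemma rep_prod (I : Type) (w : seq I) (s : I -> gT) :
  rho (\prod_(i <- w) s i)%g = \prod_(i <- w) rho (s i).
Proof. by elim: w => [|i w IH]; rewrite ?big_nil ?rep1 // !big_cons rhoM IH. Qed.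

End RepFacts.

(** * Finite matrix groups as abstract finite groups *)

Section Cayley.
Variables (F : fieldType) (n : nat) (s : seq 'M[F]_n.+1).
Hypothesis s1 : 1 \in s.
Local Notation T := (seq_sub s).

Let one : T := SeqSub s1.

(* Right translations by elements of [s], recognised by their value at 1. *)
Definition translations : {set {perm T}} :=
  [set p : {perm T} | [forall t, val (p t) == val t * val (p one)]]%SET.

Lemma translations_group_set : group_set translations.
Proof.
apply/group_setP; split=> [|p q].
  by rewrite inE; apply/forallP => t; rewrite !perm1 /= mulr1.
rewrite !inE => /forallP pP /forallP qP; apply/forallP => t.
rewrite !permM (eqP (qP (p t))) (eqP (pP t)) (eqP (qP (p one))).
by rewrite mulrA.
Qed.

Canonical translations_group := Group translations_group_set.

Definition translation_value (p : subg_of translations_group) : 'M[F]_n.+1 :=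
  val (sgval p one).

Lemma translation_valueM p q :
  translation_value (p * q)%g = translation_value p * translation_value q.
Proof.
rewrite /translation_value /= permM.
by have := valP q; rewrite inE => /forallP/(_ (sgval p one))/eqP.
Qed.

Lemma translation_value_inj : injective translation_value.
Proof.
move=> p q pq; apply/val_inj/permP => t; apply/val_inj.
have := valP p; rewrite inE => /forallP/(_ t)/eqP ->.
have := valP q; rewrite inE => /forallP/(_ t)/eqP ->.
by congr (_ * _).
Qed.

Lemma translation_value_onto h : h \in s -> h \is a GRing.unit ->
  (forall g, g \in s -> g * h \in s) -> exists p, translation_value p = h.
Proof.
move=> hs uh sh; pose f (t : T) : T := SeqSub (sh _ (valP t)).
have f_inj : injective f by move=> t u /(congr1 val) /= /(mulIr uh) /val_inj.
have pG : perm f_inj \in translations_group.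
  by rewrite inE; apply/forallP => t; rewrite !permE /= mul1r.
by exists (subg translations_group (perm f_inj));
  rewrite /translation_value subgK // permE /= mul1r.
Qed.

End Cayley.

Lemma finite_group_rep (F : fieldType) n (H : set 'M[F]_n.+1) :
  linear_group H -> finite_set H ->
  exists (gT : finGroupType) (rho : gT -> 'M[F]_n.+1),
    [/\ forall x y, rho (x * y)%g = rho x * rho y, injective rho & range rho = H].
Proof.
move=> lH fH; have [s [us sH _]] := finite_group_enum lH fH; have [uH H1 HM _] := lH.
have s1 : 1 \in s by apply/sH.
exists (subg_of (translations_group s1)), (@translation_value _ _ s s1); split.
- exact: translation_valueM.
- exact: translation_value_inj.
apply/seteqP; split=> [_ [p _ <-]|h Hh]; first by apply/sH; exact: valP.
have [|||p <-] := @translation_value_onto _ _ s s1 h; last by exists p.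
- exact/sH.
- exact: uH.
- by move=> g /sH Hg; apply/sH/HM.
Qed.

(** * Coxeter systems of orthogonal reflection groups *)

Section OrthogonalModels.
Variables (R : realType) (n : nat) (H : set 'M[R]_n.+1).
Hypotheses (lH : linear_group H) (fH : finite_set H).
Hypothesis gH : generated_by (@reflection _ _) H.
Hypothesis oH : forall h, H h -> h^T * h = 1.

Section Representation.
Variables (gT : finGroupType) (rho : gT -> 'M[R]_n.+1).
Hypothesis rhoM : forall x y, rho (x * y)%g = rho x * rho y.
Hypothesis rho_inj : injective rho.
Hypothesis rhoH : range rho = H.
Variables (r : nat) (al : 'I_r -> 'cV[R]_n.+1).
Hypothesis sb : simple_base H al.
Variable s : 'I_r -> gT.
Hypothesis sE : forall i, rho (s i) = refl (al i).

Let rhoU x : rho x \is a GRing.unit.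
Proof. by case: lH => + _ _ _; apply; rewrite -rhoH; exists x. Qed.

Let m i j : nat := #[(s i * s j)%g]%g.

Lemma rep_words x : exists w : seq 'I_r, x = (\prod_(i <- w) s i)%g.
Proof.
have [|w wE] := simple_base_words lH fH oH sb gH (h := rho x); first by rewrite -rhoH; exists x.
exists w; apply: rho_inj; rewrite (rep_prod rhoM rhoU) wE.
by apply: eq_bigr => i _; rewrite sE.
Qed.

Lemma rep_gens_sqr i : (s i * s i = 1)%g.
Proof.
apply: rho_inj; rewrite rhoM sE (rep1 rhoM rhoU) refl_sqr //.
by have [/(_ i)[]] := sb.
Qed.

Lemma rep_order_diag i : m i i = 1%N.
Proof. by rewrite /m rep_gens_sqr order1. Qed.

Lemma rep_order_off i j : i != j ->
  (1 < m i j)%N /\ dotv (al i) (al j) = - cos (pi / (m i j)%:R).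
Proof.
move=> ij; have [q [q1 dE pq nq]] := simple_base_angle lH oH sb ij.
suff -> : m i j = q by [].
apply: (rep_order rhoM rho_inj rhoU); rewrite ?(ltnW q1) // rhoM !sE //.
Qed.

Lemma rep_gram i j : dotv (al i) (al j) = - cos (pi / (m i j)%:R).
Proof.
have [<-|/rep_order_off[]//] := eqVneq i j.
rewrite rep_order_diag divr1 cospi opprK.
by have [/(_ i)[]] := sb.
Qed.

Lemma rep_gens_inj : injective s.
Proof.
move=> i j ss; apply/eqP/negPn/negP => /rep_order_off[+ _].
by rewrite /m ss rep_gens_sqr order1.
Qed.

(** Only the extension of [f] needs an idea. Equality of words in [K] alone need not be compatible
    with the matrices, so the congruence [E] asks for equality in both. Faithfulness then says that
    a word trivial as a matrix is trivial in [K], so the value of [f] on a word depends only on the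
    group element. *)
Lemma rep_coxeter_system : coxeter_system (s @: [set: 'I_r])%SET.
Proof.
split.
- apply/setP => x; rewrite !inE; have [w ->] := rep_words x.
  by apply: group_prod => i _; apply: mem_gen; apply: imset_f.
- move=> _ /imsetP[i _ ->]; apply: nt_prime_order => //; first by rewrite expgS expg1 rep_gens_sqr.
  apply/eqP => s1; apply: (reflection_neq1 (g := refl (al i))).
    by apply: refl_reflection; have [/(_ i)[]] := sb.
  by rewrite -sE s1 (rep1 rhoM rhoU).
move=> K f fr.
pose b i : 'rV[R]_n.+1 := (al i)^T.
have form i j : (b i *m al j) 0 0 = - cos (pi / (m i j)%:R) by rewrite -rep_gram.
have m_sym i j : m i j = m j i.
  rewrite /m -orderV invMg; congr #[(_ * _)%g]%g; apply/eqP;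
  by rewrite eq_invg_mul rep_gens_sqr.
have m_off i j : i != j -> (1 < m i j)%N by move=> /rep_order_off[].
have wmE (w : seq 'I_r) : wmx al b w = rho (\prod_(i <- w) s i)%g.
  by rewrite (rep_prod rhoM rhoU); apply: eq_bigr => i _; rewrite sE.
pose fw (w : seq 'I_r) := (\prod_(i <- w) f (s i))%g.
pose E (u v : seq 'I_r) := fw u = fw v /\ wmx al b u = wmx al b v.
have Erefl u : E u u by [].
have Esym u v : E u v -> E v u by move=> [e1 e2]; split; rewrite ?e1 ?e2.
have Etrans u v w : E u v -> E v w -> E u w by move=> [e1 e2] [f1 f2]; split; rewrite ?e1 ?e2.
have Ecat u u' v v' : E u u' -> E v v' -> E (u ++ v) (u' ++ v').
  move=> [e1 e2] [f1 f2]; split; last by rewrite !wmx_cat e2 f2.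
  by rewrite /fw !big_cat /=; congr (_ * _)%g.
have Ebraid i j : E (flatten (nseq (m i j) [:: i; j])) [::].
  split; last by rewrite wmx_nil (wmx_braid rep_order_diag m_sym m_off form).
  have := fr (s i) (s j); rewrite !imset_f // -/(m i j) => /(_ isT isT) E1.
  rewrite /fw big_nil -[RHS]E1; elim: (m i j) => [|k IH]; first by rewrite /= big_nil expg0.
  rewrite expgS -IH (_ : flatten (nseq k.+1 _) = [:: i; j] ++ flatten (nseq k [:: i; j])) //.
  by rewrite big_cat big_cons big_seq1.
have Ewmx u v : E u v -> wmx al b u = wmx al b v by case.
have [lam lamE] := simple_base_dual (fun=> 1) sb.
have lam0 i : 0 < (lam^T *m al i) 0 0 by rewrite -/(dotv _ _) lamE.
have faithful w := wmx_faithful rep_order_diag m_sym m_off form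
   Erefl Esym Etrans Ecat Ebraid Ewmx lam0 (w := w).
have fs2 i : (f (s i) * f (s i) = 1)%g.
  by have := fr (s i) (s i); rewrite !imset_f // -/(m i i) rep_order_diag => /(_ isT isT).
have fwV u : (fw (rev u) * fw u = 1)%g.
  rewrite /fw; elim: u => [|i u IH]; first by rewrite !big_nil mulg1.
  by rewrite rev_cons -cats1 big_cat big_seq1 big_cons mulgA -[X in (X * _)%g]mulgA fs2 mulg1.
have wmV u : wmx al b (rev u) *m wmx al b u = 1.
  rewrite !wmE mulmxE -rhoM -(rep1 rhoM rhoU); congr rho.
  elim: u => [|i u IH]; first by rewrite !big_nil mulg1.
  by rewrite rev_cons -cats1 big_cat big_seq1 big_cons mulgA -[X in (X * _)%g]mulgA rep_gens_sqr
    mulg1.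
have fwE u v : (\prod_(i <- u) s i = \prod_(i <- v) s i)%g -> fw u = fw v.
  move=> uv; have : wmx al b (rev u ++ v) = 1.
    by rewrite wmx_cat [wmx al b v]wmE -uv -wmE wmV.
  move=> /faithful[]; rewrite /fw big_nil big_cat /= -/(fw _) -/(fw v) => E1 _.
  by apply: (mulgI (fw (rev u))); rewrite fwV E1.
(* The extension evaluates [f] on a chosen word for each element; [fwE] makes this
   multiplicative. *)
have /choice[W WE] := rep_words.
exists (fun x => fw (W x)); split.
  move=> x y; rewrite (fwE (W (x * y)%g) (W x ++ W y)); first by rewrite /fw big_cat.
  by rewrite big_cat /= -!WE.
move=> _ /imsetP[i _ ->]; rewrite (fwE _ [:: i]); first by rewrite /fw big_seq1.
by rewrite big_seq1 -WE.
Qed.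

End Representation.

Lemma orthogonal_coxeter_model : exists c, coxeter_model H c.
Proof.
have [gT [rho [rhoM rho_inj rhoH]]] := finite_group_rep lH fH.
have [r [al sb]] := simple_base_ex lH fH oH.
have /choice[s sE] i : exists x, rho x = refl (al i).
  have [/(_ i)[_]] := sb; rewrite -rhoH => -[x _ <-] _ _; by exists x.
exists (FinCoxeter (rep_coxeter_system rhoM rho_inj rhoH sb sE)), rho; split=> //=.
have -> : rho @` [set` (s @: [set: 'I_r])%SET] = range (fun i => refl (al i)).
  apply/seteqP; split=> [_ [_ /imsetP[i _ ->] <-]|_ [i _ <-]]; first by exists i.
  by exists (s i) => //=; apply: imset_f.
exact: simple_base_reflections.
Qed.

Lemma coxeter_model_base c : coxeter_model H c ->
  exists (rho : cox_group c -> 'M[R]_n.+1) r (al : 'I_r -> 'cV[R]_n.+1) (s : 'I_r -> cox_group c),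
  [/\ [/\ forall x y, rho (x * y)%g = rho x * rho y, injective rho & range rho = H],
      simple_base H al, forall i, rho (s i) = refl (al i),
      range (fun i => refl (al i)) = rho @` [set` cox_gens c]
    & cox_gens c = (s @: [set: 'I_r])%SET].
Proof.
move=> [rho [rhoM rho_inj rhoH /(simple_reflections_base oH)[r [al [sb SE]]]]].
have /choice[s sE] i : exists x, x \in cox_gens c /\ rho x = refl (al i).
  have : (range (fun i => refl (al i))) (refl (al i)) by exists i.
  by rewrite -SE => -[x xc <-]; exists x.
exists rho, r, al, s; split=> //; first by move=> i; case: (sE i).
apply/setP => x; apply/idP/imsetP => [xc|[i _ ->]]; last by case: (sE i).
have : (rho @` [set` cox_gens c]) (rho x) by exists x.
by rewrite SE => -[i _ xi]; exists i => //; apply: rho_inj; rewrite -xi; case: (sE i).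
Qed.

Lemma coxeter_model_rank c : H <> [set 1] -> coxeter_model H c -> (1 <= cox_rank c <= n.+1)%N.
Proof.
move=> H1 /coxeter_model_base[rho [r [al [s [[rhoM rho_inj rhoH] sb sE _ SE]]]]].
have rE : cox_rank c = r.
  rewrite /cox_rank SE card_imset ?cardsT ?card_ord //.
  exact: (rep_gens_inj rhoM rho_inj rhoH sb sE).
rewrite rE (simple_base_rank sb) andbT lt0n; apply/eqP => r0; apply: H1.
apply/seteqP; split=> [h Hh|_ ->]; last by case: lH.
have [w ->] := simple_base_words lH fH oH sb gH Hh.
by case: w => [|i w];
  [rewrite big_nil | by have := leq_trans (leq_ltn_trans (leq0n i) (ltn_ord i)) (eq_leq r0)].
Qed.

Lemma coxeter_model_uniq c d : coxeter_model H c -> coxeter_model H d -> cox_iso c d.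
Proof.
move=> /coxeter_model_base[rho [r [al [s [[rhoM rho_inj rhoH] sb _ SE _]]]]].
move=> /coxeter_model_base[rho' [r' [al' [s' [[rhoM' rho_inj' rhoH'] sb' _ SE' _]]]]].
have [w Hw wE] := simple_base_uniq lH fH oH sb' sb; rewrite SE SE' in wE.
have [uH H1 HM HV] := lH; have uw : w \is a GRing.unit := uH _ Hw.
have /choice[f fE] x : exists y, rho' y = w * rho x * w^-1.
  have : H (w * rho x * w^-1).
    by apply: (HM _ _ (HM _ _ Hw _) (HV _ Hw)); rewrite -rhoH; exists x.
  by rewrite -rhoH' => -[y _ <-]; exists y.
have fM : {in [set: cox_group c]%SET &, {morph f : x y / (x * y)%g}}.
  by move=> x y _ _; apply: rho_inj'; rewrite rhoM' !fE rhoM conjgM_mx.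
have f_inj : injective f.
  move=> x y xy; apply: rho_inj; have := congr1 rho' xy; rewrite !fE.
  by move=> /(mulIr _)/(mulrI _); apply; rewrite ?unitrV.
exists (Morphism fM); split.
  apply/isomP; split; first by apply/injmP => x y _ _; exact: f_inj.
  rewrite morphimEdom; apply/setP => y; rewrite inE; apply/imsetP.
  have : H (w^-1 * rho' y * w).
    by apply: (HM _ _ (HM _ _ (HV _ Hw) _) Hw); rewrite -rhoH'; exists y.
  rewrite -rhoH => -[x _ xE]; exists x; rewrite ?inE //.
  by apply: rho_inj'; rewrite fE xE conjrK.
apply/setP => y; apply/imsetP/idP => [[x xc ->]|yd].
  have : (rho' @` [set` cox_gens d]) (rho' (f x)).
    by rewrite wE fE; exists (rho x) => //; exists x.
  by move=> [y' y'd /rho_inj' E]; rewrite /= -E.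
have : (rho' @` [set` cox_gens d]) (rho' y) by exists y.
rewrite wE => -[_ [x xc <-]]; rewrite -fE => /rho_inj' xy; by exists x.
Qed.

End OrthogonalModels.

(** Both Gram matrices are read off from the orders of products in [c]. The resulting isometry of
    the whole space conjugates simple reflections to simple reflections, hence one representation to
    the other. *)
Lemma orthogonal_coxeter_model_conj (R : realType) n (H H' : set 'M[R]_n.+1) c :
  linear_group H -> finite_set H -> generated_by (@reflection _ _) H ->
  (forall h, H h -> h^T * h = 1) ->
  linear_group H' -> finite_set H' -> generated_by (@reflection _ _) H' ->
  (forall h, H' h -> h^T * h = 1) ->
  coxeter_model H c -> coxeter_model H' c -> conjugate_groups H H'.
Proof.
move=> lH fH gH oH lH' fH' gH' oH'.
move=> /(coxeter_model_base oH)[rho [r [al [s [[rhoM rho_inj rhoH] sb sE SE cE]]]]].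
move=> /(coxeter_model_base oH')[rho' [r' [al' [s' [[rhoM' rho_inj' rhoH'] sb' sE' SE' cE']]]]].
have /choice[t tE] i : exists j, s i = s' j.
  have : s i \in cox_gens c by rewrite cE imset_f.
  by rewrite cE' => /imsetP[j _ ->]; exists j.
have gram i j : dotv (al i) (al j) = dotv (al' (t i)) (al' (t j)).
  rewrite (rep_gram lH oH rhoM rho_inj rhoH sb sE).
  by rewrite (rep_gram lH' oH' rhoM' rho_inj' rhoH' sb' sE') !tE.
have [Q [QQ Qa]] := gram_isometry gram; have uQ := orthogonal_unit QQ.
have Qrho x : Q * rho x * Q^-1 = rho' x.
  have [w ->] := rep_words lH fH gH oH rhoM rho_inj rhoH sb sE x.
  have rhoU y : rho y \is a GRing.unit by case: lH => + _ _ _; apply; rewrite -rhoH; exists y.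
  have rhoU' y : rho' y \is a GRing.unit by case: lH' => + _ _ _; apply; rewrite -rhoH'; exists y.
  rewrite (rep_prod rhoM rhoU) (rep_prod rhoM' rhoU').
  elim: w => [|i w IH]; first by rewrite !big_nil conjg1_mx.
  by rewrite !big_cons conjgM_mx // IH sE refl_conj // Qa tE sE'.
exists Q => //; rewrite -rhoH -rhoH' image_comp; apply/seteqP.
by split=> _ [x _ <-]; exists x => //=; rewrite Qrho.
Qed.

(** * Transport of models along conjugation and isomorphism *)

Section Transport.
Variables (R : realType) (n : nat).
Implicit Types (H : set 'M[R]_n.+1) (x : 'M[R]_n.+1).

Lemma reflection_conjV x (h : 'M[R]_n.+1) : x \is a GRing.unit ->
  reflection (x * h * x^-1) -> reflection h.
Proof.
move=> ux; have uV : x^-1 \is a GRing.unit by rewrite unitrV.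
by move=> /(reflection_conj uV); rewrite invrK conjrVK.
Qed.

Lemma root_vector_conj H x v : x \is a GRing.unit ->
  root_vector ((fun h => x * h * x^-1) @` H) (x *m v) <-> root_vector H v.
Proof.
move=> ux; have xK (u : 'cV[R]_n.+1) : x^-1 *m (x *m u) = u.
  by rewrite mulmxA [x^-1 *m x]mulVr // mul1mx.
split=> -[v0 [s]].
  move=> [[h Hh <-] rh hv]; split; first by move=> v1; apply: v0; rewrite v1 mulmx0.
  exists h; split=> //; last first.
    rewrite -[h *m v]xK -[v in RHS]xK -mulmxN -hv -!mulmxE -!mulmxA; do 2!congr (_ *m _).
    by rewrite xK.
  exact: (reflection_conjV ux).
move=> [Hs rs sv]; split; first by move=> xv; apply: v0; rewrite -(xK v) xv mulmx0.
exists (x * s * x^-1); split; [by exists s|exact: reflection_conj|].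
by rewrite -!mulmxE -!mulmxA xK sv mulmxN.
Qed.

Lemma simple_reflections_conj H S x : x \is a GRing.unit -> simple_reflections H S ->
  simple_reflections ((fun h => x * h * x^-1) @` H) ((fun h => x * h * x^-1) @` S).
Proof.
move=> ux [r [A [rk rA sg ->]]]; have xU : x \in unitmx by [].
have colx i : col i (x *m A) = x *m col i A by rewrite !colE mulmxA.
exists r, (x *m A); split.
- by rewrite -[RHS]rk (eqmxMfull A) // row_full_unit.
- by move=> i; rewrite colx; apply/root_vector_conj.
- move=> v rv; have [|c vE c0] := sg (x^-1 *m v).
    by apply/(root_vector_conj _ _ ux); rewrite mulmxA [x *m x^-1]mulrV // mul1mx.
  exists c => //; rewrite -mulmxA -vE mulmxA [x *m x^-1]mulrV // mul1mx //.
have key h i : (x * h * x^-1) *m col i (x *m A) = x *m (h *m col i A).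
  by rewrite colx -!mulmxE -!mulmxA [x^-1 *m (x *m _)]mulmxA [x^-1 *m x]mulVr // mul1mx.
apply/seteqP; split=> [_ [h [Hh rh [i hi]] <-]|_ [[h Hh <-] rh [i hi]]].
  split; [by exists h|exact: reflection_conj|exists i].
  by rewrite key hi colx mulmxN.
exists h => //; split=> //; first exact: (reflection_conjV ux).
exists i; apply: (can_inj (mulKmx xU)); by rewrite -key hi colx mulmxN.
Qed.

Lemma coxeter_model_conj H H' c : conjugate_groups H H' ->
  coxeter_model H c -> coxeter_model H' c.
Proof.
move=> [x ux ->] [rho [rhoM rho_inj rhoH sr]].
exists (fun y => x * rho y * x^-1); split.
- by move=> y z; rewrite rhoM conjgM_mx.
- by move=> y z /(mulIr _)/(mulrI _) E; apply: rho_inj; apply: E; rewrite ?unitrV.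
- by rewrite -rhoH image_comp.
- by have := simple_reflections_conj ux sr; rewrite image_comp.
Qed.

Lemma coxeter_model_iso H c d : coxeter_model H c -> cox_iso c d -> coxeter_model H d.
Proof.
move=> [rho [rhoM rho_inj rhoH sr]] [f [/isomP[/injmP f_inj fT] fS]].
have /choice[g gK] (y : cox_group d) : exists z : cox_group c, f z = y.
  have : y \in (f @* [set: cox_group c]%SET)%g by rewrite fT inE.
  by rewrite morphimEdom => /imsetP[z _ ->]; exists z.
have fI (y z : cox_group c) : f y = f z -> y = z by move=> xy; apply: f_inj; rewrite ?inE.
have gM y z : g (y * z)%g = (g y * g z)%g.
  by apply: fI; rewrite gK morphM ?inE // !gK.
exists (rho \o g); split.
- by move=> y z; rewrite /= gM rhoM.
- by move=> y z /rho_inj yz; rewrite -(gK y) yz gK.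
- rewrite -rhoH; apply/seteqP; split=> [_ [y _ <-]|_ [x _ <-]]; first by exists (g y).
  by exists (f x) => //=; congr rho; apply: fI; rewrite gK.
suff -> : (rho \o g) @` [set` cox_gens d] = rho @` [set` cox_gens c] by [].
rewrite -fS; apply/seteqP; split=> [_ [_ /imsetP[x xc ->] <-]|_ [x xc <-]].
  by exists x => //=; congr rho; apply: fI; rewrite gK.
exists (f x); first exact: imset_f.
by rewrite /=; congr rho; apply: fI; rewrite gK.
Qed.

Lemma cox_iso_refl c : cox_iso c c.
Proof.
exists (idm_morphism [set: cox_group c]%G); split; first exact: idm_isom.
by apply/setP => x; apply/imsetP/idP => [[y yc ->]//|xc]; exists x.
Qed.

End Transport.

(** * Real reflection groups and finite Coxeter systems *)

Section RealReflectionGroups.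
Variable R : realType.
Implicit Types (H : set 'M[R]_3).

Lemma real_reflection_group_orthogonal H : real_reflection_groups H ->
  exists H', [/\ conjugate_groups H H', real_reflection_groups H'
               & forall h, H' h -> h^T * h = 1].
Proof.
move=> rH; have [lH fH _ _] := rH; have [x ux oH] := finite_group_orthogonalizable lH fH.
exists ((fun h => x * h * x^-1) @` H); split; first by exists x.
  exact: real_reflection_groups_conj.
by move=> _ [h Hh <-]; exact: oH.
Qed.

Lemma coxeter_model_ex H : real_reflection_groups H -> exists c, coxeter_model H c.
Proof.
move=> /real_reflection_group_orthogonal[H' [HH' [lH fH gH _] oH]].
have [c cH] := orthogonal_coxeter_model lH fH gH oH.
by exists c; apply: coxeter_model_conj cH; exact: conj_groups_sym.
Qed.

Lemma real_coxeter_model_rank H c : real_reflection_groups H -> coxeter_model H c ->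
  (1 <= cox_rank c <= 3)%N.
Proof.
move=> /real_reflection_group_orthogonal[H' [HH' [lH fH gH H1] oH]] /(coxeter_model_conj HH').
exact: coxeter_model_rank.
Qed.

Lemma real_coxeter_model_uniq H c d : real_reflection_groups H ->
  coxeter_model H c -> coxeter_model H d -> cox_iso c d.
Proof.
move=> /real_reflection_group_orthogonal[H' [HH' [lH fH gH H1] oH]].
move=> /(coxeter_model_conj HH') cH /(coxeter_model_conj HH').
exact: coxeter_model_uniq.
Qed.

Lemma real_coxeter_model_conj H K c : real_reflection_groups H -> real_reflection_groups K ->
  coxeter_model H c -> coxeter_model K c -> conjugate_groups H K.
Proof.
move=> /real_reflection_group_orthogonal[H' [HH' [lH fH gH H1] oH]].
move=> /real_reflection_group_orthogonal[K' [KK' [lK fK gK K1] oK]].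
move=> /(coxeter_model_conj HH') cH /(coxeter_model_conj KK') cK.
apply: conj_groups_trans HH' _; apply: conj_groups_trans (conj_groups_sym KK').
exact: orthogonal_coxeter_model_conj cH cK.
Qed.

Lemma coxeter_bijection :
  exists Psi : set (set 'M[R]_3) -> (finCoxeter -> Prop),
    bij_between (@conj_class _ _ @` real_reflection_groups (R := R))
                small_rank_cox_classes Psi /\
    forall H, real_reflection_groups H ->
      (exists c, coxeter_model H c) /\
      (forall c, coxeter_model H c -> Psi (conj_class H) = cox_class c).
Proof.
pose Psi (X : set (set 'M[R]_3)) : finCoxeter -> Prop :=
  fun d => exists H, [/\ real_reflection_groups H, X = conj_class H & coxeter_model H d].
have PsiE H c : real_reflection_groups H -> coxeter_model H c ->
    Psi (conj_class H) = cox_class c.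
  move=> rH cH; apply/funext => d; apply/propext; split.
    move=> [H' [rH' /conj_classE HH' dH']]; apply: (real_coxeter_model_uniq rH cH).
    by apply: coxeter_model_conj dH'; exact: conj_groups_sym.
  by move=> cd; exists H; split=> //; exact: coxeter_model_iso cd.
exists Psi; split; last first.
  by move=> H rH; split=> [|c]; [exact: coxeter_model_ex | exact: PsiE].
split.
- move=> _ [H rH <-]; have [c cH] := coxeter_model_ex rH.
  exists c; first exact: real_coxeter_model_rank cH.
  exact: PsiE.
- move=> _ _ [H rH <-] [K rK <-]; have [c cH] := coxeter_model_ex rH.
  have [d dK] := coxeter_model_ex rK; rewrite (PsiE _ _ rH cH) (PsiE _ _ rK dK) => E.
  have cd : cox_class c d by rewrite E; exact: cox_iso_refl.
  apply/conj_classE; exact: real_coxeter_model_conj rH rK (coxeter_model_iso cH cd) dK.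
- move=> K [c /andP[c1 c3] ->].
  have [H [rH cH]] := cox_group_model R c3 c1.
  by exists (conj_class H); [exists H | exact: PsiE].
Qed.

End RealReflectionGroups.

Theorem mainTheorem2 (R : realType) :
  [/\ (* phi (W) is a finite subgroup of GL(V), isomorphic to W / {1, -1} *)
      forall W : set 'M[R[i]]_2,
        linear_group W -> finite_set W -> W (- 1) ->
        [/\ linear_group (@phi R[i] @` W), finite_set (@phi R[i] @` W),
            forall g h, W g -> W h -> phi (g * h) = phi g * phi h
          & forall g h, W g -> W h -> phi g = phi h <-> h = g \/ h = - g],
      (* it preserves the quadratic form and a real structure *)
      nondegenerate_form (@quadR R[i]),
      forall W : set 'M[R[i]]_2, order2_reflection_groups W ->
        preserves_form (@quadR R[i]) (@phi R[i] @` W) /\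
        exists2 U, real_structure U & stabilizes (@phi R[i] @` W) U,
      (* W |-> phi (W) induces a bijection on conjugacy classes *)
      exists Phi : set (set 'M[R[i]]_2) -> set (set 'M[R]_3),
        set_bij (@conj_class _ _ @` order2_reflection_groups (R := R))
                (@conj_class _ _ @` real_reflection_groups (R := R)) Phi /\
        forall W, order2_reflection_groups W ->
          (exists H, real_model (@phi R[i] @` W) H) /\
          (forall H, real_model (@phi R[i] @` W) H ->
             Phi (conj_class W) = conj_class H)
    & (* real reflection groups and Coxeter systems of rank 1 to 3 *)
      exists Psi : set (set 'M[R]_3) -> (finCoxeter -> Prop),
        bij_between (@conj_class _ _ @` real_reflection_groups (R := R))
                    small_rank_cox_classes Psi /\
        forall H, real_reflection_groups H ->
          (exists c, coxeter_model H c) /\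
          (forall c, coxeter_model H c -> Psi (conj_class H) = cox_class c)].
Proof.
split.
- by move=> W lW fW WN; exact: phi_group_spec.
- by apply: quadR_nondegenerate; rewrite pnatr_eq0.
- by move=> W oW; exact: phi_group_preserves.
- exact: order2_groups_bijection.
- exact: coxeter_bijection.
Qed.
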